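(* Let $[a,b]\subseteq(0,2]$, let $\alpha:\mathbb{R}\to[a,b]$ be continuous, and let $$Y(t)=\int f(t,x)\,dM_\alpha(x),\qquad t\in\mathbb{R},$$ where $M_\alpha$ is an $\alpha(x)$-multistable measure. Let $u\in\mathbb{R}$. Assume that $f(t,\cdot)\in\mathcal{F}_{a,b}$ for all $t$ and $$\lim_{r\to0}\int\Big|\frac{f(u+rt,u+rz)-f(u,u+rz)}{r^{h-1/\alpha(u+rz)}}-H(t,z)\Big|^{a,b}dz=0$$ for a jointly measurable function $H(t,z)$ with $H(t,\cdot)\in\mathcal{F}_{a,b}$ for all $t$. Then $Y$ is $h$-localisable at $u$ with local form $$Y_u'=\Big\{\int H(t,z)\,dM_{\alpha(u)}(z):t\in\mathbb{R}\Big\},$$ where $M_{\alpha(u)}$ is $\alpha(u)$-stable measure. If, in addition, there exists $\eta>1/a$ such that for each bounded interval $I$ we can find $c>0$ such that $$\Big\|\frac{f(u+rt,\cdot)-f(u+rv,\cdot)}{r^h}\Big\|_\alpha\le c|t-v|^\eta\qquad(t,v\in I)\qquad( * )$$ for all sufficiently small $r>0$, then $Y$ is strongly localisable at $u$. Condition $( * )$ is implied by $$\int\Big|\frac{f(u+rt,u+rz)-f(u+rv,u+rz)}{r^{h-1/\alpha(u+rz)}}\Big|^{\alpha(u+rz)}dz\le c_1|t-v|^{a\eta}\qquad(t,v\in I).$$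
   Context: Integrals without limits are over $\mathbb{R}$. Notation: $|y|^{a,b}=\max\{|y|^a,|y|^b\}$; $\mathcal{F}_{a,b}$ is the space of measurable $g:\mathbb{R}\to\mathbb{R}$ with $\int|g(x)|^{a,b}dx<\infty$. For measurable $\alpha:\mathbb{R}\to[a,b]$, $\mathcal{F}_\alpha$ is the space of measurable $g$ with $\|g\|_\alpha<\infty$, where $\|g\|_\alpha$ is the number $\lambda>0$ with $\int|g(x)/\lambda|^{\alpha(x)}dx=1$ (and $\|g\|_\alpha=0$ if $g=0$ a.e.); every $g\in\mathcal{F}_{a,b}$ belongs to $\mathcal{F}_\alpha$. The $\alpha(x)$-multistable integral is a stochastic process $\{I(g):g\in\mathcal{F}_\alpha\}$ with $$\mathbb{E}\Big(\exp i\sum_{j=1}^d\theta_jI(g_j)\Big)=\exp\Big\{-\int\Big|\sum_{j=1}^d\theta_jg_j(x)\Big|^{\alpha(x)}dx\Big\}$$ for all $d\in\mathbb{N}$, $g_1,\dots,g_d\in\mathcal{F}_\alpha$, $\theta_1,\dots,\theta_d\in\mathbb{R}$ (such a process exists). One writes $\int g\,dM_\alpha:=I(g)$, where $M_\alpha(A)=I(\mathbf{1}_A)$, for Lebesgue measurable $A$ of finite measure, is the $\alpha(x)$-multistable measure. $M_{\alpha(u)}$ denotes the same object for the constant index function equal to $\alpha(u)$ ($\alpha(u)$-stable measure). A process $Y=\{Y(t):t\in\mathbb{R}\}$ is $h$-localisable at $u$ with local form (tangent process) $Y_u'=\{Y_u'(t):t\in\mathbb{R}\}$ if $$\frac{Y(u+rt)-Y(u)}{r^h}\to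 Y_u'(t)$$ in finite-dimensional distributions (as processes in $t$) as $r\to0$, $r>0$. If $Y$ and $Y_u'$ have versions in $C(\mathbb{R})$ (the space of continuous functions on $\mathbb{R}$) and this convergence occurs in distribution with respect to the metric of uniform convergence on bounded intervals, $Y$ is strongly localisable at $u$.
   Formalization: If ''sufficiently small r'' depends on I, strong localisability is proved with Y's continuous version only near u, or on R if Y has one; in full if r's range is independent of I. The last condition gives ( * ) with exponent aη/b, not η, and strong localisability in the same forms. *)

(* Defs.v *)
From HB Require Import structures.
From mathcomp Require Import all_boot all_order all_algebra.
From mathcomp Require Import all_classical all_reals all_analysis.
From mathcomp Require Import measurable_realfun.

Set Implicit Arguments.
Unset Strict Implicit.
Unset Printing Implicit Defensive.
Import Order.TTheory GRing.Theory Num.Theory.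
Import numFieldNormedType.Exports.
Local Open Scope classical_set_scope.
Local Open Scope ring_scope.

Notation leb := completed_lebesgue_measure.

(* The line with the sigma-algebra of Lebesgue (not only Borel) measurable
   sets, on which [completed_lebesgue_measure] is defined; its carrier is R. *)
Notation lebesgueR R := (caratheodory_type (wlength (@idfun R))^*%mu).

Definition lebesgue_measurable_fun (R : realType) (g : R -> R) : Prop :=
  measurable_fun [set: lebesgueR R] (g : lebesgueR R -> R).

(* Measurability for the completion of two-dimensional Lebesgue measure. *)
Definition jointly_measurable_fun (R : realType) (H : R -> R -> R) : Prop :=
  forall B : set R, measurable B ->
    completed_algebra_gen (@lebesgue_measure R \x @lebesgue_measure R)%E
      [set tz | B (H tz.1 tz.2)].

Definition bounded_interval (R : realType) (A : set R) : Prop :=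
  is_interval A /\ bounded_set A.

Section FunctionSpaces.
Context {R : realType}.
Local Open Scope ereal_scope.

Definition powmax (a b y : R) : R := Num.max (`|y| `^ a)%R (`|y| `^ b)%R.

Definition Fab (a b : R) (g : R -> R) : Prop :=
  lebesgue_measurable_fun g /\ \int[leb]_x (powmax a b (g x))%:E < +oo.

(* The value is +oo when g is not a.e. zero and no such l exists. *)
Definition Fnorm (alpha g : R -> R) : \bar R :=
  if `[< {ae leb, forall x, g x = 0%R} >] then 0
  else xget +oo [set l%:E | l in
    [set l : R | (0 < l)%R /\ \int[leb]_x (`|g x / l| `^ alpha x)%:E = 1]].

Definition Falpha (alpha g : R -> R) : Prop :=
  lebesgue_measurable_fun g /\ Fnorm alpha g < +oo.

(* I g is the integral of g with respect to the alpha(x)-multistable measure.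
   The complex identity for the joint characteristic function is split into its
   real and imaginary parts. *)
Definition multistable_integral (d : measure_display) (T : measurableType d)
    (P : probability T R) (alpha : R -> R) (I : (R -> R) -> T -> R) : Prop :=
  (forall g, Falpha alpha g -> measurable_fun [set: T] (I g)) /\
  (forall (n : nat) (g : 'I_n -> R -> R) (theta : 'I_n -> R),
    (forall j, Falpha alpha (g j)) ->
    'E_P[fun w => cos (\sum_j theta j * I (g j) w)] =
      expeR (- \int[leb]_x (`|\sum_j theta j * g j x| `^ alpha x)%:E) /\
    'E_P[fun w => sin (\sum_j theta j * I (g j) w)] = 0).

End FunctionSpaces.

(* X r converges in distribution to X' as r decreases to 0. *)
Definition cvg_in_distribution (R : realType) (S : topologicalType)
    (d d' : measure_display) (T : measurableType d) (T' : measurableType d')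
    (P : probability T R) (P' : probability T' R)
    (X : R -> T -> S) (X' : T' -> S) : Prop :=
  forall phi : S -> R, continuous phi ->
    (exists M : R, forall s, `|phi s| <= M) ->
    ('E_P[phi \o X r] @[r --> 0^'+] --> 'E_P'[phi \o X'])%E.

(* C(R), topologised by uniform convergence on bounded intervals. *)
Definition path_space (R : realType) : topologicalType :=
  initial_topology (fun x : continuousType R R =>
    (x : R -> R) : {family @bounded_interval R, R -> R}).

Section Localisability.
Context {R : realType}.
Context {d d' : measure_display} {T : measurableType d} {T' : measurableType d'}.

Definition localisable (P : probability T R) (P' : probability T' R) (h u : R)
    (Y : R -> T -> R) (Y' : R -> T' -> R) : Prop :=
  forall (n : nat) (t : 'I_n -> R),
    @cvg_in_distribution R 'rV[R]_n d d' T T' P P'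
      (fun r w => \row_j ((Y (u + r * t j) w - Y u w) / r `^ h))
      (fun w => \row_j Y' (t j) w).

Lemma rescaled_path_continuous (h u r : R) (x : continuousType R R) :
  continuous (fun t => (x (u + r * t) - x u) / r `^ h).
Proof.
move=> t; apply: cvgMr_tmp; apply: cvgB; last exact: cvg_cst.
apply: (@continuous_comp _ _ _ (fun t => u + r * t) x); last exact: cts_fun.
by apply: cvgD; [exact: cvg_cst|apply: cvgMl_tmp; exact: cvg_id].
Qed.

Definition rescaled_path (h u r : R) (x : continuousType R R) : path_space R :=
  mkcts (@rescaled_path_continuous h u r x).

End Localisability.

(* Z is a process with paths in C(R) and Z(t) = Y(t) almost surely for each t in
   V.  For V = setT this says that Z is a version of Y in C(R). *)
Definition continuous_version_on (R : realType) (d : measure_display)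
    (T : measurableType d) (P : probability T R) (V : set R)
    (Y : R -> T -> R) (Z : T -> continuousType R R) : Prop :=
  (forall t, measurable_fun [set: T] (fun w => Z w t)) /\
  (forall t, V t -> {ae P, forall w, Z w t = Y t w}).

(* V = setT is the definition with versions of Y and Y' in C(R).  When V is a
   neighbourhood of u, Y needs a continuous version only at the times in V; the
   values of Z away from u do not affect the limit, since any bounded interval
   of times t is mapped into V by u + r t once r is small. *)
Definition strongly_localisable (R : realType) (V : set R)
    (d d' : measure_display) (T : measurableType d) (T' : measurableType d')
    (P : probability T R) (P' : probability T' R) (h u : R)
    (Y : R -> T -> R) (Y' : R -> T' -> R) : Prop :=
  exists (Z : T -> continuousType R R) (Z' : T' -> continuousType R R),
    [/\ continuous_version_on P V Y Z,
        continuous_version_on P' setT Y' Z' &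
        @cvg_in_distribution R (path_space R) d d' T T' P P'
          (fun r w => rescaled_path h u r (Z w)) Z'].

Section Increments.
Context {R : realType} (alpha : R -> R) (f : R -> R -> R) (h u : R).
Local Open Scope ereal_scope.

Definition norm_increments (eta : R) (A : set R) (c r : R) : Prop :=
  forall t v : R, A t -> A v ->
    Fnorm alpha (fun x => (f (u + r * t) x - f (u + r * v) x) / r `^ h)%R
      <= (c * `|t - v| `^ eta)%:E.

Definition integral_increments (kappa : R) (A : set R) (c r : R) : Prop :=
  forall t v : R, A t -> A v ->
    \int[leb]_z (`|(f (u + r * t) (u + r * z) - f (u + r * v) (u + r * z))
                   / r `^ (h - (alpha (u + r * z))^-1)| `^ alpha (u + r * z))%:E
      <= (c * `|t - v| `^ kappa)%:E.

End Increments.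

Definition on_bounded_intervals (R : realType)
    (B : set R -> R -> R -> Prop) : Prop :=
  forall A : set R, bounded_interval A ->
    exists2 c : R, 0 < c & \forall r \near 0^'+, B A c r.

(* The same, but "all sufficiently small r" does not depend on the interval. *)
Definition uniformly_on_bounded_intervals (R : realType)
    (B : set R -> R -> R -> Prop) : Prop :=
  exists2 r0 : R, 0 < r0 & forall A : set R, bounded_interval A ->
    exists2 c : R, 0 < c & forall r : R, 0 < r < r0 -> B A c r.

(* Main.v *)
Require Import Defs.
From HB Require Import structures.
From mathcomp Require Import all_boot all_order all_algebra.
From mathcomp Require Import all_classical all_reals all_analysis.
From mathcomp Require Import measurable_realfun ring lra zify.

Set Implicit Arguments.
Unset Strict Implicit.
Unset Printing Implicit Defensive.
Import Order.TTheory GRing.Theory Num.Theory.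
Import numFieldNormedType.Exports.
Local Open Scope classical_set_scope.
Local Open Scope ring_scope.


(* The characteristic function of a linear combination of the rescaled
   increments of Y is exp(-J), where J is the integral of the |.|^alpha of the
   corresponding combination of kernels.  Substituting x = u + r z absorbs the
   factor r^h into r^(h - 1/alpha(u + r z)), so that J tends to its analogue for
   H and alpha(u): the kernels converge by hypothesis and the exponents because
   alpha is continuous.  Convergence of characteristic functions gives tightness
   and convergence of the means of Lipschitz functions, by approximation with
   trigonometric polynomials, and then of bounded continuous functions, by
   inf-convolution.

   For strong localisability, P(|X| >= l) <= C_a J(1/l) for each integral X, so
   either increment condition bounds the tail of an increment over [v, t] by
   C l^(-b) |t - v|^(a eta) for l <= 1, uniformly in small r, and by passage to
   the limit also for Y'.  Since a eta > 1, chaining along dyadic points yields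
   continuous versions and reduces, uniformly in r, convergence in C(R) to that
   of the finite-dimensional distributions.  A version of Y near u, or on the
   whole line when the same range of r serves all intervals, is recovered from
   the rescaled increments of Y for a single r. *)

(** * Power modulars for the completed Lebesgue measure *)

(** The two increment conditions are not interchangeable with the same exponent: a modular s < 1
    only bounds the norm by s^(1/b), so the integral condition yields the norm condition with a eta
    / b, which may be too small for chaining. Both are therefore brought to a bound on the modular,
    truncated at 1, which keeps the exponent a eta.

    As the indices range over (0, 2], the modular has in general no triangle inequality with
    constant 1. Its substitute is |x + y|^p <= (1 + s)^2 |x|^p + (1 + 1/s)^2 |y|^p, whose first
    factor tends to 1 with s.

    Convergence in distribution is stated through means of continuous functions, while only the
    coordinates of the processes are known to be measurable. Each enlargement of the class of test
    functions has to deliver measurability along with convergence of the means. The functions whose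
    means are read off characteristic functions are almost periodic; they approximate a Lipschitz
    function on boxes only, which is where tightness enters. *)

Section AffineChange.
Context {R : realType}.
Implicit Types (r u : R) (A : set R).
Local Open Scope ereal_scope.
Local Notation mu := ((wlength (@idfun R))^*%mu).
Local Notation aff u r := (fun z : R => u + r * z)%R.

Lemma aff_preimage_itv u r (x y : R) : (0 < r)%R ->
  aff u r @^-1` `]x, y]%classic = `]((x - u) / r)%R, ((y - u) / r)%R]%classic.
Proof.
move=> r0; apply/seteqP; split => z /=; rewrite !in_itv/= ltr_pdivrMr// ler_pdivlMr//.
  by rewrite !(mulrC z) ltrBlDl lerBrDl.
by rewrite !(mulrC z) ltrBlDl lerBrDl.
Qed.

Lemma wlength_aff u r (A : set R) : (0 < r)%R -> ocitv A ->
  wlength idfun (aff u r @^-1` A) = (r^-1)%:E * wlength idfun A.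
Proof.
move=> r0 [[x y] _ <-] /=; rewrite aff_preimage_itv// !wlength_itv/= !lte_fin.
rewrite ltr_pM2r ?invr_gt0// ltrD2r.
case: ifP => _; last by rewrite mule0.
by rewrite -!EFinB -EFinM; congr (_%:E); rewrite -mulrBl mulrC; congr (_ * _)%R; ring.
Qed.

(** A cover by intervals pulls back to a cover by intervals. The same bound for the inverse map
    gives the reverse inequality. Working with the outer measure reaches all Lebesgue measurable
    sets, not only Borel ones. *)
Lemma outer_aff_le u r A : (0 < r)%R ->
  mu (aff u r @^-1` A) <= (r^-1)%:E * mu A.
Proof.
move=> r0; rewrite -ereal_inf_pZl ?invr_gt0//.
apply: le_ereal_inf_tmp => _ [_ [F [mF AF] <-] <-].
rewrite -nneseriesZl; last by move=> i _; exact: wlength_ge0.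
apply: ereal_inf_lbound; exists (fun k => aff u r @^-1` F k).
  split; last by move=> z /= /AF[k _ ?]; exists k.
  move=> i; have /= := mF i => -[[x y] _ <-].
  rewrite (aff_preimage_itv _ _ _ r0). exact: is_ocitv.
by apply: eq_eseriesr => i _; rewrite wlength_aff//; exact: mF.
Qed.

Lemma outer_aff u r A : (0 < r)%R -> mu (aff u r @^-1` A) = (r^-1)%:E * mu A.
Proof.
move=> r0; apply/eqP; rewrite eq_le outer_aff_le//=.
have ri0 : (0 < r^-1)%R by rewrite invr_gt0.
have := @outer_aff_le (- u / r)%R r^-1 (aff u r @^-1` A) ri0.
rewrite -comp_preimage (_ : _ \o _ = id); last first.
  by apply/funext => z /=; field; rewrite gt_eqF.
rewrite preimage_id -(@lee_pmul2l _ (r^-1)%:E)//.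
by rewrite muleA -EFinM invrK mulVf ?gt_eqF// mul1e.
Qed.

(** Continuity does not make preimages of Lebesgue measurable sets measurable; here the Caratheodory
    condition itself is transported, since the outer measure scales by a constant. *)
Lemma measurable_aff u r : (0 < r)%R ->
  measurable_fun [set: lebesgueR R] (aff u r : lebesgueR R -> lebesgueR R).
Proof.
move=> r0 _ A mA; rewrite setTI.
have {}mA : mu.-caratheodory A := mA.
change (mu.-caratheodory (aff u r @^-1` A)) => X.
have ri0 : (0 < r^-1)%R by rewrite invr_gt0.
have E : X = aff u r @^-1` (aff (- u / r)%R r^-1 @^-1` X).
  rewrite -comp_preimage (_ : _ \o _ = id) ?preimage_id//.
  by apply/funext => z /=; field; rewrite gt_eqF.
move: E; set W := (_ @^-1` X) => E.
rewrite [in LHS]E [X in _ = mu (X `&` _) + mu (X `&` _)]E.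
rewrite preimage_setC -!preimage_setI; move: W {E} => W.
rewrite !outer_aff// -ge0_muleDr; [|exact: outer_measure_ge0..].
by congr (_ * _); exact: mA.
Qed.

Lemma leb_aff u r (A : set (lebesgueR R)) : (0 < r)%R ->
  leb (aff u r @^-1` A) = (r^-1)%:E * leb A.
Proof. exact: outer_aff. Qed.

Lemma integral_aff u r (g : lebesgueR R -> \bar R) : (0 < r)%R ->
  measurable_fun setT g -> (forall x, 0 <= g x) ->
  \int[leb]_z (g (u + r * z)%R) = (r^-1)%:E * \int[leb]_x (g x).
Proof.
move=> r0 mg g0.
have ri0 : (0 <= r^-1)%R by rewrite invr_ge0 ltW.
have maff := measurable_aff u r0.
have := @ge0_integral_pushforward _ _ _ _ R _ maff leb setT g measurableT mg.
rewrite preimage_setT => <-; last by move=> ? _; exact: g0.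
rewrite -(@ge0_integral_mscale _ _ _ leb setT measurableT (NngNum ri0))//.
apply: eq_measure_integral => A mA _.
exact: leb_aff.
Qed.

End AffineChange.

(** * Power inequalities for exponents in (0, 2] *)

Section PowerInequalities.
Context {R : realType}.
Implicit Types (a b p s x y : R).

Lemma le_powR2r p x y : 0 <= p -> 0 <= x -> x <= y -> x `^ p <= y `^ p.
Proof.
move=> p0 x0 xy; apply: ge0_ler_powR => //; rewrite nnegrE//.
exact: le_trans xy.
Qed.

Lemma powR_le_powmax a b p y : 0 < a -> a <= p <= b ->
  `|y| `^ p <= powmax a b y.
Proof.
move=> a0 /andP[ap pb]; rewrite /powmax le_max.
have p0 := lt_le_trans a0 ap; have b0 := lt_le_trans p0 pb.
have [->|y0] := eqVneq y 0.
  by rewrite normr0 !powR0 ?lexx// gt_eqF.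
have [y1|y1] := leP `|y| 1.
  by rewrite ger_powR// normr_gt0 y0.
by rewrite [X in _ || X]ler_powR ?orbT// ltW.
Qed.

Lemma powmax_ge0 a b y : 0 <= powmax a b y.
Proof. by rewrite /powmax le_max powR_ge0. Qed.

Lemma powmaxM a b x y : powmax a b (x * y) <= powmax a b x * powmax a b y.
Proof.
by rewrite {1}/powmax ge_max !normrM !powRM// !ler_pM ?powR_ge0//
  /powmax le_max lexx ?orbT.
Qed.

(** If |y| <= s |x| then |x + y| <= (1 + s) |x|, otherwise |x + y| <= (1 + 1/s) |y|, so one of the
    two terms always suffices. The squares make the bound uniform in p <= 2. *)
Lemma powR_normD p s x y : 0 < p <= 2 -> 0 < s ->
  `|x + y| `^ p <= (1 + s) ^+ 2 * `|x| `^ p + (1 + s^-1) ^+ 2 * `|y| `^ p.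
Proof.
move=> /andP[p0 p2] s0.
have key c z w : 1 <= c -> `|z| <= c * `|w| -> `|z| `^ p <= c ^+ 2 * `|w| `^ p.
  move=> c1 zw; have c0 : 0 <= c by rewrite (le_trans _ c1).
  apply: (le_trans (le_powR2r (ltW p0) _ zw)) => //.
  rewrite powRM// ler_wpM2r ?powR_ge0// -powR_mulrn//; exact: ler_powR.
have [xy|xy] := leP `|y| (s * `|x|).
  rewrite -[leLHS]addr0 lerD//; last by rewrite mulr_ge0 ?powR_ge0 ?sqr_ge0.
  apply: key; first by rewrite lerDl ltW.
  by rewrite mulrDl mul1r (le_trans (ler_normD _ _))// lerD2l.
rewrite -[leLHS]add0r lerD//; first by rewrite mulr_ge0 ?powR_ge0 ?sqr_ge0.
apply: key; first by rewrite lerDl invr_ge0 ltW.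
rewrite mulrDl mul1r (le_trans (ler_normD _ _))// addrC lerD2l.
by rewrite ltW// mulrC ltr_pdivlMr// mulrC.
Qed.

Lemma powmaxD a b x y : 0 < a -> a <= b -> b <= 2 ->
  powmax a b (x + y) <= 4 * powmax a b x + 4 * powmax a b y.
Proof.
move=> a0 ab b2.
have key p : a <= p <= b ->
    `|x + y| `^ p <= 4 * powmax a b x + 4 * powmax a b y.
  move=> apb; have /andP[ap pb] := apb.
  have p02 : 0 < p <= 2 by rewrite (lt_le_trans a0 ap) (le_trans pb b2).
  apply: (le_trans (powR_normD _ _ p02 ltr01)).
  have -> : (1 + 1) ^+ 2 = 4 :> R by ring.
  have -> : (1 + 1^-1) ^+ 2 = 4 :> R by rewrite invr1; ring.
  by rewrite lerD// ler_wpM2l// powR_le_powmax.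
by rewrite {1}/powmax ge_max !key ?lexx ?ab.
Qed.

Lemma powmax_gt0 a b x : x != 0 -> 0 < powmax a b x.
Proof. by move=> x0; rewrite /powmax lt_max powR_gt0// normr_gt0. Qed.

Lemma powmax1 a b : powmax a b 1 = 1.
Proof. by rewrite /powmax normr1 !powR1 maxxx. Qed.

Lemma powmax_le1 a b x : 0 < a -> a <= b -> `|x| <= 1 ->
  powmax a b x = `|x| `^ a.
Proof.
move=> a0 ab x1; apply: max_l.
have [->|x0] := eqVneq x 0.
  by rewrite normr0 powR0 ?powR_ge0// gt_eqF// (lt_le_trans a0 ab).
by rewrite ger_powR// normr_gt0 x0.
Qed.

Lemma powmax_ge1 a b x : a <= b -> 1 <= `|x| -> powmax a b x = `|x| `^ b.
Proof. by move=> ab x1; apply: max_r; rewrite ler_powR. Qed.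

End PowerInequalities.

(** * The modular: scaling, quasi-triangle inequality, finiteness *)

Section Modular.
Context {d : measure_display} {X : measurableType d} {R : realType}.
Variable mu : {measure set X -> \bar R}.
Variables a b : R.
Hypotheses (a0 : 0 < a) (ab : a <= b) (b2 : b <= 2).
Implicit Types (al g k : X -> R).
Local Open Scope ereal_scope.

Definition modular al g : \bar R := \int[mu]_x (`|g x| `^ al x)%:E.

Lemma measurable_powR_norm al g :
  measurable_fun setT al -> measurable_fun setT g ->
  measurable_fun setT (fun x => (`|g x| `^ al x)%R).
Proof.
move=> mal mg; rewrite /powR; apply: measurable_fun_ifT.
- apply: measurable_fun_eqr; last exact: measurable_cst.
  exact: measurableT_comp.
- apply: (measurableT_comp (f := fun b : bool => (b%:R : R))) => //.
  by apply: measurable_fun_eqr; last exact: measurable_cst.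
- apply: measurableT_comp => //; apply: measurable_funM => //.
  by apply: measurableT_comp => //; exact: measurableT_comp.
Qed.

Lemma measurable_powmax g : measurable_fun setT g ->
  measurable_fun setT (fun x => powmax a b (g x)).
Proof.
by move=> mg; apply: measurable_maxr; apply: measurable_powR_norm.
Qed.

Lemma modular_ge0 al g : 0 <= modular al g.
Proof. by apply: integral_ge0 => x _; rewrite lee_fin powR_ge0. Qed.

Lemma measurable_modular al g :
  measurable_fun setT al -> measurable_fun setT g ->
  measurable_fun setT (fun x => (`|g x| `^ al x)%:E).
Proof. by move=> mal mg; apply/measurable_EFinP; exact: measurable_powR_norm. Qed.

Lemma eq_modular al g k : g =1 k -> modular al g = modular al k.
Proof. by move=> /funext ->. Qed.

Section FixedIndex.
Variable al : X -> R.
Hypotheses (mal : measurable_fun setT al) (alab : forall x, (a <= al x <= b)%R).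

Lemma modular_le_powmax g : measurable_fun setT g ->
  modular al g <= \int[mu]_x (powmax a b (g x))%:E.
Proof.
move=> mg; apply: ge0_le_integral => //.
- exact: measurable_modular.
- by apply/measurable_EFinP; exact: measurable_powmax.
- by move=> x _; rewrite lee_fin powR_le_powmax.
Qed.

Lemma modularZ (c : R) g : measurable_fun setT g ->
  modular al (fun x => c * g x)%R <= (powmax a b c)%:E * modular al g.
Proof.
move=> mg; rewrite -ge0_integralZl//; do ?by [exact: measurable_modular |
  rewrite lee_fin powmax_ge0].
apply: ge0_le_integral => //.
- by apply: measurable_modular => //; exact: measurable_funM.
- by apply: measurable_funeM; exact: measurable_modular.
- move=> x _; rewrite -EFinM lee_fin normrM powRM//.
  by rewrite ler_wpM2r ?powR_ge0// powR_le_powmax.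
Qed.

Lemma modularD (s : R) g k : (0 < s)%R ->
  measurable_fun setT g -> measurable_fun setT k ->
  modular al (fun x => g x + k x)%R <=
  ((1 + s) ^+ 2)%:E * modular al g + ((1 + s^-1) ^+ 2)%:E * modular al k.
Proof.
move=> s0 mg mk.
have mM (c : R) (f : X -> R) : measurable_fun setT f ->
    measurable_fun setT (fun x => c%:E * (`|f x| `^ al x)%:E).
  by move=> mf; apply: measurable_funeM; exact: measurable_modular.
have p0 x (c : R) y : (0 <= c ^+ 2)%R -> 0 <= (c ^+ 2)%:E * (`|y| `^ al x)%:E.
  by move=> c0; rewrite -EFinM lee_fin mulr_ge0// powR_ge0.
rewrite -!ge0_integralZl//; do ?by [exact: measurable_modular |
  rewrite lee_fin sqr_ge0 | move=> x _; rewrite lee_fin powR_ge0].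
rewrite -ge0_integralD//; do ?by [exact: mM |
  move=> x _; apply: p0; rewrite sqr_ge0].
apply: ge0_le_integral => //.
- by apply: measurable_modular => //; exact: measurable_funD.
- by apply: emeasurable_funD; exact: mM.
move=> x _; rewrite -!EFinM -EFinD lee_fin powR_normD//.
have /andP[ap pb] := alab x.
by rewrite (lt_le_trans a0 ap) (le_trans pb b2).
Qed.

End FixedIndex.

Definition finite_powmax g :=
  measurable_fun setT g /\ \int[mu]_x (powmax a b (g x))%:E < +oo.

Lemma powmax_integralD g k : measurable_fun setT g -> measurable_fun setT k ->
  \int[mu]_x (powmax a b (g x + k x))%:E <=
  4%:E * \int[mu]_x (powmax a b (g x))%:E + 4%:E * \int[mu]_x (powmax a b (k x))%:E.
Proof.
move=> mg mk.
have mP (f : X -> R) : measurable_fun setT f ->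
    measurable_fun setT (fun x => (powmax a b (f x))%:E).
  by move=> mf; apply/measurable_EFinP; exact: measurable_powmax.
have mM (f : X -> R) : measurable_fun setT f ->
    measurable_fun setT (fun x => 4%:E * (powmax a b (f x))%:E).
  by move=> mf; apply: measurable_funeM; exact: mP.
rewrite -!ge0_integralZl//; do ?by [exact: mP |
  move=> x _; rewrite lee_fin powmax_ge0].
rewrite -ge0_integralD//; do ?by [exact: mM |
  move=> x _; rewrite -EFinM lee_fin mulr_ge0// powmax_ge0].
apply: ge0_le_integral => //.
- by move=> x _; rewrite lee_fin powmax_ge0.
- by apply: mP; exact: measurable_funD.
- by apply: emeasurable_funD; exact: mM.
- by move=> x _; rewrite -!EFinM -EFinD lee_fin powmaxD.
Qed.

Lemma finite_powmaxD g k : finite_powmax g -> finite_powmax k ->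
  finite_powmax (fun x => g x + k x)%R.
Proof.
move=> [mg ig] [mk ik]; split; first exact: measurable_funD.
rewrite (le_lt_trans (powmax_integralD mg mk))//.
by rewrite lte_add_pinfty// lte_mul_pinfty.
Qed.

Lemma powmax_integralZ (c : R) g : measurable_fun setT g ->
  \int[mu]_x (powmax a b (c * g x))%:E <=
    (powmax a b c)%:E * \int[mu]_x (powmax a b (g x))%:E.
Proof.
move=> mg; have mP (f : X -> R) : measurable_fun setT f ->
    measurable_fun setT (fun x => (powmax a b (f x))%:E).
  by move=> mf; apply/measurable_EFinP; exact: measurable_powmax.
rewrite -ge0_integralZl//; do ?by [exact: mP | rewrite lee_fin powmax_ge0 |
  move=> x _; rewrite lee_fin powmax_ge0].
apply: ge0_le_integral => //.
- by move=> x _; rewrite lee_fin powmax_ge0.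
- by apply: mP; exact: measurable_funM.
- by apply: measurable_funeM; exact: mP.
- by move=> x _; rewrite -EFinM lee_fin powmaxM.
Qed.

Lemma finite_powmaxZ (c : R) g : finite_powmax g ->
  finite_powmax (fun x => c * g x)%R.
Proof.
move=> [mg ig]; split; first exact: measurable_funM.
by rewrite (le_lt_trans (powmax_integralZ _ mg))// lte_mul_pinfty// lee_fin powmax_ge0.
Qed.

Lemma finite_powmax0 : finite_powmax (fun=> 0%R).
Proof.
split; first exact: measurable_cst.
rewrite integral0_eq// => x _; rewrite /powmax normr0 !powR0 ?maxxx// gt_eqF//.
exact: lt_le_trans a0 ab.
Qed.

Lemma finite_powmax_sum (I : Type) (s : seq I) (g : I -> X -> R) :
  (forall i, finite_powmax (g i)) ->
  finite_powmax (fun x => \sum_(i <- s) g i x)%R.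
Proof.
move=> fg; elim: s => [|i s ih].
  by under eq_fun do rewrite big_nil; exact: finite_powmax0.
by under eq_fun do rewrite big_cons; exact: finite_powmaxD.
Qed.

End Modular.

(** * Continuity in base and exponent; limits of modulars *)

Section PowContinuity.
Context {R : realType}.

Lemma continuous_powR_base (p x : R) : 0 < x -> {for x, continuous (fun y : R => y `^ p)}.
Proof.
move=> x0; apply: differentiable_continuous; rewrite -derivable1_diffP.
by apply: derivable_powR; rewrite in_itv/= x0.
Qed.

(** The condition on [p] is for [x = 0]: the power of 0 is 1 at exponent 0 and vanishes at all
    others. *)
Lemma continuous_powR_exponent (x p : R) : p != 0 ->
  {for p, continuous (fun q : R => x `^ q)}.
Proof.
move=> p0; rewrite /powR; have [_|x0] := eqVneq x 0.
  rewrite /prop_for /continuous_at (negbTE p0); apply: cvg_near_cst.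
  near=> q; have : q != 0 by near: q; apply: cvgr_neq0 p0; exact: cvg_id.
  by move=> /negbTE->.
apply: (@cvg_comp _ _ _ (fun q => q * ln x) expR _ (nbhs (p * ln x))).
  by apply: cvgMr_tmp; exact: cvg_id.
exact: continuous_expR.
Unshelve. all: by end_near. Qed.

Lemma continuous_powmax (a b x : R) : x != 0 -> {for x, continuous (powmax a b)}.
Proof.
move=> x0; rewrite /powmax.
have pc p : {for x, continuous (fun y : R => `|y| `^ p)}.
  have xp : 0 < `|x| by rewrite normr_gt0.
  exact: cvg_comp (@norm_continuous _ R x) (@continuous_powR_base p _ xp).
exact: (continuous_max (pc a) (pc b)).
Qed.

(** Stands in for the estimate |a_n - b_n| <= d_n. First [s] is chosen so small that (1 + s)^2 - 1
    is negligible against a bound on both sequences; then [n] is taken so large that [d_] absorbs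
    the factor (1 + 1/s)^2. *)
Lemma cvg_quasi_close (a_ b_ d_ : R^nat) (l : R) :
  (forall n, 0 <= a_ n) -> (forall n, 0 <= b_ n) -> (forall n, 0 <= d_ n) ->
  b_ @ \oo --> l -> d_ @ \oo --> 0 ->
  (forall s, 0 < s -> \forall n \near \oo,
    a_ n <= (1 + s) ^+ 2 * b_ n + (1 + s^-1) ^+ 2 * d_ n /\
    b_ n <= (1 + s) ^+ 2 * a_ n + (1 + s^-1) ^+ 2 * d_ n) ->
  a_ @ \oo --> l.
Proof.
move=> a0 b0 d0 bl dl h.
have l0 : 0 <= l by apply: (cvgr_to_ge bl); exact: nearW.
suff abl : a_ \- b_ @ \oo --> (0 : R).
  rewrite -[l]add0r (_ : a_ = (a_ \- b_) \+ b_); first exact: cvgD.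
  by apply/funext => n /=; rewrite subrK.
apply/cvgrPdist_lt => e e0.
(* The bound on [a_] given by the hypothesis at s = 1, once [b_ n <= l + 1] and [d_ n <= 1]. *)
pose K := 4 * (l + 1) + 4.
have K0 : 0 < K by rewrite /K; lra.
pose s := Num.min 1 (e / 2 / (3 * K)).
have s0 : 0 < s by rewrite /s lt_min ltr01/= !divr_gt0// mulr_gt0.
have s1 : s <= 1 by rewrite /s ge_min lexx.
have sK : 3 * s * K <= e / 2.
  have : s <= e / 2 / (3 * K) by rewrite /s ge_min lexx orbT.
  by rewrite ler_pdivlMr ?mulr_gt0//; nra.
pose C := (1 + s^-1) ^+ 2.
have C0 : 0 < C by rewrite exprn_gt0// addr_gt0// invr_gt0.
near=> n.
have [ab ba] : a_ n <= (1 + s) ^+ 2 * b_ n + C * d_ n /\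
    b_ n <= (1 + s) ^+ 2 * a_ n + C * d_ n by near: n; exact: h s s0.
have [ab1 _] : a_ n <= (1 + 1) ^+ 2 * b_ n + (1 + 1^-1) ^+ 2 * d_ n /\
    b_ n <= (1 + 1) ^+ 2 * a_ n + (1 + 1^-1) ^+ 2 * d_ n.
  by near: n; exact: h 1 ltr01.
have bl1 : b_ n <= l + 1.
  by near: n; apply: cvgr_le bl _ _; rewrite ltrDl.
have d1 : d_ n <= 1 by near: n; apply: cvgr_le dl _ _.
have dC : C * d_ n < e / 2.
  rewrite mulrC -ltr_pdivlMr//; near: n; apply: cvgr_lt dl _ _.
  by rewrite !divr_gt0.
have aK : a_ n <= K by move: ab1; rewrite invr1 /K; have := d0 n; nra.
have bK : b_ n <= K by rewrite /K; lra.
have := a0 n; have := b0 n => b0n a0n.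
have s2 : (1 + s) ^+ 2 <= 1 + 3 * s by nra.
rewrite /= sub0r normrN ltr_norml; apply/andP; split.
  suff : b_ n - a_ n <= 3 * s * K + C * d_ n by lra.
  have : 3 * s * a_ n <= 3 * s * K by rewrite ler_wpM2l// mulr_ge0// ltW.
  have : (1 + s) ^+ 2 * a_ n <= (1 + 3 * s) * a_ n by rewrite ler_wpM2r.
  lra.
suff : a_ n - b_ n <= 3 * s * K + C * d_ n by lra.
have : 3 * s * b_ n <= 3 * s * K by rewrite ler_wpM2l// mulr_ge0// ltW.
have : (1 + s) ^+ 2 * b_ n <= (1 + 3 * s) * b_ n by rewrite ler_wpM2r.
lra.
Unshelve. all: by end_near. Qed.

Lemma cvge_quasi_close (A_ B_ D_ : nat -> \bar R) (l : \bar R) :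
  (forall n, 0 <= A_ n)%E -> (forall n, 0 <= B_ n)%E -> (forall n, 0 <= D_ n)%E ->
  (forall n, B_ n \is a fin_num) -> l \is a fin_num ->
  B_ n @[n --> \oo] --> l -> D_ n @[n --> \oo] --> 0%E ->
  (forall n s, 0 < s ->
    (A_ n <= ((1 + s) ^+ 2)%:E * B_ n + ((1 + s^-1) ^+ 2)%:E * D_ n)%E /\
    (B_ n <= ((1 + s) ^+ 2)%:E * A_ n + ((1 + s^-1) ^+ 2)%:E * D_ n)%E) ->
  A_ n @[n --> \oo] --> l.
Proof.
move=> A0 B0 D0 Bfin lfin Bl Dl h.
have [Dfin Dl'] := (fine_cvgP _ _).1 Dl.
have Afin : \forall n \near \oo, A_ n \is a fin_num.
  near=> n; rewrite ge0_fin_numE//.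
  have [h1 _] := h n 1 ltr01.
  rewrite (le_lt_trans h1)// ltey_eq fin_numD !fin_numM//.
  by near: n.
move: Bl; rewrite -(fineK lfin) => /fine_cvgP[_ Bl].
apply/fine_cvgP; split => //.
apply: (@cvg_quasi_close _ _ _ _ _ _ _ Bl Dl') => [n|n|n|s s0];
  rewrite /= ?fine_ge0//.
near=> n.
have An : A_ n \is a fin_num by near: n.
have Dn : D_ n \is a fin_num by near: n.
by have [h1 h2] := h n s s0; split; rewrite -lee_fin EFinD !EFinM !fineK.
Unshelve. all: by end_near. Qed.

End PowContinuity.

Section ModularLimits.
Context {d : measure_display} {X : measurableType d} {R : realType}.
Variable mu : {measure set X -> \bar R}.
Variables a b : R.
Hypotheses (a0 : 0 < a) (ab : a <= b) (b2 : b <= 2).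
Local Open Scope ereal_scope.

(** Intermediate value theorem for s |-> modular of s g. Continuity follows from the multiplicative
    bound between the values at s and t, whose factor [powmax a b (s / t)] tends to 1. *)
Lemma modular_eq1 (al g : X -> R) :
  measurable_fun setT al -> (forall x, (a <= al x <= b)%R) ->
  measurable_fun setT g -> modular mu al g < +oo -> modular mu al g != 0 ->
  exists2 l : R, (0 < l)%R & modular mu al (fun x => g x / l)%R = 1.
Proof.
move=> mal alab mg goo gn0.
have mZ (s : R) : measurable_fun setT (fun x => s * g x)%R.
  exact: measurable_funM.
have fin s : modular mu al (fun x => s * g x)%R \is a fin_num.
  rewrite ge0_fin_numE; last exact: modular_ge0.
  rewrite (le_lt_trans (modularZ mu a0 mal alab s mg))//.
  by rewrite lte_mul_pinfty// lee_fin powmax_ge0.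
have [n nE] : exists n : R -> R,
    forall s, modular mu al (fun x => s * g x)%R = (n s)%:E.
  by exists (fun s => fine (modular mu al (fun x => s * g x)%R)) => s; rewrite fineK.
have n_ge0 s : (0 <= n s)%R by rewrite -lee_fin -nE modular_ge0.
have nle s t : (t != 0 -> n s <= powmax a b (s / t) * n t)%R.
  move=> t0; have := modularZ mu a0 mal alab (s / t) (mZ t).
  rewrite (@eq_modular _ _ _ _ _ _ (fun x => s * g x)%R); last first.
    by move=> x /=; rewrite mulrA divfK.
  by rewrite !nE -EFinM lee_fin.
have n1 : modular mu al g = (n 1%R)%:E.
  by rewrite -nE; apply: eq_modular => x; rewrite mul1r.
have n1_gt0 : (0 < n 1)%R.
  by rewrite lt_def n_ge0 andbT; move: gn0; rewrite n1 eqe.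
have ncont s : (0 < s)%R -> {for s, continuous n}.
  move=> s0; have sn0 : s != 0%R by rewrite gt_eqF.
  have c1 : powmax a b (t / s)%R @[t --> s] --> (1 : R)%R.
    rewrite -[X in _ --> X](@powmax1 _ a b) -[in X in _ --> X](divff sn0).
    apply: (@cvg_comp _ _ _ (fun t : R => t / s)%R (powmax a b) _ (nbhs (s / s)%R)).
      by apply: cvgMr_tmp; exact: cvg_id.
    by apply: continuous_powmax; rewrite divff// oner_neq0.
  have c2 : powmax a b (s / t)%R @[t --> s] --> (1 : R)%R.
    rewrite -[X in _ --> X](@powmax1 _ a b) -[in X in _ --> X](divff sn0).
    apply: (@cvg_comp _ _ _ (fun t : R => s / t)%R (powmax a b) _ (nbhs (s / s)%R)).
      by apply: cvgMl_tmp; exact: cvgV.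
    by apply: continuous_powmax; rewrite divff// oner_neq0.
  apply: (@squeeze_cvgr _ _ _ _ (fun t => (powmax a b (s / t))^-1 * n s)%R
      (fun t => powmax a b (t / s) * n s)%R).
  - near=> t; have t0 : t != 0%R.
      by near: t; apply: cvgr_neq0 sn0; exact: cvg_id.
    rewrite nle// andbT mulrC ler_pdivrMr ?powmax_gt0 ?mulf_neq0 ?invr_eq0//.
    by rewrite mulrC nle.
  - have : ((powmax a b (s / t))^-1 * n s)%R @[t --> s] --> (1^-1 * n s)%R.
      by apply: cvgM; [apply: cvgV; rewrite ?oner_neq0|exact: cvg_cst].
    by rewrite invr1 mul1r.
  - have : (powmax a b (t / s) * n s)%R @[t --> s] --> (1 * n s)%R.
      by apply: cvgM => //; exact: cvg_cst.
    by rewrite mul1r.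
(* Since w^a * n 1 = 1, scaling by min(1, w) brings the modular to at most 1 and scaling by max(1,
   w) to at least 1. The comparison with 1 ensures that only the power [a] of the ratio occurs. *)
pose w := (n 1 `^ (- a^-1))%R.
have w0 : (0 < w)%R by rewrite powR_gt0.
have wa : (w `^ a * n 1 = 1)%R.
  rewrite /w -powRrM mulNr mulVf ?gt_eqF// powRN powRr1 ?ltW//.
  by rewrite mulVf// gt_eqF.
pose s1 := Num.min 1%R w; pose s2 := Num.max 1%R w.
have s10 : (0 < s1)%R by rewrite /s1 lt_min ltr01.
have s20 : (0 < s2)%R by rewrite /s2 lt_max ltr01.
have s12 : (s1 <= s2)%R by rewrite /s1 /s2 ge_min le_max lexx.
have ns1 : (n s1 <= 1)%R.
  rewrite (le_trans (nle s1 1%R _)) ?oner_neq0// divr1 powmax_le1//; last first.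
    by rewrite gtr0_norm// /s1 ge_min lexx.
  rewrite -[leRHS]wa ler_wpM2r// gtr0_norm//.
  apply: le_powR2r; [exact: ltW|exact: ltW|].
  by rewrite /s1 ge_min lexx orbT.
have ns2 : (1 <= n s2)%R.
  have := nle 1%R s2; rewrite gt_eqF// => /(_ isT).
  rewrite powmax_le1//; last first.
    by rewrite gtr0_norm ?divr_gt0// ler_pdivrMr// mul1r /s2 le_max lexx.
  move=> h; rewrite -[leLHS]wa (le_trans (ler_wpM2l _ h)) ?powR_ge0//.
  rewrite mulrA -powRM//; last exact: ltW.
  rewrite -[leRHS]mul1r; apply: ler_wpM2r => //.
  have e1 : ((1 : R) `^ a = 1)%R by rewrite powR1.
  rewrite -[leRHS]e1; apply: le_powR2r; [exact: ltW|exact: mulr_ge0 (ltW w0) _|].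
  rewrite gtr0_norm ?divr_gt0// mul1r ler_pdivrMr// mul1r.
  by rewrite /s2 le_max lexx orbT.
have [s sin ns] : exists2 s, s \in `[s1, s2] & n s = 1%R.
  apply: IVT => //.
    apply: continuous_in_subspaceT => s; rewrite inE/= in_itv/= => /andP[s1s _].
    by apply: ncont; exact: lt_le_trans s1s.
  by rewrite ge_min ns1/= le_max ns2 orbT.
have s0 : (0 < s)%R.
  by move: sin; rewrite in_itv/= => /andP[s1s _]; exact: lt_le_trans s1s.
exists s^-1%R; first by rewrite invr_gt0.
transitivity (modular mu al (fun x => s * g x)%R); last by rewrite nE ns.
by apply: eq_modular => x; rewrite invrK mulrC.
Unshelve. all: by end_near. Qed.

(** Exponent and integrand vary together, so they are separated: with [S] fixed the exponents
    converge by domination by [powmax a b (S x)], and replacing [S] by [S_ n] costs the modular of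
    the difference, by [cvge_quasi_close]. *)
Lemma modular_cvg (al_ : nat -> X -> R) (al : X -> R) (S_ : nat -> X -> R) (S : X -> R) :
  (forall n, measurable_fun setT (al_ n)) -> measurable_fun setT al ->
  (forall n x, (a <= al_ n x <= b)%R) ->
  (forall x, (a <= al x <= b)%R) ->
  (forall x, al_ n x @[n --> \oo] --> al x) ->
  (forall n, measurable_fun setT (S_ n)) -> finite_powmax mu a b S ->
  \int[mu]_x (powmax a b (S_ n x - S x))%:E @[n --> \oo] --> 0 ->
  modular mu (al_ n) (S_ n) @[n --> \oo] --> modular mu al S.
Proof.
move=> mal_ mal al_ab alab al_al mS_ [mS Soo] SS.
have mD n : measurable_fun setT (fun x => S_ n x - S x)%R.
  exact: measurable_funB.
have Bcvg : modular mu (al_ n) S @[n --> \oo] --> modular mu al S.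
  have [|||||_ _ //] := @dominated_convergence _ _ _ mu setT measurableT
    (fun n x => (`|S x| `^ al_ n x)%:E) (fun x => (`|S x| `^ al x)%:E)
    (fun x => (powmax a b (S x))%:E).
  - by move=> n; exact: measurable_modular.
  - exact: measurable_modular.
  - apply: aeW => x _; apply: cvg_EFin; first exact: nearW.
    apply: (@cvg_comp _ _ _ (al_ ^~ x) (fun q => (`|S x| `^ q)%R) _ (nbhs (al x))).
      exact: al_al.
    apply: continuous_powR_exponent; rewrite gt_eqF//.
    by have /andP[+ _] := alab x; exact: lt_le_trans.
  - apply/integrableP; split.
      by apply/measurable_EFinP; exact: measurable_powmax.
    by under eq_integral do rewrite gee0_abs ?lee_fin ?powmax_ge0//.
  - apply: aeW => x n _; rewrite gee0_abs// lee_fin.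
    exact: powR_le_powmax.
have Boo n : modular mu (al_ n) S \is a fin_num.
  rewrite ge0_fin_numE; last exact: modular_ge0.
  exact: le_lt_trans (modular_le_powmax mu a0 (mal_ n) (al_ab n) mS) Soo.
have B'oo : modular mu al S \is a fin_num.
  rewrite ge0_fin_numE; last exact: modular_ge0.
  exact: le_lt_trans (modular_le_powmax mu a0 mal alab mS) Soo.
have Dcvg : modular mu (al_ n) (fun x => S_ n x - S x)%R @[n --> \oo] --> 0.
  apply: (@squeeze_cvge _ _ _ _ (cst 0) _ _ _ _ (cvg_cst _) SS).
  by apply: nearW => n; rewrite modular_ge0/= modular_le_powmax.
have AB n s : (0 < s)%R -> modular mu (al_ n) (S_ n) <=
    ((1 + s) ^+ 2)%:E * modular mu (al_ n) S +
    ((1 + s^-1) ^+ 2)%:E * modular mu (al_ n) (fun x => S_ n x - S x)%R.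
  move=> s0; rewrite (@eq_modular _ _ _ _ _ (S_ n) (fun x => S x + (S_ n x - S x))%R).
    by apply: (@modularD _ _ _ _ a b) => //; rewrite ?al_ab.
  by move=> x; rewrite addrC subrK.
have BA n s : (0 < s)%R -> modular mu (al_ n) S <=
    ((1 + s) ^+ 2)%:E * modular mu (al_ n) (S_ n) +
    ((1 + s^-1) ^+ 2)%:E * modular mu (al_ n) (fun x => S_ n x - S x)%R.
  move=> s0; rewrite (@eq_modular _ _ _ _ _ S (fun x => S_ n x + (S x - S_ n x))%R).
    rewrite [X in _ + _ * X](_ : _ = modular mu (al_ n) (fun x => S x - S_ n x)%R).
      by apply: (@modularD _ _ _ _ a b) => //; exact: measurable_funB.
    by apply: eq_integral => x _; rewrite distrC.
  by move=> x; rewrite addrC subrK.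
apply: (cvge_quasi_close _ _ _ Boo B'oo Bcvg Dcvg) => [n|n|n|n s s0];
  [exact: modular_ge0..|].
by split; [exact: AB|exact: BA].
Qed.

End ModularLimits.

(** * The Luxemburg norm and the substitution x = u + r z *)

Section LebesgueModular.
Context {R : realType}.
Variables a b : R.
Hypotheses (a0 : 0 < a) (ab : a <= b).
Implicit Types (al : R -> R) (g k : R -> R).
Local Open Scope ereal_scope.
Local Notation leb := (@completed_lebesgue_measure R).

#[local] Instance ae_leb_filter : Filter (almost_everywhere leb).
Proof. exact: (ae_filter_ringOfSetsType leb). Qed.

Lemma lebesgue_measurable_continuous al : continuous al ->
  lebesgue_measurable_fun al.
Proof.
move=> cal _ B mB; rewrite setTI; apply: sub_caratheodory.
by have := continuous_measurable_fun cal measurableT mB; rewrite setTI.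
Qed.

Lemma lebesgue_measurable_aff u r g : (0 < r)%R -> lebesgue_measurable_fun g ->
  lebesgue_measurable_fun (fun z => g (u + r * z)%R).
Proof.
by move=> r0 mg; exact: (measurableT_comp mg (measurable_aff u r0)).
Qed.

Section Norm.
Variable al : R -> R.
Hypotheses (mal : lebesgue_measurable_fun al) (alab : forall x, (a <= al x <= b)%R).

Lemma al_neq0 x : al x != 0%R.
Proof. by have /andP[+ _] := alab x => /(lt_le_trans a0) al0; rewrite gt_eqF. Qed.

Lemma modular0P g : lebesgue_measurable_fun g ->
  modular leb al g = 0 <-> {ae leb, forall x, g x = 0%R}.
Proof.
move=> mg; have mM := measurable_modular mal mg.
have -> : modular leb al g = \int[leb]_x `|(`|g x| `^ al x)%:E|.
  by apply: eq_integral => x _; rewrite gee0_abs.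
split => [/(ae_eq_integral_abs leb measurableT mM)|] h.
  apply: filterS h => x /(_ I) [/eqP]; rewrite powR_eq0 => /andP[/eqP + _].
  exact: normr0_eq0.
apply/(ae_eq_integral_abs leb measurableT mM); apply: filterS h => x -> _.
by rewrite normr0 powR0//= al_neq0.
Qed.

Lemma Fab_modular_lty g : Fab a b g -> modular leb al g < +oo.
Proof.
move=> [mg goo]; exact: le_lt_trans (modular_le_powmax leb a0 mal alab mg) goo.
Qed.

(** Existence of a normalising factor excludes the default value +oo of [Fnorm]. *)
Lemma FnormE g : Fab a b g -> ~ {ae leb, forall x, g x = 0%R} ->
  exists2 l : R, (0 < l)%R /\ modular leb al (fun x => g x / l)%R = 1 &
    Fnorm al g = l%:E.
Proof.
move=> gab gn0; have [mg _] := gab.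
have n0 : modular leb al g != 0 by apply/eqP => /(modular0P mg).
have [l l0 gl] := modular_eq1 a0 ab mal alab mg (Fab_modular_lty gab) n0.
rewrite /Fnorm asboolF//; case: xgetP => [y -> [l' [l'0 gl'] <-]|/(_ l%:E)[]].
  by exists l'.
by exists l.
Qed.

Lemma Fab_Falpha g : Fab a b g -> Falpha al g.
Proof.
move=> gab; have [mg _] := gab; split => //.
have [g0|/(FnormE gab)[l _ ->]] := pselect {ae leb, forall x, g x = 0%R}.
  by rewrite /Fnorm asboolT.
exact: ltry.
Qed.

Let modular_shrink g (l m : R) : lebesgue_measurable_fun g ->
  (0 < l)%R -> (0 < m)%R -> (l <= m)%R ->
  modular leb al (fun x => g x / m)%R <=
    ((l / m) `^ a)%:E * modular leb al (fun x => g x / l)%R.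
Proof.
move=> mg l0 m0 lm.
have lm0 : (0 < l / m)%R by rewrite divr_gt0.
have lm1 : (l / m <= 1)%R by rewrite ler_pdivrMr// mul1r.
rewrite -[X in (X `^ a)%R]gtr0_norm// -(powmax_le1 a0 ab) ?gtr0_norm//.
have -> : (fun x => g x / m)%R = (fun x => (l / m) * (g x / l))%R.
  by apply/funext => x; field; rewrite !gt_eqF.
exact: (modularZ leb a0 mal alab _ (measurable_funM mg (measurable_cst _))).
Qed.

(** With the converse below, the description of the norm by its unit ball, through which bounds on
    the norm and on the modular are exchanged. *)
Lemma Fnorm_le_modular g (m : R) : (0 < m)%R -> Fab a b g ->
  Fnorm al g <= m%:E -> modular leb al (fun x => g x / m)%R <= 1.
Proof.
move=> m0 gab; have [mg _] := gab.
have [g0 _|/(FnormE gab)[l [l0 gl ->]]] := pselect {ae leb, forall x, g x = 0%R}.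
  have mgm : lebesgue_measurable_fun (fun x => g x / m)%R by exact: measurable_funM.
  rewrite ((modular0P mgm).2 _)//.
  by apply: filterS g0 => x ->; rewrite mul0r.
rewrite lee_fin => lm; rewrite (le_trans (modular_shrink mg l0 m0 lm))//.
rewrite gl mule1 lee_fin -[leRHS](_ : 1 `^ a = 1)%R; last by rewrite powR1.
apply: le_powR2r; [exact: ltW|by rewrite divr_ge0// ltW|].
by rewrite ler_pdivrMr// mul1r.
Qed.

Lemma modular_le_Fnorm g (m : R) : (0 < m)%R -> Fab a b g ->
  modular leb al (fun x => g x / m)%R <= 1 -> Fnorm al g <= m%:E.
Proof.
move=> m0 gab gm; have [mg _] := gab.
have [g0|/(FnormE gab)[l [l0 gl ->]]] := pselect {ae leb, forall x, g x = 0%R}.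
  by rewrite /Fnorm asboolT// lee_fin ltW.
rewrite lee_fin leNgt; apply/negP => ml.
have := modular_shrink mg m0 l0 (ltW ml); rewrite gl.
apply/negP; rewrite -ltNge.
apply: (@le_lt_trans _ _ (((m / l) `^ a)%:E * 1)).
  by apply: lee_wpmul2l => //; rewrite lee_fin powR_ge0.
rewrite mule1 lte_fin -[ltRHS](_ : 1 `^ a = 1)%R; last by rewrite powR1.
apply: gt0_ltr_powR => //; rewrite ?nnegrE ?divr_ge0// ?ltW//.
by rewrite ltr_pdivrMr// mul1r.
Qed.

Lemma Fnorm0 : Fnorm al (fun=> 0%R) = 0.
Proof. by rewrite /Fnorm asboolT//; exact: aeW. Qed.

(* The factor r of the substitution x = u + r z is (r ^ (1 / p)) ^ p with
   p = al (u + r z), which turns r ^ h into r ^ (h - 1 / p). *)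
Lemma modular_rescale (h u r : R) g : (0 < r)%R -> lebesgue_measurable_fun g ->
  modular leb al (fun x => g x / r `^ h)%R =
  modular leb (fun z => al (u + r * z)%R)
    (fun z => g (u + r * z) / r `^ (h - (al (u + r * z))^-1))%R.
Proof.
move=> r0 mg.
have mgh : lebesgue_measurable_fun (fun x => g x / r `^ h)%R by exact: measurable_funM.
have mM := measurable_modular mal mgh.
have rn0 : r != 0%R by rewrite gt_eqF.
have E := integral_aff u r0 mM (fun x => powR_ge0 _ _).
have -> : modular leb al (fun x => g x / r `^ h)%R =
    r%:E * ((r^-1)%:E * modular leb al (fun x => g x / r `^ h)%R).
  by rewrite muleA -EFinM (divff rn0) mul1e.
rewrite -[X in _ * X]E.
have maff := measurable_aff u r0.
rewrite -ge0_integralZl; [|exact: measurableT|exact: (measurableT_comp mM maff)|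
  by move=> x _; rewrite lee_fin powR_ge0|by rewrite lee_fin ltW].
apply: eq_integral => z _; rewrite -EFinM; congr (_%:E).
have p0 := al_neq0 (u + r * z)%R; move: (al _) p0 (g _) => p p0 y.
rewrite powRB; last by rewrite rn0 implybT.
rewrite invf_div mulrCA [in RHS]normrM [in RHS]powRM// (gtr0_norm (powR_gt0 _ r0)).
by rewrite -powRrM mulVf// powRr1// ltW.
Qed.

End Norm.
End LebesgueModular.

(** * Characteristic functions, tails and weak convergence *)

Section BoundedMean.
Context {d : measure_display} {T : measurableType d} {R : realType}.
Variable P : probability T R.
Implicit Types (f g : T -> R) (A : set T).

(** All random quantities whose means are taken are bounded, so measurability and a bound are
    carried together and [mean] can be real valued. *)
Definition bounded_rv f :=
  measurable_fun setT f /\ exists M : R, forall w, `|f w| <= M.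

Definition mean f : R := (\int[P]_w f w)%R.

Lemma bounded_rv_integrable f : bounded_rv f -> P.-integrable setT (EFin \o f).
Proof.
move=> [mf [M fM]]; apply: measurable_bounded_integrable => //.
  exact: le_lt_trans (probability_le1 P measurableT) (ltry _).
by exists M; split; [exact: num_real|move=> x Mx w _ /=; rewrite ltW// (le_lt_trans _ Mx)].
Qed.

Lemma expectation_mean f : bounded_rv f -> ('E_P[f] = (mean f)%:E)%E.
Proof.
move=> bf; rewrite unlock /mean /Rintegral fineK//.
exact: (integrable_fin_num measurableT (bounded_rv_integrable bf)).
Qed.

Lemma bounded_rv_cst (c : R) : bounded_rv (fun=> c).
Proof. by split; [exact: measurable_cst|exists `|c|]. Qed.

Lemma bounded_rvD f g : bounded_rv f -> bounded_rv g ->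
  bounded_rv (fun w => f w + g w).
Proof.
move=> [mf [M fM]] [mg [N gN]]; split; first exact: measurable_funD.
by exists (M + N) => w; rewrite (le_trans (ler_normD _ _))// lerD.
Qed.

Lemma bounded_rvZ (c : R) f : bounded_rv f -> bounded_rv (fun w => c * f w).
Proof.
move=> [mf [M fM]]; split; first exact: measurable_funM.
by exists (`|c| * M) => w; rewrite normrM ler_wpM2l.
Qed.

Lemma bounded_rvB f g : bounded_rv f -> bounded_rv g ->
  bounded_rv (fun w => f w - g w).
Proof.
move=> [mf [M fM]] [mg [N gN]]; split; first exact: measurable_funB.
by exists (M + N) => w; rewrite (le_trans (ler_normB _ _))// lerD.
Qed.

Lemma bounded_rv_indic A : measurable A -> bounded_rv (\1_A).
Proof.
move=> mA; split; first exact: measurable_indic.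
exists 1 => w; rewrite indicE; case: (_ \in _); first by rewrite normr1.
by rewrite normr0.
Qed.

Lemma bounded_rv_cos f : measurable_fun setT f -> bounded_rv (fun w => cos (f w)).
Proof.
move=> mf; split.
  by apply: measurableT_comp mf; apply: continuous_measurable_fun; exact: continuous_cos.
by exists 1 => w; rewrite ler_norml cos_geN1 cos_le1.
Qed.

Lemma bounded_rv_sin f : measurable_fun setT f -> bounded_rv (fun w => sin (f w)).
Proof.
move=> mf; split.
  by apply: measurableT_comp mf; apply: continuous_measurable_fun; exact: continuous_sin.
by exists 1 => w; rewrite ler_norml sin_geN1 sin_le1.
Qed.

Lemma mean_cst (c : R) : mean (fun=> c) = c.
Proof.
rewrite /mean Rintegral_cst//; apply: etrans (mulr1 c); congr (c * _).
exact: (congr1 fine (probability_setT P)).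
Qed.

Lemma meanD f g : bounded_rv f -> bounded_rv g ->
  mean (fun w => f w + g w) = mean f + mean g.
Proof. by move=> bf bg; rewrite /mean RintegralD//; exact: bounded_rv_integrable. Qed.

Lemma meanB f g : bounded_rv f -> bounded_rv g ->
  mean (fun w => f w - g w) = mean f - mean g.
Proof. by move=> bf bg; rewrite /mean RintegralB//; exact: bounded_rv_integrable. Qed.

Lemma meanZ (c : R) f : bounded_rv f -> mean (fun w => c * f w) = c * mean f.
Proof. by move=> bf; rewrite /mean RintegralZl//; exact: bounded_rv_integrable. Qed.

Lemma le_mean f g : bounded_rv f -> bounded_rv g -> (forall w, f w <= g w) ->
  mean f <= mean g.
Proof.
by move=> bf bg fg; rewrite /mean le_Rintegral//; exact: bounded_rv_integrable.
Qed.

Lemma mean_indic A : measurable A -> mean (\1_A) = fine (P A).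
Proof.
by move=> mA; rewrite /mean /Rintegral integral_indic// setIT.
Qed.

Lemma mean_dist f g A (e M : R) : bounded_rv f -> bounded_rv g -> measurable A ->
  0 <= e -> (forall w, ~ A w -> `|f w - g w| <= e) ->
  (forall w, `|f w - g w| <= M) ->
  `|mean f - mean g| <= e + M * fine (P A).
Proof.
move=> bf bg mA e0 fge fgM.
have bA := bounded_rv_indic mA.
have bE : bounded_rv (fun w => e + M * \1_A w).
  by apply: bounded_rvD; [exact: bounded_rv_cst|exact: bounded_rvZ].
have bE' : bounded_rv (fun w => - 1 * (e + M * \1_A w)) by exact: bounded_rvZ.
have bfg := bounded_rvB bf bg.
have E : mean (fun w => e + M * \1_A w) = e + M * fine (P A).
  rewrite meanD; [|exact: bounded_rv_cst|exact: bounded_rvZ].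
  by rewrite mean_cst meanZ// mean_indic.
have h w : `|f w - g w| <= e + M * \1_A w.
  rewrite indicE; have [Aw|Aw] := boolP (w \in A).
    by rewrite mulr1 (le_trans (fgM w))// lerDr.
  by rewrite mulr0 addr0 fge//; move/negP: Aw; rewrite inE.
rewrite -meanB// -E ler_norml; apply/andP; split.
  rewrite -mulN1r -meanZ//; apply: le_mean => // w.
  by rewrite mulN1r lerNl; have := h w; rewrite ler_norml lerNl => /andP[].
by apply: le_mean => // w; have := h w; rewrite ler_norml => /andP[].
Qed.

Lemma mean_ae_eq f g : bounded_rv f -> bounded_rv g ->
  {ae P, forall w, f w = g w} -> mean f = mean g.
Proof.
move=> [mf _] [mg _] fg; rewrite /mean /Rintegral; congr fine.
apply: ae_eq_integral => //; [exact/measurable_EFinP..|].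
by apply: filterS fg => w ->.
Qed.

Lemma markov_mean f A (c : R) : bounded_rv f -> measurable A -> 0 < c ->
  (forall w, 0 <= f w) -> (forall w, A w -> c <= f w) -> (P A <= (mean f / c)%:E)%E.
Proof.
move=> bf mA c0 f0 Af.
have := @le_mean (fun w => c * \1_A w) f (bounded_rvZ c (bounded_rv_indic mA)) bf.
rewrite meanZ; last exact: bounded_rv_indic.
rewrite mean_indic// => h.
rewrite -(fineK (fin_num_measure P A mA)) lee_fin ler_pdivlMr// mulrC h// => w.
rewrite indicE; have [|_] := boolP (w \in A); last by rewrite mulr0.
by rewrite inE mulr1 => /Af.
Qed.

End BoundedMean.

(** * Tail bounds from the characteristic function *)

Section TailBound.
Context {d : measure_display} {T : measurableType d} {R : realType}.
Variable P : probability T R.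

Lemma cos1_lt1 : cos (1 : R) < 1.
Proof.
rewrite -[ltRHS]cos0 ltr_cos ?ltr01// !in_itv/= ?lexx ?pi_ge0//.
by rewrite ler01/= (le_trans _ (pi_ge2 _))// ler1n.
Qed.

Lemma cos_le_cos1 (y : R) : 1 <= `|y| <= 2 -> cos y <= cos 1.
Proof.
have -> : cos y = cos `|y|.
  by have [y0|y0] := ger0P y; rewrite ?cosN.
move=> /andP[y1 y2]; rewrite leNgt ltr_cos -?leNgt// in_itv/=.
  by rewrite (le_trans ler01 y1)/= (le_trans y2 (pi_ge2 _)).
by rewrite ler01/= (le_trans _ (pi_ge2 _))// ler1n.
Qed.

Lemma measurable_le_rv (f g : T -> R) :
  measurable_fun setT f -> measurable_fun setT g -> measurable [set w | f w <= g w].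
Proof.
by move=> mf mg; rewrite -[X in measurable X]setTI; exact: measurable_fun_le.
Qed.

Lemma measurable_norm_ge (X : T -> R) (l : R) :
  measurable_fun setT X -> measurable [set w | l <= `|X w|].
Proof. by move=> mX; apply: measurable_le_rv => //; exact: measurableT_comp. Qed.

(** The Markov constant on one dyadic shell times the sum of the geometric series over all
    shells. *)
Definition tail_constant (a : R) : R := (1 - cos 1)^-1 * (1 - 2 `^ (- a))^-1.

Lemma powR2N_lt1 (a : R) : 0 < a -> 0 < (2 : R) `^ (- a) < 1.
Proof.
move=> a0; rewrite powR_gt0//= powRN invf_lt1 ?powR_gt0//.
rewrite -[ltLHS](_ : 1 `^ a = 1); last by rewrite powR1.
by apply: gt0_ltr_powR => //; rewrite ?nnegrE// ltr1n.
Qed.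

Lemma tail_constant_gt0 (a : R) : 0 < a -> 0 < tail_constant a.
Proof.
move=> a0; rewrite mulr_gt0// invr_gt0 subr_gt0 ?cos1_lt1//.
by have /andP[] := powR2N_lt1 a0.
Qed.

Local Open Scope ereal_scope.

Lemma nneseries_geometric_le (c q : R) : (0 <= c)%R -> (0 <= q < 1)%R ->
  \sum_(m <oo) (c * q ^+ m)%:E <= (c / (1 - q))%:E.
Proof.
move=> c0 /andP[q0 q1].
apply: lime_le.
  by apply: is_cvg_nneseries => n _ _; rewrite lee_fin mulr_ge0// exprn_ge0.
apply: nearW => n; rewrite sumEFin lee_fin.
have := congr1 (fun f : R^nat => f n) (@geometric_seriesE R c q _).
rewrite lt_eqF// => /(_ isT); rewrite /series/= => ->.
apply: ler_wpM2r; first by rewrite invr_ge0 subr_ge0 ltW.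
by rewrite ler_piMr// gerBl exprn_ge0.
Qed.

(** The event is covered by shells where |X| / l lies in [2^m, 2^(m+1)]. With t = 2^(-m) / l, 1 -
    cos(t X) is at least 1 - cos 1 on the shell, as 2 <= pi, and has mean 1 - exp(- N t) <= N t <=
    2^(-m a) N(1/l). *)
Lemma cf_tail (X : T -> R) (N : R -> \bar R) (a l : R) :
  (0 < a)%R -> (0 < l)%R -> measurable_fun setT X ->
  (forall t, 0 <= N t) ->
  (forall t, 'E_P[fun w => cos (t * X w)%R] = expeR (- N t)) ->
  (forall s t, (0 <= s <= 1)%R -> N (s * t)%R <= (s `^ a)%:E * N t) ->
  P [set w | (l <= `|X w|)%R] <= (tail_constant a)%:E * N l^-1%R.
Proof.
move=> a0 l0 mX N0 cf Nhom.
have c0 : (0 < 1 - cos 1 :> R)%R by rewrite subr_gt0 cos1_lt1.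
have /andP[q0 q1] := powR2N_lt1 a0; set q := (2 `^ (- a))%R in q0 q1.
pose s m : R := (2 ^- m)%R.
have s0 m : (0 < s m)%R by rewrite invr_gt0 exprn_gt0.
have s1 m : (s m <= 1)%R by rewrite invf_le1 ?exprn_gt0// exprn_ege1// ler1n.
have sq m : (s m `^ a = q ^+ m)%R.
  rewrite /s /q -powR_invn// -powRrM -[in RHS]powR_mulrn ?powR_ge0//.
  by rewrite -powRrM mulNr mulNr mulrC.
have mc t : measurable_fun setT (fun w => t * X w)%R by exact: measurable_funM.
have one_cos t : 1 - 'E_P[fun w => cos (t * X w)%R] <= N t.
  rewrite cf; case: (N t) (N0 t) => [x _| _|//]; last by rewrite leey.
  by rewrite /= -EFinB lee_fin lerBlDl addrC -lerBlDl; have := expR_ge1Dx (- x); lra.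
pose F m := [set w | (1 <= `|s m * l^-1 * X w| <= 2)%R].
have mF m : measurable (F m).
  rewrite (_ : F m = [set w | (1 <= `|s m * l^-1 * X w|)%R] `&`
      [set w | (`|s m * l^-1 * X w| <= 2)%R]); last first.
    by apply/seteqP; split => w /=; [move=> /andP[]|move=> [? ?]; apply/andP].
  apply: measurableI; first exact: measurable_norm_ge.
  by apply: measurable_le_rv => //; exact: measurableT_comp.
have PF m : P (F m) <= ((1 - cos 1)^-1 * q ^+ m)%:E * N l^-1%R.
  have b1 : bounded_rv (fun=> 1%R : R) := @bounded_rv_cst _ T R 1%R.
  have bc := bounded_rv_cos (mc (s m * l^-1)%R).
  have := @markov_mean _ _ _ P _ _ _ (bounded_rvB b1 bc) (mF m) c0.
  move=> /(_ _ _) h; apply: (le_trans (h _ _)).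
  - by move=> w; rewrite subr_ge0 cos_le1.
  - by move=> w Fw; rewrite lerD2l lerN2 cos_le_cos1.
  rewrite meanB// mean_cst mulrC EFinM EFinM -muleA; apply: lee_wpmul2l.
    by rewrite lee_fin invr_ge0 ltW.
  rewrite EFinB -expectation_mean// (le_trans (one_cos _))// -sq.
  by apply: Nhom; rewrite ltW//= s1.
have mU : measurable (\bigcup_m F m) by exact: bigcupT_measurable.
have mA : measurable [set w | (l <= `|X w|)%R] by exact: measurable_norm_ge.
have sub : [set w | (l <= `|X w|)%R] `<=` \bigcup_m F m.
  move=> w /= lX.
  have Xl : (1 <= `|X w| / l)%R by rewrite ler_pdivlMr// mul1r.
  pose n := Num.truncn (`|X w| / l)%R.
  have y0 : (0 <= `|X w| / l)%R by rewrite (le_trans ler01).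
  have /andP[ny yn] := truncn_itv y0.
  have n0 : (1 < n.+1)%N by rewrite -(ltr_nat R) (le_lt_trans Xl).
  have /andP[mn nm] := trunc_log_bounds (ltnSn 1) n0.
  (* With n the integer part of |X w| / l, 2^m <= n < 2^(m+1) gives |X w| / l < n + 1 <= 2^(m+1). *)
  exists (trunc_log 2 n) => //=; rewrite /F/= -mulrA normrM gtr0_norm//.
  rewrite normrM mulrC (gtr0_norm (_ : 0 < l^-1)%R) ?invr_gt0// mulrC.
  rewrite /s mulrC ler_pdivlMr ?exprn_gt0// ler_pdivrMr ?exprn_gt0// mul1r.
  rewrite -exprS -!natrX mulrC.
  rewrite (le_trans _ ny) ?ler_nat//=.
  by rewrite (le_trans (ltW yn))// ler_nat.
apply: (le_trans (le_measure P _ _ sub)); rewrite ?inE//.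
apply: (le_trans (measure_sigma_subadditive _ mF mU (@subset_refl _ _))).
apply: (@le_trans _ _ (\sum_(m <oo) ((1 - cos 1)^-1 * q ^+ m)%:E * N l^-1%R)).
  by apply: lee_nneseries => // m _; exact: PF.
case: (N l^-1%R) (N0 l^-1%R) => [x x0| _|//]; last first.
  by rewrite gt0_muley ?leey// lte_fin tail_constant_gt0.
under eq_eseriesr do rewrite muleC.
rewrite nneseriesZl; last first.
  by move=> m _; rewrite lee_fin mulr_ge0 ?invr_ge0 ?exprn_ge0// ltW.
rewrite muleC lee_wpmul2r// nneseries_geometric_le// ?invr_ge0 ?ltW//.
Qed.

End TailBound.

(** * Uniform approximation by trigonometric polynomials *)

Section TrigApproximation.
Context {R : realType} {n : nat}.
Implicit Types (x y : 'rV[R]_n) (t : 'I_n -> R) (p q g : 'rV[R]_n -> R).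

Definition dot t x : R := \sum_j t j * x 0 j.

Inductive trig_poly : ('rV[R]_n -> R) -> Prop :=
| trig_poly_cos c t : trig_poly (fun x => c * cos (dot t x))
| trig_poly_sin c t : trig_poly (fun x => c * sin (dot t x))
| trig_polyD p q : trig_poly p -> trig_poly q -> trig_poly (fun x => p x + q x).

Lemma dotD t t' x : dot (fun j => t j + t' j) x = dot t x + dot t' x.
Proof. by rewrite -big_split; apply: eq_bigr => j _; rewrite mulrDl. Qed.

Lemma dotB t t' x : dot (fun j => t j - t' j) x = dot t x - dot t' x.
Proof. by rewrite -sumrB; apply: eq_bigr => j _; rewrite mulrBl. Qed.

Lemma trig_poly_coscos c t t' : trig_poly (fun x => c * (cos (dot t x) * cos (dot t' x))).
Proof.
have -> : (fun x => c * (cos (dot t x) * cos (dot t' x))) =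
    (fun x => c / 2 * cos (dot (fun j => t j + t' j) x) +
              c / 2 * cos (dot (fun j => t j - t' j) x)).
  by apply/funext => x; rewrite dotD dotB cosD cosB; field.
by apply: trig_polyD; exact: trig_poly_cos.
Qed.

Lemma trig_poly_sinsin c t t' : trig_poly (fun x => c * (sin (dot t x) * sin (dot t' x))).
Proof.
have -> : (fun x => c * (sin (dot t x) * sin (dot t' x))) =
    (fun x => - c / 2 * cos (dot (fun j => t j + t' j) x) +
              c / 2 * cos (dot (fun j => t j - t' j) x)).
  by apply/funext => x; rewrite dotD dotB cosD cosB; field.
by apply: trig_polyD; exact: trig_poly_cos.
Qed.

Lemma trig_poly_sincos c t t' : trig_poly (fun x => c * (sin (dot t x) * cos (dot t' x))).
Proof.
have -> : (fun x => c * (sin (dot t x) * cos (dot t' x))) =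
    (fun x => c / 2 * sin (dot (fun j => t j + t' j) x) +
              c / 2 * sin (dot (fun j => t j - t' j) x)).
  by apply/funext => x; rewrite dotD dotB sinD sinB; field.
by apply: trig_polyD; exact: trig_poly_sin.
Qed.

Lemma trig_polyM p q : trig_poly p -> trig_poly q -> trig_poly (fun x => p x * q x).
Proof.
have E (f g : 'rV[R]_n -> R) : f =1 g -> trig_poly f -> trig_poly g.
  by move=> /funext ->.
move=> Tp Tq; elim: Tp => {p} [c t|c t|p1 p2 _ h1 _ h2]; last first.
- by apply: E (trig_polyD h1 h2) => x; rewrite mulrDl.
- elim: Tq => {q} [c' t'|c' t'|q1 q2 _ h1 _ h2]; last first.
  + by apply: E (trig_polyD h1 h2) => x; rewrite mulrDr.
  + by apply: E (trig_poly_sinsin (c * c') t t') => x; ring.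
  + by apply: E (trig_poly_sincos (c * c') t t') => x; ring.
- elim: Tq => {q} [c' t'|c' t'|q1 q2 _ h1 _ h2]; last first.
  + by apply: E (trig_polyD h1 h2) => x; rewrite mulrDr.
  + by apply: E (trig_poly_sincos (c * c') t' t) => x; ring.
  + by apply: E (trig_poly_coscos (c * c') t t') => x; ring.
Qed.

Lemma trig_poly_cst c : trig_poly (fun=> c).
Proof.
have -> : (fun=> c) = (fun x => c * cos (dot (fun=> 0) x)).
  apply/funext => x; rewrite /dot big1 ?cos0 ?mulr1// => j _.
  by rewrite mul0r.
exact: trig_poly_cos.
Qed.

Lemma trig_poly_bounded p : trig_poly p -> exists M, forall x, `|p x| <= M.
Proof.
elim => {p} [c t|c t|p1 p2 _ [M1 h1] _ [M2 h2]].
- by exists `|c| => x; rewrite normrM ler_piMr// cos_max.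
- by exists `|c| => x; rewrite normrM ler_piMr// sin_max.
- by exists (M1 + M2) => x; rewrite (le_trans (ler_normD _ _))// lerD.
Qed.

(** Approximation is uniform on the whole space, so it passes to means without tightness. The class
    is that of almost periodic functions; it is shown to be an algebra and a lattice. *)
Definition trig_approx g :=
  forall e, 0 < e -> exists2 p, trig_poly p & forall x, `|g x - p x| <= e.

Lemma trig_approx_poly p : trig_poly p -> trig_approx p.
Proof. by move=> Tp e e0; exists p => // x; rewrite subrr normr0 ltW. Qed.

Lemma trig_approx_bounded g : trig_approx g -> exists2 M, 0 < M & forall x, `|g x| <= M.
Proof.
move=> /(_ 1 ltr01)[p /trig_poly_bounded[M pM] gp].
exists (1 + `|M|) => [|x]; first by rewrite ltr_pwDl.
rewrite -(subrK (p x) (g x)) (le_trans (ler_normD _ _))// lerD//.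
by rewrite (le_trans (pM x))// ler_norm.
Qed.

Lemma trig_approx_lim g :
  (forall e, 0 < e -> exists2 g', trig_approx g' & forall x, `|g x - g' x| <= e) ->
  trig_approx g.
Proof.
move=> h e e0; have e20 : 0 < e / 2 by rewrite divr_gt0.
have [g' /(_ _ e20)[p Tp g'p] gg'] := h _ e20.
exists p => // x; rewrite -(subrKA (g' x)) (splitr e).
by rewrite (le_trans (ler_normD _ _))// lerD.
Qed.

Lemma trig_approxD g g' : trig_approx g -> trig_approx g' ->
  trig_approx (fun x => g x + g' x).
Proof.
move=> h h' e e0; have e20 : 0 < e / 2 by rewrite divr_gt0.
have [p Tp gp] := h _ e20; have [p' Tp' gp'] := h' _ e20.
exists (fun x => p x + p' x) => [|x]; first exact: trig_polyD.
rewrite opprD addrACA (splitr e).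
by rewrite (le_trans (ler_normD _ _))// lerD.
Qed.

Lemma trig_approxM g g' : trig_approx g -> trig_approx g' ->
  trig_approx (fun x => g x * g' x).
Proof.
move=> h h' e e0.
have [M M0 gM] := trig_approx_bounded h.
have eM : 0 < e / 2 / M by rewrite !divr_gt0.
have [p' Tp' gp'] := h' _ eM.
have [N pN] := trig_poly_bounded Tp'.
have N0 : 0 < `|N| + 1 by rewrite ltr_wpDl.
have eN : 0 < e / 2 / (`|N| + 1) by rewrite !divr_gt0.
have [p Tp gp] := h _ eN.
exists (fun x => p x * p' x) => [|x]; first exact: trig_polyM.
have -> : g x * g' x - p x * p' x = g x * (g' x - p' x) + (g x - p x) * p' x by ring.
rewrite (splitr e) (le_trans (ler_normD _ _))// lerD// normrM.
  by rewrite -[leRHS](divfK (lt0r_neq0 M0)) [leRHS]mulrC ler_pM.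
rewrite -[leRHS](divfK (lt0r_neq0 N0)) ler_pM//.
by rewrite (le_trans (pN x))// (le_trans (ler_norm _))// lerDl.
Qed.

Lemma trig_approx_cst c : trig_approx (fun=> c).
Proof. exact/trig_approx_poly/trig_poly_cst. Qed.

(* The iteration p := p + (u^2 - p^2) / 2 increases to |u| for |u| <= 1. *)
Fixpoint abs_iter (k : nat) (u : R) : R :=
  if k is k'.+1 then
    abs_iter k' u + (u * u - abs_iter k' u * abs_iter k' u) / 2
  else 0.

(** One step multiplies the error |u| - p by 1 - (|u| + p)/2 <= 1 - |u|/2. The invariant turns this
    into an error of at most 2/k, uniform in u although the contraction degenerates as u tends to
    0. *)
Lemma abs_iter_dist k u : `|u| <= 1 ->
  0 <= abs_iter k u <= `|u| /\ (`|u| - abs_iter k u) * (1 + k%:R * `|u| / 2) <= `|u|.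
Proof.
move=> u1; set s := `|u| in u1 *.
have s0 : 0 <= s by rewrite /s.
have us : u * u = s * s by rewrite /s -normrM ger0_norm// -expr2 sqr_ge0.
elim: k => [|k [/andP[p0 ps] h]].
  by rewrite /= lexx s0; split => //; rewrite !mul0r subr0 addr0 mulr1.
rewrite /= us; set p := abs_iter k u in p0 ps h *.
have E : s - (p + (s * s - p * p) / 2) = (s - p) * (1 - (s + p) / 2) by field.
have sp2 : 0 <= 1 - (s + p) / 2 by lra.
split.
  apply/andP; split; first by rewrite addr_ge0// divr_ge0// subr_ge0; exact: ler_pM.
  by rewrite -subr_ge0 E mulr_ge0// subr_ge0.
rewrite E; apply: le_trans h; rewrite -mulrA ler_wpM2l ?subr_ge0//.
have k0 : 0 <= k%:R * s by rewrite mulr_ge0.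
apply: (@le_trans _ _ ((1 - s / 2) * (1 + k.+1%:R * s / 2))).
  by rewrite ler_wpM2r//; [rewrite addr_ge0// divr_ge0// mulr_ge0|lra].
rewrite -(natr1 k).
have ks : 0 <= k%:R * s * s by rewrite mulr_ge0.
have ss : 0 <= s * s by rewrite mulr_ge0.
by move: (k%:R) ks k0 => K; lra.
Qed.

Lemma abs_iter_cvg (u : R) k : `|u| <= 1 -> `| `|u| - abs_iter k.+1 u| <= 2 / k.+1%:R.
Proof.
move=> u1; have [/andP[p0 pu] h] := abs_iter_dist k.+1 u1.
rewrite ger0_norm ?subr_ge0// ler_pdivlMr//.
have [u0|u0] := eqVneq u 0.
  have : abs_iter k.+1 u = 0 by apply/eqP; rewrite eq_le p0 andbT -[leRHS](normr0 R) -u0.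
  by move=> ->; rewrite u0 normr0 subr0 mul0r.
have un : 0 < `|u| by rewrite normr_gt0.
rewrite -(ler_pM2r un); move: h; set p := abs_iter _ _ => h.
suff : (`|u| - p) * (k.+1%:R * `|u| / 2) <= `|u| by lra.
by apply: le_trans h; rewrite ler_wpM2l ?subr_ge0// lerDr.
Qed.

Lemma trig_approx_norm g : trig_approx g -> trig_approx (fun x => `|g x|).
Proof.
move=> ag; have [M M0 gM] := trig_approx_bounded ag.
pose u x := M^-1 * g x.
have au : trig_approx u by apply: trig_approxM => //; exact: trig_approx_cst.
have u1 x : `|u x| <= 1 by rewrite /u normrM gtr0_norm ?invr_gt0// ler_pdivrMl// mulr1.
have aiter k : trig_approx (fun x => abs_iter k (u x)).
  elim: k => [|k ih] /=; first exact: trig_approx_cst.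
  apply: (trig_approxD ih).
  have -> : (fun x => (u x * u x - abs_iter k (u x) * abs_iter k (u x)) / 2) =
     (fun x => 2^-1 * (u x * u x) + (- 2^-1) * (abs_iter k (u x) * abs_iter k (u x))).
    by apply/funext => x; ring.
  by apply: trig_approxD; apply: trig_approxM; do ?[exact: trig_approx_cst|exact: trig_approxM].
have aabs : trig_approx (fun x => `|u x|).
  apply: trig_approx_lim => e e0.
  pose k := Num.truncn (2 / e).
  exists (fun x => abs_iter k.+1 (u x)) => // x.
  rewrite (le_trans (abs_iter_cvg _ (u1 x)))// ler_pdivrMr// mulrC -ler_pdivrMr//.
  have e20 : 0 <= 2 / e by rewrite divr_ge0// ltW.
  by have /andP[_ /ltW] := truncn_itv e20.
have -> : (fun x => `|g x|) = (fun x => M * `|u x|).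
  by apply/funext => x; rewrite /u normrM mulrA gtr0_norm ?invr_gt0// divff ?gt_eqF// mul1r.
by apply: trig_approxM => //; exact: trig_approx_cst.
Qed.

Lemma trig_approx_min g g' : trig_approx g -> trig_approx g' ->
  trig_approx (fun x => Num.min (g x) (g' x)).
Proof.
move=> ag ag'.
have -> : (fun x => Num.min (g x) (g' x)) =
    (fun x => 2^-1 * (g x + g' x + (- 1) * `|g x + (- 1) * g' x|)).
  apply/funext => x; rewrite !mulN1r; have [gg|gg] := leP (g x) (g' x).
    by rewrite ler0_norm ?subr_le0//; field.
  by rewrite gtr0_norm ?subr_gt0//; field.
apply: trig_approxM; first exact: trig_approx_cst.
apply: trig_approxD; first exact: trig_approxD.
apply: trig_approxM; first exact: trig_approx_cst.
apply: trig_approx_norm; apply: trig_approxD => //.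
by apply: trig_approxM => //; exact: trig_approx_cst.
Qed.

Lemma trig_approx_sum (I : Type) (s : seq I) (g : I -> 'rV[R]_n -> R) :
  (forall i, trig_approx (g i)) -> trig_approx (fun x => \sum_(i <- s) g i x).
Proof.
move=> ag; elim: s => [|i s ih].
  by under eq_fun do rewrite big_nil; exact: trig_approx_cst.
by under eq_fun do rewrite big_cons; exact: trig_approxD.
Qed.

Lemma trig_approx_bigmin (I : Type) (s : seq I) (c : R) (g : I -> 'rV[R]_n -> R) :
  (forall i, trig_approx (g i)) ->
  trig_approx (fun x => \big[Num.min/c]_(i <- s) g i x).
Proof.
move=> ag; elim: s => [|i s ih].
  by under eq_fun do rewrite big_nil; exact: trig_approx_cst.
by under eq_fun do rewrite big_cons; exact: trig_approx_min.
Qed.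

Lemma trig_approx_norm_sin (th c : R) (j : 'I_n) :
  trig_approx (fun x => `|sin (th * (x 0 j - c))|).
Proof.
apply: trig_approx_norm.
pose t i := if i == j then th else 0.
have dt x : dot t x = th * x 0 j.
  rewrite /dot (bigD1 j)//= /t eqxx big1 ?addr0// => i /negbTE ->.
  by rewrite mul0r.
have -> : (fun x : 'rV[R]_n => sin (th * (x 0 j - c))) =
    (fun x => cos (th * c) * sin (dot t x) + (- sin (th * c)) * cos (dot t x)).
  by apply/funext => x; rewrite dt mulrBr sinB; ring.
by apply: trig_approx_poly; apply: trig_polyD;
  [exact: trig_poly_sin|exact: trig_poly_cos].
Qed.

End TrigApproximation.

Section LipschitzApproximation.
Context {R : realType}.

Lemma sin_near0 : exists2 e : R, 0 < e &
  forall s, `|s| <= e -> `|s| / 2 <= `|sin s| <= 2 * `|s|.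
Proof.
have d : h^-1 *: (sin (h *: 1 + 0) - sin 0) @[h --> (0 : R)^'] --> cos (0 : R).
  have ds := is_derive_sin (0 : R).
  have -> : cos (0 : R) = 'D_1 sin (0 : R) by rewrite derive_val.
  exact: ex_derive.
have h12 : (0 : R) < 1 / 2 by lra.
rewrite cos0 in d; have /cvgrPdist_le /(_ _ h12) := d.
rewrite near_withinE => /nbhs_normP[e /= e0 he].
exists (e / 2) => [|s se]; first by rewrite divr_gt0.
have [->|s0] := eqVneq s 0; first by rewrite sin0 normr0; lra.
have := he s; rewrite /= sub0r normrN => /(_ _ s0).
have -> : `|s| < e by rewrite (le_lt_trans se)// ltr_pdivrMr// mulr2n mulrDr mulr1 ltrDl.
move=> /(_ isT); rewrite sin0 subr0 addr0 [_ *: 1]mulr1 => h.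
have sp : 0 < `|s| by rewrite normr_gt0.
have E : `|sin s| = `|s^-1 *: sin s| * `|s|.
  by rewrite -normrM [_ *: _]mulrC divfK.
rewrite E (mulrC `|s|) !ler_pM2r//.
move: h; set y := _ *: _; rewrite ler_distl => /andP[h1 h2].
by rewrite ger0_norm; lra.
Qed.

Context {n : nat}.
Implicit Types (x y : 'rV[R]_n).

Definition l1dist x y : R := \sum_j `|x 0 j - y 0 j|.

(* On the box, phi x is within e of the minimum over a fine grid of points y of
   phi y + 2 L |x - y|_1, and |s| is comparable to |sin s| for small s. *)
Lemma lipschitz_trig_approx (phi : 'rV[R]_n -> R) (M L K e : R) :
  (forall x, `|phi x| <= M) -> 0 <= L ->
  (forall x y, `|phi x - phi y| <= L * l1dist x y) -> 0 < K -> 0 < e ->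
  exists psi, [/\ trig_approx psi, forall x, `|psi x| <= M &
    forall x, (forall j, `|x 0 j| <= K) -> `|phi x - psi x| <= e].
Proof.
move=> phiM L0 phiL K0 e0.
have [s0 s00 sinP] := sin_near0.
(* For points of the box, |th (x_j - y_j)| <= s0, the range in which |sin s| lies between |s|/2 and
   2|s|. *)
pose th := s0 / (2 * K).
have th0 : 0 < th by rewrite divr_gt0// mulr_gt0.
(* At a grid point y at distance D from x in the l1 metric, the error is at most L D from [phi] plus
   2 L * 2 D from the penalty, hence the factor 5; n mesh widths bound D. *)
pose N := (Num.truncn (5 * L * n%:R * (2 * K) / e)).+1.
have Nbig : 5 * L * n%:R * (2 * K / N%:R) <= e.
  rewrite mulrA ler_pdivrMr// [leRHS]mulrC -ler_pdivrMr//.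
  have z0 : 0 <= 5 * L * n%:R * (2 * K) / e.
    by rewrite divr_ge0 ?(ltW e0)// !mulr_ge0// ltW.
  by have /andP[_ /ltW] := truncn_itv z0.
pose y (k : {ffun 'I_n -> 'I_N.+1}) : 'rV[R]_n :=
  \row_j (- K + 2 * K / N%:R * (k j)%:R).
(* On the box the penalty is at least L times the distance, so each term is at least [phi x]. The
   default M of the minimum keeps [psi] below M off the box as well. *)
pose term k x := phi (y k) + 2 * L / th * \sum_j `|sin (th * (x 0 j - y k 0 j))|.
pose psi x := \big[Num.min/M]_(k : {ffun 'I_n -> 'I_N.+1}) term k x.
have ybox k j : `|y k 0 j| <= K.
  rewrite mxE ler_norml lerDl; apply/andP; split.
    by apply: mulr_ge0 => //; apply: divr_ge0 => //; rewrite mulr_ge0// ltW.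
  rewrite -lerBrDl opprK -ler_pdivlMl ?divr_gt0 ?mulr_gt0//.
  rewrite invf_div -mulrA; have -> : (2 * K)^-1 * (K + K) = 1 by field; rewrite gt_eqF.
  by rewrite mulr1 ler_nat -ltnS.
have box x k : (forall j, `|x 0 j| <= K) ->
    l1dist x (y k) / 2 <= th^-1 * \sum_j `|sin (th * (x 0 j - y k 0 j))| <=
    2 * l1dist x (y k).
  move=> xK; rewrite /l1dist mulr_suml !mulr_sumr.
  have hj j : `|x 0 j - y k 0 j| / 2 <= th^-1 * `|sin (th * (x 0 j - y k 0 j))| <=
      2 * `|x 0 j - y k 0 j|.
    have xy : `|x 0 j - y k 0 j| <= 2 * K.
      rewrite (le_trans (ler_normB _ _))// mulr2n mulrDl mul1r.
      by rewrite lerD// xK.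
    have := sinP (th * (x 0 j - y k 0 j)); rewrite normrM (gtr0_norm th0).
    have -> : th * `|x 0 j - y k 0 j| <= s0.
      by rewrite -ler_pdivlMl// (le_trans xy)// /th invf_div divfK// gt_eqF.
    move=> /(_ isT) /andP[h1 h2]; rewrite ler_pdivlMl// ler_pdivrMl//.
    by apply/andP; split; [move: h1|move: h2]; lra.
  by apply/andP; split; apply: ler_sum => j _; have /andP[] := hj j.
have termM k x : - M <= term k x.
  apply: (@le_trans _ _ (phi (y k))).
    by have := phiM (y k); rewrite ler_norml => /andP[].
  rewrite lerDl; apply: mulr_ge0; last by rewrite sumr_ge0.
  by apply: divr_ge0; [rewrite mulr_ge0|exact: ltW].
have M0 : 0 <= M by rewrite (le_trans _ (phiM 0)).
exists psi; split.
- apply: trig_approx_bigmin => k; apply: trig_approxD; first exact: trig_approx_cst.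
  apply: trig_approxM; first exact: trig_approx_cst.
  by apply: trig_approx_sum => j; exact: trig_approx_norm_sin.
- move=> x; rewrite ler_norml; apply/andP; split.
    by apply: (big_ind (fun z => - M <= z)) => [|z w zM wM|k _];
      rewrite ?le_min ?zM ?wM//; lra.
  by rewrite /psi; elim/big_rec: _ => // k z _ zM; rewrite ge_min zM orbT.
move=> x xK.
have lower : phi x <= psi x.
  apply: (big_ind (fun z => phi x <= z)) => [|z w zx wx|k _].
  - by have := phiM x; rewrite ler_norml => /andP[].
  - by rewrite le_min zx wx.
  have /andP[h _] := box x k xK.
  have := phiL x (y k); rewrite ler_norml => /andP[_ h2].
  have : 2 * L * (l1dist x (y k) / 2) <=
      2 * L * (th^-1 * \sum_j `|sin (th * (x 0 j - y k 0 j))|).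
    by rewrite ler_wpM2l// mulr_ge0.
  rewrite /term -[_ / th * _]mulrA; move: (th^-1 * _) => S h3; lra.
rewrite distrC ger0_norm ?subr_ge0//.
(* The coordinate in units of the mesh. It reaches N at the right end of the box, hence [N.+1] grid
   points per axis. *)
pose q j := (x 0 j + K) / (2 * K / N%:R).
have c0 : 0 < 2 * K / N%:R by rewrite divr_gt0// mulr_gt0.
have q0 j : 0 <= q j.
  apply: divr_ge0; last exact: ltW.
  by have := xK j; rewrite ler_norml => /andP[]; lra.
have qN j : (Num.truncn (q j) < N.+1)%N.
  rewrite ltnS -(ler_nat R); have /andP[+ _] := truncn_itv (q0 j) => /le_trans; apply.
  rewrite /q invf_div mulrA ler_pdivrMr ?mulr_gt0// mulrC ler_pM2l//.
  by have := xK j; rewrite ler_norml => /andP[]; lra.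
pose k := [ffun j => Ordinal (qN j)].
have xyk j : `|x 0 j - y k 0 j| <= 2 * K / N%:R.
  rewrite mxE ffunE/=; have /andP[h1 h2] := truncn_itv (q0 j).
  have E : x 0 j = - K + 2 * K / N%:R * q j by rewrite mulrC divfK ?gt_eqF//; ring.
  rewrite {1}E opprD addrACA subrr add0r -mulrBr normrM gtr0_norm//.
  rewrite -[leRHS]mulr1; apply: ler_wpM2l; first exact: ltW.
  by rewrite ger0_norm ?subr_ge0// lerBlDl natr1 ltW.
have dk : l1dist x (y k) <= n%:R * (2 * K / N%:R).
  apply: (le_trans (ler_sum _ (fun j _ => xyk j))).
  by rewrite sumr_const card_ord [leRHS]mulr_natl.
have psik : psi x <= term k x.
  by rewrite /psi (bigD1 k)//= ge_min lexx.
rewrite lerBlDr (le_trans psik)//.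
have /andP[_ h] := box x k xK.
have := phiL x (y k); rewrite ler_norml => /andP[h2 _].
have h3 : 2 * L * (th^-1 * \sum_j `|sin (th * (x 0 j - y k 0 j))|) <=
    2 * L * (2 * l1dist x (y k)) by rewrite ler_wpM2l// mulr_ge0.
have h4 : L * l1dist x (y k) <= L * (n%:R * (2 * K / N%:R)) by rewrite ler_wpM2l.
rewrite /term -[_ / th * _]mulrA; move: (th^-1 * _) h3 => S h3.
have : 5 * (L * (n%:R * (2 * K / N%:R))) <= e by move: Nbig; rewrite -!mulrA.
lra.
Qed.

End LipschitzApproximation.

Section UnionBound.
Context {d : measure_display} {T : measurableType d} {R : realType}.
Variable P : probability T R.

Lemma probability_bigU_le (I : Type) (s : seq I) (F : I -> set T) (e : I -> R) :
  (forall i, measurable (F i)) -> (forall i, (P (F i) <= (e i)%:E)%E) ->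
  (P (\big[setU/set0]_(i <- s) F i) <= (\sum_(i <- s) e i)%:E)%E.
Proof.
move=> mF Fe; elim: s => [|i s ih]; first by rewrite !big_nil measure0.
rewrite !big_cons EFinD; apply: le_trans (leeD (Fe i) ih).
by apply: measureU2 => //; exact: bigsetU_measurable.
Qed.

End UnionBound.

Section TrigApproxMeasurable.
Context {R : realType} {n : nat} {d : measure_display} {T : measurableType d}.
Variables (P : probability T R) (X : T -> 'rV[R]_n).
Hypothesis mX : forall j, measurable_fun setT (fun w => X w 0 j).

Lemma measurable_dot (t : 'I_n -> R) : measurable_fun setT (fun w => dot t (X w)).
Proof.
by apply: measurable_sum => j; exact: measurable_funM.
Qed.

Lemma bounded_rv_trig_poly p : trig_poly p -> bounded_rv (p \o X).
Proof.
elim => {p} [c t|c t|p q _ hp _ hq].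
- exact/bounded_rvZ/bounded_rv_cos/measurable_dot.
- exact/bounded_rvZ/bounded_rv_sin/measurable_dot.
- exact: (bounded_rvD hp hq).
Qed.

Lemma natS_inv_gt0 (k : nat) : 0 < k.+1%:R^-1 :> R.
Proof. by rewrite invr_gt0. Qed.

Lemma bounded_rv_trig_approx g : trig_approx g -> bounded_rv (g \o X).
Proof.
move=> ag; split; last first.
  by have [M _ gM] := trig_approx_bounded ag; exists M => w; exact: gM.
pose p k := sval (cid2 (ag _ (natS_inv_gt0 k))).
have pT k : trig_poly (p k) by rewrite /p; case: cid2.
have gp k x : `|g x - p k x| <= k.+1%:R^-1 by rewrite /p; case: cid2 => /= q _.
apply: (@measurable_fun_cvg _ _ _ _ (fun k => p k \o X)).
  by move=> k; have [] := bounded_rv_trig_poly (pT k).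
move=> w _; apply/cvgrPdist_le => e e0; near=> k.
rewrite (le_trans (gp k _))//; near: k.
by have := near_infty_natSinv_lt (PosNum e0); apply: filterS => k /ltW.
Unshelve. all: by end_near. Qed.

(** Measurability is that of a pointwise limit of trigonometric approximations, on boxes of
    half-width k + 1 with error 1/(k + 1): each value of [X] eventually lies in the box. *)
Lemma bounded_rv_lipschitz (phi : 'rV[R]_n -> R) (M L : R) :
  (forall x, `|phi x| <= M) -> 0 <= L ->
  (forall x y, `|phi x - phi y| <= L * l1dist x y) -> bounded_rv (phi \o X).
Proof.
move=> phiM L0 phiL; split; last by exists M => w; exact: phiM.
have K0 k : 0 < k.+1%:R :> R by rewrite ltr0n.
have h k := cid (lipschitz_trig_approx phiM L0 phiL (K0 k) (natS_inv_gt0 k)).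
pose psi k := sval (h k).
have psiP k : [/\ trig_approx (psi k), forall x : 'rV[R]_n, `|psi k x| <= M &
    forall x : 'rV[R]_n, (forall j, `|x 0 j| <= k.+1%:R) -> `|phi x - psi k x| <= k.+1%:R^-1].
  exact: svalP (h k).
apply: (@measurable_fun_cvg _ _ _ _ (fun k => psi k \o X)).
  by move=> k; have [a _ _] := psiP k; have [] := bounded_rv_trig_approx a.
move=> w _; apply/cvgrPdist_le => e e0.
pose K := \sum_j `|X w 0 j|.
have KX j : `|X w 0 j| <= K by rewrite /K (bigD1 j)//= lerDl sumr_ge0.
have KS0 : 0 <= K by rewrite sumr_ge0.
near=> k; have [_ _ /(_ (X w)) h'] := psiP k.
rewrite (le_trans (h' _))//.
  move=> j; rewrite (le_trans (KX j))//.
  apply: (@le_trans _ _ (Num.truncn K).+1%:R).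
    by have /andP[_ /ltW] := truncn_itv KS0.
  by rewrite ler_nat ltnS; near: k; exact: nbhs_infty_ge.
near: k; have := near_infty_natSinv_lt (PosNum e0).
by apply: filterS => k /ltW.
Unshelve. all: by end_near. Qed.

End TrigApproxMeasurable.

(** * Convergence of the means of Lipschitz functions *)

Section WeakConvergence.
Context {R : realType} {n : nat} {I : Type} (F : set_system I) {FF : ProperFilter F}.
Context {d d' : measure_display} {T : measurableType d} {T' : measurableType d'}.
Variables (P : probability T R) (P' : probability T' R).
Variables (X : I -> T -> 'rV[R]_n) (X' : T' -> 'rV[R]_n).
Hypothesis mX : forall i j, measurable_fun setT (fun w => X i w 0 j).
Hypothesis mX' : forall j, measurable_fun setT (fun w => X' w 0 j).
Hypothesis cvg_cos : forall t,
  mean P (fun w => cos (dot t (X i w))) @[i --> F] --> mean P' (fun w => cos (dot t (X' w))).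
Hypothesis cvg_sin : forall t,
  mean P (fun w => sin (dot t (X i w))) @[i --> F] --> mean P' (fun w => sin (dot t (X' w))).
Hypothesis tight : forall e : R, 0 < e -> exists2 K : R, 0 < K &
  (\forall i \near F, forall j, (P [set w | (K <= `|X i w 0 j|)%R] <= e%:E)%E) /\
  (forall j, (P' [set w | (K <= `|X' w 0 j|)%R] <= e%:E)%E).

Lemma mean_trig_poly_cvg p : trig_poly p ->
  mean P (p \o X i) @[i --> F] --> mean P' (p \o X').
Proof.
elim => {p} [c t|c t|p q Tp hp Tq hq].
- rewrite meanZ; last exact/bounded_rv_cos/measurable_dot.
  have -> : (fun i => mean P ((fun x => c * cos (dot t x)) \o X i)) =
      (fun i => c * mean P (fun w => cos (dot t (X i w)))).
    by apply/funext => i; rewrite meanZ//; exact/bounded_rv_cos/measurable_dot.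
  by apply: cvgMl_tmp; exact: cvg_cos.
- rewrite meanZ; last exact/bounded_rv_sin/measurable_dot.
  have -> : (fun i => mean P ((fun x => c * sin (dot t x)) \o X i)) =
      (fun i => c * mean P (fun w => sin (dot t (X i w)))).
    by apply/funext => i; rewrite meanZ//; exact/bounded_rv_sin/measurable_dot.
  by apply: cvgMl_tmp; exact: cvg_sin.
- rewrite meanD; [|exact: bounded_rv_trig_poly..].
  have -> : (fun i => mean P ((fun x => p x + q x) \o X i)) =
      (fun i => mean P (p \o X i) + mean P (q \o X i)).
    by apply/funext => i; rewrite meanD//; exact: (bounded_rv_trig_poly (mX i)).
  exact: cvgD.
Qed.

(* A function that agrees up to e with a trigonometric polynomial on a box that
   carries most of the mass, and is bounded elsewhere. *)
Lemma mean_cvg_approx (g : 'rV[R]_n -> R) :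
  (forall i, bounded_rv (g \o X i)) -> bounded_rv (g \o X') ->
  (forall e, 0 < e -> exists p, trig_poly p /\
    (\forall i \near F, `|mean P (g \o X i) - mean P (p \o X i)| <= e) /\
    `|mean P' (g \o X') - mean P' (p \o X')| <= e) ->
  mean P (g \o X i) @[i --> F] --> mean P' (g \o X').
Proof.
move=> bg bg' h; apply/cvgrPdist_le => e e0.
have e30 : 0 < e / 3 by rewrite divr_gt0.
have [p [Tp [gp gp']]] := h _ e30.
have /cvgrPdist_le /(_ _ e30) := mean_trig_poly_cvg Tp.
apply: filterS2 gp => i gp pp.
have -> : mean P' (g \o X') - mean P (g \o X i) =
  (mean P' (g \o X') - mean P' (p \o X')) + (mean P' (p \o X') - mean P (p \o X i))
  - (mean P (g \o X i) - mean P (p \o X i)) by ring.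
have -> : e = e / 3 + e / 3 + e / 3 by field.
by rewrite (le_trans (ler_normB _ _))// lerD// (le_trans (ler_normD _ _))// lerD.
Qed.

Lemma mean_trig_approx_cvg g : trig_approx g ->
  mean P (g \o X i) @[i --> F] --> mean P' (g \o X').
Proof.
move=> ag; apply: mean_cvg_approx => [i||e e0].
- by apply: bounded_rv_trig_approx ag; exact: mX.
- exact: bounded_rv_trig_approx ag.
have [p Tp gp] := ag _ e0; exists p; split => //.
have key d0 (T0 : measurableType d0) (P0 : probability T0 R) (X0 : T0 -> 'rV[R]_n) :
    (forall j, measurable_fun setT (fun w => X0 w 0 j)) ->
    `|mean P0 (g \o X0) - mean P0 (p \o X0)| <= e.
  move=> mX0.
  rewrite (le_trans (@mean_dist _ _ _ P0 _ _ set0 e e _ _ _ _ _ _))//.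
  - exact: (bounded_rv_trig_approx mX0).
  - exact: (bounded_rv_trig_poly mX0).
  - exact: ltW.
  - by move=> w _; exact: gp.
  - by move=> w; exact: gp.
  - by rewrite measure0 mulr0 addr0.
by split; [apply: nearW => i; exact: key|exact: key].
Qed.

Lemma mean_lipschitz_cvg (phi : 'rV[R]_n -> R) (M L : R) :
  (forall x, `|phi x| <= M) -> 0 <= L ->
  (forall x y, `|phi x - phi y| <= L * l1dist x y) ->
  mean P (phi \o X i) @[i --> F] --> mean P' (phi \o X').
Proof.
move=> phiM L0 phiL.
have M0 : 0 <= M by rewrite (le_trans _ (phiM 0)).
have bphi i : bounded_rv (phi \o X i) by exact: (bounded_rv_lipschitz (mX i) phiM L0).
have bphi' : bounded_rv (phi \o X') by exact: (bounded_rv_lipschitz mX' phiM L0).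
apply/cvgrPdist_le => e e0.
(* Off the box the two functions differ by at most 2 M, on an event of probability at most n e';
   with e' = e / (6 D) this contributes at most e / 6. *)
pose D := 2 * M * n%:R + 1.
have D0 : 0 < D by rewrite ltr_wpDl// !mulr_ge0.
pose e' := e / (6 * D).
have e'0 : 0 < e' by rewrite divr_gt0// mulr_gt0.
have [K K0 [tX tX']] := tight e'0.
have e60 : 0 < e / 6 by rewrite divr_gt0.
have [psi [apsi psiM psiK]] := lipschitz_trig_approx phiM L0 phiL K0 e60.
have key d0 (T0 : measurableType d0) (P0 : probability T0 R) (X0 : T0 -> 'rV[R]_n) :
    (forall j, measurable_fun setT (fun w => X0 w 0 j)) ->
    bounded_rv (phi \o X0) ->
    (forall j, (P0 [set w | (K <= `|X0 w 0 j|)%R] <= e'%:E)%E) ->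
    `|mean P0 (phi \o X0) - mean P0 (psi \o X0)| <= e / 3.
  move=> mX0 bphi0 t0.
  pose A := \big[setU/set0]_(j <- enum 'I_n) [set w | (K <= `|X0 w 0 j|)%R].
  have mA : measurable A.
    by apply: bigsetU_measurable => j _; exact: measurable_norm_ge.
  have PA : fine (P0 A) <= n%:R * e'.
    rewrite -lee_fin fineK ?fin_num_measure//.
    apply: (le_trans (probability_bigU_le _ _ t0)).
      by move=> j; exact: measurable_norm_ge.
    by rewrite big_enum/= sumr_const card_ord mulr_natl.
  rewrite (le_trans (@mean_dist _ _ _ P0 _ _ A (e / 6) (2 * M) _ _ mA _ _ _))//.
  - exact: (bounded_rv_trig_approx mX0).
  - exact: ltW.
  - move=> w nA; apply: psiK => j; rewrite leNgt; apply/negP => Kj.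
    apply: nA; rewrite /A (big_rem j) ?mem_enum//=; left => /=; exact: ltW.
  - move=> w /=; rewrite (le_trans (ler_normB _ _))// mulr2n mulrDl mul1r.
    by rewrite lerD.
  have -> : e / 3 = e / 6 + e / 6 by field.
  rewrite lerD2l (le_trans (ler_wpM2l _ PA)) ?mulr_ge0//.
  have -> : e / 6 = D * e' by rewrite /e'; field; rewrite gt_eqF.
  by rewrite mulrA; apply: ler_wpM2r; [exact: ltW|rewrite /D lerDl].
have e30 : 0 < e / 3 by rewrite divr_gt0.
have /cvgrPdist_le /(_ _ e30) := mean_trig_approx_cvg apsi.
apply: filterS2 tX => i /(key _ _ _ _ (mX i) (bphi i)) h1 h2.
have h3 := key _ _ _ _ mX' bphi' tX'.
have -> : mean P' (phi \o X') - mean P (phi \o X i) =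
  (mean P' (phi \o X') - mean P' (psi \o X')) + (mean P' (psi \o X') - mean P (psi \o X i))
  - (mean P (phi \o X i) - mean P (psi \o X i)) by ring.
have -> : e = e / 3 + e / 3 + e / 3 by field.
by rewrite (le_trans (ler_normB _ _))// lerD// (le_trans (ler_normD _ _))// lerD.
Qed.

End WeakConvergence.

(** * From Lipschitz to bounded continuous test functions *)

Section InfConvolution.
Context {R : realType} {S S' : Type}.
Implicit Types (phi : S -> R) (c : S' -> S -> R).

(** With S' = S this is a Lipschitz regularisation of [phi]; with S' larger it is a McShane
    extension. The proof uses both, hence two types. *)
Definition infconv phi c (x : S') : R := inf (range (fun y => phi y + c x y)).

Variables (phi : S -> R) (M : R) (c : S' -> S -> R) (y0 : S).
Hypotheses (phiM : forall y, `|phi y| <= M) (c0 : forall x y, 0 <= c x y).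

Lemma infconv_ge x m : (forall y, m <= phi y + c x y) -> m <= infconv phi c x.
Proof.
by move=> h; apply: lb_le_inf => [|_ [y _ <-]//]; exists (phi y0 + c x y0), y0.
Qed.

Lemma infconv_le x y : infconv phi c x <= phi y + c x y.
Proof.
apply: ge_inf; last by exists y.
exists (- M) => _ [z _ <-].
by rewrite ler_wpDr//; have := phiM z; rewrite ler_norml => /andP[].
Qed.

Lemma infconv_geN x : - M <= infconv phi c x.
Proof.
apply: infconv_ge => z.
by rewrite ler_wpDr//; have := phiM z; rewrite ler_norml => /andP[].
Qed.

Lemma infconv_dist x x' (e : R) : (forall y, `|c x y - c x' y| <= e) ->
  `|infconv phi c x - infconv phi c x'| <= e.
Proof.
move=> h.
have key z z' : (forall y, `|c z y - c z' y| <= e) ->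
    infconv phi c z - e <= infconv phi c z'.
  move=> hz; apply: infconv_ge => y; have := infconv_le z y; have := hz y.
  by rewrite ler_norml => /andP[_]; lra.
rewrite ler_norml; apply/andP; split.
  have := key x' x; rewrite lerBlDl => h'; rewrite lerBrDl lerBlDl h'// => y.
  by rewrite distrC.
by have := key x x' h; lra.
Qed.

End InfConvolution.

Section Portmanteau.
Context {R : realType} {S : Type} {I : Type} (F : set_system I) {FF : ProperFilter F}.
Context {d d' : measure_display} {T : measurableType d} {T' : measurableType d'}.
Variables (P : probability T R) (P' : probability T' R).

Lemma mean_cvg_dominated (f_ : nat -> T -> R) (f : T -> R) (M : R) :
  (forall k, measurable_fun setT (f_ k)) -> (forall k w, `|f_ k w| <= M) ->
  (forall w, f_ ^~ w @ \oo --> f w) ->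
  bounded_rv f /\ mean P (f_ k) @[k --> \oo] --> mean P f.
Proof.
move=> mf fM ff.
have mf' : measurable_fun setT f.
  by apply: (@measurable_fun_cvg _ _ _ _ f_) => // w _; exact: ff.
have bf : bounded_rv f.
  split => //; exists M => w.
  apply: (cvgr_to_le (cvg_norm (ff w))); exact: nearW.
split => //.
have bk k : bounded_rv (f_ k) by split => //; exists M.
have [|||||_ _ h] := @dominated_convergence _ _ _ P setT measurableT
    (fun k w => (f_ k w)%:E) (fun w => (f w)%:E) (fun=> M%:E).
- by move=> k; exact/measurable_EFinP.
- exact/measurable_EFinP.
- by apply: aeW => w _; apply: cvg_EFin; [exact: nearW|exact: ff].
- exact: (bounded_rv_integrable P (bounded_rv_cst M)).
- by apply: aeW => w k _; rewrite lee_fin.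
have E g : bounded_rv g -> (\int[P]_w (g w)%:E = (mean P g)%:E)%E.
  by move=> bg; rewrite -expectation_mean// unlock.
move: h; rewrite E//; under eq_fun do rewrite E//.
by move=> /fine_cvgP[].
Qed.

End Portmanteau.

Section PortmanteauMetric.
Context {R : realType} {S : Type} {I : Type} (F : set_system I) {FF : ProperFilter F}.
Context {d d' : measure_display} {T : measurableType d} {T' : measurableType d'}.
Variables (P : probability T R) (P' : probability T' R).
Variables (X : I -> T -> S) (X' : T' -> S) (D : nat -> S -> S -> R).
Hypothesis D_ge0 : forall N x y, 0 <= D N x y.
Hypothesis D_refl : forall N x, D N x x = 0.
Hypothesis D_sym : forall N x y, D N x y = D N y x.
Hypothesis D_triangle : forall N x y z, D N x z <= D N x y + D N y z.

Definition lipschitz_test (M : R) (psi : S -> R) : Prop :=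
  (forall x, `|psi x| <= M) /\
  exists N L, 0 <= L /\ forall x y, `|psi x - psi y| <= L * D N x y.

Hypothesis lip_meas : forall M psi, lipschitz_test M psi ->
  (forall i, bounded_rv (psi \o X i)) /\ bounded_rv (psi \o X').
Hypothesis lip_cvg : forall M psi, lipschitz_test M psi ->
  mean P (psi \o X i) @[i --> F] --> mean P' (psi \o X').

(** A sequence of pseudometrics covers both uses: the constant sequence of the l1 distance for
    vectors, and uniform distances on [-N, N] for paths. All large N are demanded at once, because
    the regularisation uses [D N] with weight N + 1. *)
Definition D_continuous (phi : S -> R) : Prop := forall x e, 0 < e ->
  exists N0 : nat, exists2 del : R, 0 < del &
    forall N, (N0 <= N)%N -> forall y, D N x y < del -> `|phi x - phi y| < e.

Variables (phi : S -> R) (M : R).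
Hypotheses (phiM : forall x, `|phi x| <= M) (phic : D_continuous phi).

Let phi_ N (x : S) := infconv phi (fun x y => N.+1%:R * D N x y) x.

Let c0 N x y : 0 <= N.+1%:R * D N x y.
Proof. by rewrite mulr_ge0. Qed.

Let phi_le N x : phi_ N x <= phi x.
Proof.
have := infconv_le phiM (c0 N) x x.
by rewrite D_refl mulr0 addr0.
Qed.

Let phi_lip N : lipschitz_test M (phi_ N).
Proof.
split => [x|].
  rewrite ler_norml (infconv_geN x phiM (c0 N))/= (le_trans (phi_le N x))//.
  exact: le_trans (ler_norm _) (phiM x).
exists N, N.+1%:R; split => // x y.
apply: (infconv_dist x phiM (c0 N)) => z.
rewrite -mulrBr normrM ger0_norm// ler_wpM2l// ler_norml.
have h1 := D_triangle N x y z; have h2 := D_triangle N y x z.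
rewrite (D_sym N y x) in h2; apply/andP; split; lra.
Qed.

Let phi_cvg x : phi_ ^~ x @ \oo --> phi x.
Proof.
apply/cvgrPdist_le => e e0.
have [N0 [del del0 h]] := phic x e0.
near=> N.
rewrite ger0_norm ?subr_ge0// lerBlDr -lerBlDl.
apply: (infconv_ge x) => y.
have [xy|xy] := ltP (D N x y) del.
  have /h : (N0 <= N)%N by near: N; exact: nbhs_infty_ge.
  move=> /(_ _ xy); rewrite ltr_norml => /andP[h1 h2].
  by have := c0 N x y; lra.
(* At distance [del] or more the penalty outweighs the oscillation 2 M of [phi], so only close
   points compete in the infimum. *)
have : 2 * M <= N.+1%:R * D N x y.
  apply: (@le_trans _ _ (N.+1%:R * del)); last by rewrite ler_wpM2l.
  have M0 : 0 <= M by rewrite (le_trans _ (phiM x)).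
  have z0 : 0 <= 2 * M / del by rewrite divr_ge0// ?mulr_ge0// ltW.
  rewrite -ler_pdivrMr//; apply: (@le_trans _ _ (Num.truncn (2 * M / del)).+1%:R).
    by have /andP[_ /ltW] := truncn_itv z0.
  by rewrite ler_nat ltnS; near: N; exact: nbhs_infty_ge.
have := phiM x; have := phiM y; rewrite !ler_norml => /andP[? ?] /andP[? ?].
lra.
Unshelve. all: by end_near. Qed.

Lemma portmanteau_bounded_rv :
  (forall i, bounded_rv (phi \o X i)) /\ bounded_rv (phi \o X').
Proof.
have h N := lip_meas (phi_lip N).
have phi_M N x : `|phi_ N x| <= M by have [] := phi_lip N.
split => [i|].
  have [] := @mean_cvg_dominated _ _ _ P (fun N => phi_ N \o X i) (phi \o X i) M => //.
  - by move=> N; have [/(_ i)[]] := h N.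
  - by move=> N w; exact: phi_M.
  - by move=> w; exact: phi_cvg.
have [] := @mean_cvg_dominated _ _ _ P' (fun N => phi_ N \o X') (phi \o X') M => //.
- by move=> N; have [_ []] := h N.
- by move=> N w; exact: phi_M.
- by move=> w; exact: phi_cvg.
Qed.

(** The regularisations lie below [phi] and their means converge, which bounds the lower limit. The
    upper limit is treated by applying this to the opposite of [phi]. *)
Lemma portmanteau_lower (e : R) : 0 < e ->
  \forall i \near F, mean P' (phi \o X') - e <= mean P (phi \o X i).
Proof.
move=> e0; have e20 : 0 < e / 2 by rewrite divr_gt0.
have [bi b'] := portmanteau_bounded_rv.
have hm N := lip_meas (phi_lip N).
have phi_M N x : `|phi_ N x| <= M by have [] := phi_lip N.
have [||| _] := @mean_cvg_dominated _ _ _ P' (fun N => phi_ N \o X') (phi \o X') M => //.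
- by move=> N; have [_ []] := hm N.
- by move=> N w; exact: phi_M.
- by move=> w; exact: phi_cvg.
move=> /cvgrPdist_le/(_ _ e20)[N _ /(_ N (leqnn N))] hN.
have /cvgrPdist_le/(_ _ e20) := lip_cvg (phi_lip N).
apply: filterS => i hi.
have : mean P (phi_ N \o X i) <= mean P (phi \o X i).
  apply: le_mean => //; last by move=> w; exact: phi_le.
  by have [/(_ i)] := hm N.
move: hN hi; rewrite /= !ler_norml => /andP[? ?] /andP[? ?]; lra.
Qed.

End PortmanteauMetric.

Section PortmanteauCvg.
Context {R : realType} {S : Type} {I : Type} (F : set_system I) {FF : ProperFilter F}.
Context {d d' : measure_display} {T : measurableType d} {T' : measurableType d'}.
Variables (P : probability T R) (P' : probability T' R).
Variables (X : I -> T -> S) (X' : T' -> S) (D : nat -> S -> S -> R).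

Lemma portmanteau (phi : S -> R) (M : R) :
  (forall N x y, 0 <= D N x y) -> (forall N x, D N x x = 0) ->
  (forall N x y, D N x y = D N y x) ->
  (forall N x y z, D N x z <= D N x y + D N y z) ->
  (forall M psi, lipschitz_test D M psi ->
    (forall i, bounded_rv (psi \o X i)) /\ bounded_rv (psi \o X')) ->
  (forall M psi, lipschitz_test D M psi ->
    mean P (psi \o X i) @[i --> F] --> mean P' (psi \o X')) ->
  (forall x, `|phi x| <= M) -> D_continuous D phi ->
  ('E_P[phi \o X i] @[i --> F] --> 'E_P'[phi \o X'])%E.
Proof.
move=> D0 Drefl Dsym Dtri lm lc phiM phic.
have [bi b'] := portmanteau_bounded_rv P P' D0 Drefl Dsym Dtri lm phiM phic.
rewrite (expectation_mean P' b').
rewrite (_ : (fun i => _) = (fun i => (mean P (phi \o X i))%:E)); last first.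
  by apply/funext => i; rewrite expectation_mean.
apply: cvg_EFin; first exact: nearW.
apply/cvgrPdist_le => e e0.
have low := @portmanteau_lower _ _ _ F FF _ _ _ _ P P' X X' D D0 Drefl Dsym Dtri lm lc _ _ phiM phic e e0.
have NphiM x : `|- 1 * phi x| <= M by rewrite mulN1r normrN.
have Nphic : D_continuous D (fun x => - 1 * phi x).
  move=> x e' e'0; have [N0 [del del0 h]] := phic x e' e'0.
  exists N0, del => // N NN0 y xy.
  by rewrite -mulrBr normrM normrN1 mul1r (h N NN0).
have up := @portmanteau_lower _ _ _ F FF _ _ _ _ P P' X X' D D0 Drefl Dsym Dtri lm lc _ _ NphiM Nphic e e0.
move: up low; apply: filterS2 => i up low.
rewrite /=; have E1 := meanZ P (-1) (bi i); have E2 := meanZ P' (-1) b'.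
rewrite /comp in E1 E2 low up *.
by rewrite ler_norml; apply/andP; split; move: low up; rewrite E1 E2; set y := mean _ _; set z := mean _ _; lra.
Qed.

End PortmanteauCvg.

Section ConvergenceInDistribution.
Context {R : realType} {n : nat}.
Context {d d' : measure_display} {T : measurableType d} {T' : measurableType d'}.
Variables (P : probability T R) (P' : probability T' R).
Variables (X : R -> T -> 'rV[R]_n) (X' : T' -> 'rV[R]_n).

Lemma cvg_in_distribution_rV :
  (forall r j, measurable_fun setT (fun w => X r w 0 j)) ->
  (forall j, measurable_fun setT (fun w => X' w 0 j)) ->
  (forall phi M L, (forall x, `|phi x| <= M) -> 0 <= L ->
    (forall x y, `|phi x - phi y| <= L * l1dist x y) ->
    mean P (phi \o X r) @[r --> 0^'+] --> mean P' (phi \o X')) ->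
  cvg_in_distribution P P' X X'.
Proof.
move=> mX mX' h phi phic [M phiM].
apply: (@portmanteau R _ _ (0 : R)^'+ _ _ _ _ _ P P' X X' (fun=> l1dist) phi M) => //.
- by move=> _ x y; rewrite sumr_ge0.
- by move=> _ x; rewrite /l1dist big1// => j _; rewrite subrr normr0.
- by move=> _ x y; apply: eq_bigr => j _; rewrite distrC.
- move=> _ x y z; rewrite -big_split/=; apply: ler_sum => j _.
  by rewrite -(subrKA (y 0 j)) ler_normD.
- move=> M' psi [psiM [_ [L [L0 psiL]]]]; split => [r|].
    exact: bounded_rv_lipschitz psiM L0 psiL.
  exact: bounded_rv_lipschitz psiM L0 psiL.
- by move=> M' psi [psiM [_ [L [L0 psiL]]]]; exact: h psiL.
move=> x e e0.
have /cvgrPdist_lt/(_ _ e0)/nbhs_ballP[del /= del0 hdel] := phic x.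
exists 0%N, del => // _ _ y xy; apply: hdel; split => // i j; rewrite (ord1 i).
rewrite /ball/= (le_lt_trans _ xy)// /l1dist (bigD1 j)//= lerDl.
by rewrite sumr_ge0.
Qed.

End ConvergenceInDistribution.

(** * Chaining and continuous versions *)

Section DyadicChaining.
Context {R : realType}.
Implicit Types (x : R -> R) (t v : R) (N k m j : nat).

Definition dyadic_floor k t : R := (Num.floor (t * 2 ^+ k))%:~R / 2 ^+ k.

(** Counting from the left end -N keeps indices natural; j up to [N.*2 * 2 ^ k] exhausts the grid of
    [-N, N]. *)
Definition grid_point N k j : R := j%:R / 2 ^+ k - N%:R.

Let p2 k : 0 < 2 ^+ k :> R. Proof. by rewrite exprn_gt0. Qed.
Let p2n k : 2 ^+ k != 0 :> R. Proof. by rewrite gt_eqF. Qed.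

Lemma dyadic_floor_itv k t : dyadic_floor k t <= t < dyadic_floor k t + 2 ^- k.
Proof.
have /andP[h1 h2] := floor_itv (t * 2 ^+ k).
rewrite /dyadic_floor ler_pdivrMr// h1/= -[X in _ + X]mul1r -mulrDl.
by rewrite ltr_pdivlMr// -intrD1.
Qed.

Lemma dyadic_floor_cvg t : dyadic_floor ^~ t @ \oo --> t.
Proof.
apply/cvgrPdist_le => e e0; near=> k.
have /andP[h1 h2] := dyadic_floor_itv k t.
rewrite ger0_norm ?subr_ge0// lerBlDl (le_trans (ltW h2))// lerD2l.
rewrite -exprVn -[leLHS]mul1r.
near: k; have := @cvg_geometric R 1 2^-1; rewrite ger0_norm//.
have -> : (2^-1 : R) < 1 by rewrite invf_lt1// ltr1n.
move=> /(_ isT)/cvgr_norm_le h; have := h e; rewrite normr0 => /(_ e0).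
by apply: filterS => k; rewrite /geometric/= ger0_norm.
Unshelve. all: by end_near. Qed.

Lemma grid_point2 N k j : grid_point N k j = grid_point N k.+1 j.*2.
Proof.
rewrite /grid_point; congr (_ - _); rewrite -muln2 natrM exprS.
by field; rewrite p2n.
Qed.

Lemma grid_pointS N k j : grid_point N k j.+1 = grid_point N k j + 2 ^- k.
Proof. by rewrite /grid_point -natr1 mulrDl mul1r addrAC. Qed.

Lemma grid_point_itv N k j : (j <= N.*2 * 2 ^ k)%N ->
  - N%:R <= grid_point N k j <= N%:R.
Proof.
move=> jN; rewrite /grid_point lerDr divr_ge0//= lerBlDr ler_pdivrMr//.
by rewrite -natrD addnn -natrX -natrM ler_nat.
Qed.

Lemma dyadic_floor_grid N k t : - N%:R <= t <= N%:R ->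
  exists2 j, (j <= N.*2 * 2 ^ k)%N & dyadic_floor k t = grid_point N k j.
Proof.
move=> /andP[tN1 tN2].
have h0 : 0 <= (t + N%:R) * 2 ^+ k by rewrite mulr_ge0// ?(ltW (p2 _))// -lerBlDr sub0r.
have E : (t + N%:R) * 2 ^+ k = t * 2 ^+ k + ((N * 2 ^ k)%N : int)%:~R.
  by rewrite mulrDl -natrX -natrM pmulrn.
pose z := Num.floor (t * 2 ^+ k) + (N * 2 ^ k)%N%:Z.
have zE : z = Num.floor ((t + N%:R) * 2 ^+ k) by rewrite E floorDrz ?intr_int// intrKfloor.
have z0 : 0 <= z by rewrite zE floor_ge0.
exists `|z|%N.
  rewrite -lez_nat gez0_abs// -(ler_int R) zE (le_trans (floor_le _))//.
  rewrite -pmulrn -addnn natrM natrX natrD; apply: ler_wpM2r; first exact: ltW.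
  by rewrite lerD2r.
have zR : `|z|%N%:R = z%:~R :> R by rewrite -[in RHS](gez0_abs z0) pmulrn.
apply: (mulIf (p2n k)); rewrite /dyadic_floor /grid_point zR divfK// mulrBl divfK// /z intrD.
by rewrite -natrX -natrM pmulrn addrK.
Qed.

(** The integer part of 2 y is twice that of y or one more, so passing to the next level crosses at
    most one cell of the finer grid. *)
Lemma dyadic_floorS k t :
  dyadic_floor k.+1 t = dyadic_floor k t \/
  dyadic_floor k.+1 t = dyadic_floor k t + 2 ^- k.+1.
Proof.
have /andP[h1 h2] := floor_itv (t * 2 ^+ k).
have /andP[h3 h4] := floor_itv (t * 2 ^+ k.+1).
set z := Num.floor _ in h1 h2 *; set y := Num.floor _ in h3 h4 *.
have : (y = z * 2) \/ (y = z * 2 + 1).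
  have zy : (z * 2 <= y)%R.
    by rewrite -ltzD1 -(ltr_int R) (le_lt_trans _ h4)// intrM exprS mulrCA mulrC ler_wpM2l.
  have yz : (y < z * 2 + 2)%R.
    rewrite -(ltr_int R) (le_lt_trans h3)// intrD intrM exprS mulrCA.
    by move: h2; rewrite intrD/=; lra.
  lia.
by rewrite /dyadic_floor -/z -/y => -[->|->]; [left|right]; rewrite ?intrD intrM exprS;
  field; rewrite p2n.
Qed.

Definition small_increments N k (e : R) x : Prop := forall j, (j < N.*2 * 2 ^ k)%N ->
  `|x (grid_point N k j.+1) - x (grid_point N k j)| < e.

Lemma chain_step N k e x t : 0 < e -> small_increments N k.+1 e x ->
  - N%:R <= t <= N%:R -> `|x (dyadic_floor k.+1 t) - x (dyadic_floor k t)| <= e.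
Proof.
move=> e0 xe tN.
have [j jN jE] := dyadic_floor_grid k tN.
have [j' j'N j'E] := dyadic_floor_grid k.+1 tN.
have [->|E] := dyadic_floorS k t; first by rewrite subrr normr0 ltW.
have Ej : j' = j.*2.+1.
  move: E; rewrite j'E jE (grid_point2 N k j) -grid_pointS /grid_point => /addIr.
  by move=> /(mulIf (invr_neq0 (p2n k.+1)))/eqP; rewrite eqr_nat => /eqP.
by rewrite j'E jE (grid_point2 N k) Ej ltW// xe// -Ej.
Qed.

Section Chain.
Variables (rho : R) (N m : nat) (x : R -> R).
Hypotheses (rho0 : 0 < rho) (rho1 : rho < 1).
Hypothesis xinc : forall k, (m <= k)%N -> small_increments N k (rho ^+ k) x.

Lemma chain_sum k i t : (m <= k)%N -> - N%:R <= t <= N%:R ->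
  `|x (dyadic_floor (k + i) t) - x (dyadic_floor k t)| <=
    rho ^+ k * (1 - rho ^+ i) / (1 - rho).
Proof.
move=> mk tN; have r1 : 1 - rho != 0 by rewrite subr_eq0 gt_eqF.
elim: i => [|i ih]; first by rewrite addn0 subrr normr0 expr0 subrr mulr0 mul0r.
rewrite -(subrKA (x (dyadic_floor (k + i) t))) (le_trans (ler_normD _ _))//.
have h : `|x (dyadic_floor (k + i.+1) t) - x (dyadic_floor (k + i) t)| <= rho ^+ (k + i).
  rewrite addnS (le_trans (chain_step _ (xinc _) tN)) ?exprn_gt0//.
    by rewrite (leq_trans mk)// -addnS leq_addr.
  by rewrite exprS ler_piMl ?exprn_ge0// ltW.
apply: (le_trans (lerD h ih)); rewrite exprD exprS le_eqVlt; apply/orP; left.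
by apply/eqP; field.
Qed.

Lemma chain_sum_le k i t : (m <= k)%N -> - N%:R <= t <= N%:R ->
  `|x (dyadic_floor (k + i) t) - x (dyadic_floor k t)| <= rho ^+ k / (1 - rho).
Proof.
move=> mk tN; apply: (le_trans (chain_sum i mk tN)).
have r1 : 0 < 1 - rho by rewrite subr_gt0.
rewrite ler_pM2r ?invr_gt0// ler_piMr ?exprn_ge0// ?ltW//.
by rewrite ltrBlDr ltrDl exprn_gt0.
Qed.

(** The limit is a parameter: for a path already continuous it is the value at t, otherwise the
    value of the constructed version. *)
Lemma chain_limit k t l : (m <= k)%N -> - N%:R <= t <= N%:R ->
  x (dyadic_floor i t) @[i --> \oo] --> l ->
  `|l - x (dyadic_floor k t)| <= rho ^+ k / (1 - rho).
Proof.
move=> mk tN xl.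
have xl' : `|x (dyadic_floor i t) - x (dyadic_floor k t)| @[i --> \oo] -->
    `|l - x (dyadic_floor k t)|.
  by apply: cvg_norm; apply: cvgB => //; exact: cvg_cst.
apply: (cvgr_to_le xl'); near=> i.
have ki : (k <= i)%N by near: i; exact: nbhs_infty_ge.
by rewrite -(subnKC ki); exact: chain_sum_le.
Unshelve. all: by end_near. Qed.

Lemma rho_pow_small e : 0 < e -> exists2 k, (m <= k)%N & rho ^+ k < e.
Proof.
move=> e0; have := @cvg_geometric R 1 rho; rewrite gtr0_norm// => /(_ rho1).
move=> /cvgr_norm_lt h; have := h e; rewrite normr0 => /(_ e0)[k _ hk].
exists (maxn m k); first exact: leq_maxl.
have := hk (maxn m k) (leq_maxr _ _).
by rewrite /geometric/= mul1r gtr0_norm// exprn_gt0.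
Qed.

Lemma chain_cvg t : - N%:R <= t <= N%:R -> cvg (x (dyadic_floor i t) @[i --> \oo]).
Proof.
move=> tN; apply/cauchy_cvgP/cauchy_ballP => e e0.
have r1 : 0 < 1 - rho by rewrite subr_gt0.
have e1 : 0 < e / 2 * (1 - rho) by rewrite mulr_gt0// divr_gt0.
have [k mk rk] := rho_pow_small e1.
exists ([set z | ball (x (dyadic_floor k t)) (e / 2) z],
  [set z | ball (x (dyadic_floor k t)) (e / 2) z]) => /=.
  have h : \forall i \near \oo, ball (x (dyadic_floor k t)) (e / 2) (x (dyadic_floor i t)).
    near=> i; have ki : (k <= i)%N by near: i; exact: nbhs_infty_ge.
    rewrite /ball/= distrC -(subnKC ki) (le_lt_trans (chain_sum_le _ mk tN))//.
    by rewrite ltr_pdivrMr.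
  by split.
by move=> [y z] /= [h1 h2]; exact: ball_splitr h1 h2.
Unshelve. all: by end_near. Qed.

(** Times at most 2^(-k) apart have equal or adjacent floors at level k, so a single grid increment
    is involved. *)
Lemma dyadic_floor_near k t v : (m <= k)%N ->
  - N%:R <= t <= N%:R -> - N%:R <= v <= N%:R -> `|t - v| <= 2 ^- k ->
  `|x (dyadic_floor k t) - x (dyadic_floor k v)| <= rho ^+ k.
Proof.
move=> mk; wlog vt : t v / v <= t.
  move=> h tN vN tv; have [vt|/ltW tv'] := leP v t; first exact: h.
  by rewrite distrC h// distrC.
move=> tN vN; rewrite ger0_norm ?subr_ge0// lerBlDl => tv.
have [j jN jE] := dyadic_floor_grid k tN.
have [i iN iE] := dyadic_floor_grid k vN.
have /andP[t1 t2] := dyadic_floor_itv k t.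
have /andP[v1 v2] := dyadic_floor_itv k v.
have gpl a b : grid_point N k a < grid_point N k b -> (a < b)%N.
  by rewrite /grid_point ltrD2r ltr_pM2r ?invr_gt0// ltr_nat.
have ij : (i < j.+1)%N.
  by apply: gpl; rewrite -iE grid_pointS -jE (le_lt_trans v1)// (le_lt_trans vt).
have ji : (j < i.+2)%N.
  apply: gpl; rewrite -jE !grid_pointS -iE (le_lt_trans t1)// (le_lt_trans tv)//.
  by rewrite ltrD2r.
have : (j == i) || (j == i.+1) by rewrite eqn_leq; lia.
rewrite jE iE => /orP[/eqP->|/eqP ji'].
  by rewrite subrr normr0 exprn_ge0// ltW.
by rewrite ji' ltW// xinc// -ji'.
Qed.

Lemma chain_continuity k t v l l' : (m <= k)%N ->
  - N%:R <= t <= N%:R -> - N%:R <= v <= N%:R -> `|t - v| <= 2 ^- k ->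
  x (dyadic_floor i t) @[i --> \oo] --> l -> x (dyadic_floor i v) @[i --> \oo] --> l' ->
  `|l - l'| <= rho ^+ k * (1 + 2 / (1 - rho)).
Proof.
move=> mk tN vN tv xl xl'.
have h1 := chain_limit mk tN xl; have h2 := chain_limit mk vN xl'.
have h3 := dyadic_floor_near mk tN vN tv.
have -> : l - l' = (l - x (dyadic_floor k t)) +
  (x (dyadic_floor k t) - x (dyadic_floor k v)) - (l' - x (dyadic_floor k v)) by ring.
rewrite (le_trans (ler_normB _ _))//.
have -> : rho ^+ k * (1 + 2 / (1 - rho)) =
  rho ^+ k / (1 - rho) + rho ^+ k + rho ^+ k / (1 - rho) by ring.
by rewrite lerD// (le_trans (ler_normD _ _))// lerD.
Qed.

End Chain.

Definition chainable (rho : R) x : Prop := forall N, exists m,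
  forall k, (m <= k)%N -> small_increments N k (rho ^+ k) x.

(** Built from the values at dyadic times alone, so it is continuous for every chainable [x],
    however irregular elsewhere, and is a limit of countably many coordinates. *)
Definition chain_path x t : R := lim (x (dyadic_floor i t) @[i --> \oo]).

Lemma chain_path_cvg rho x t : 0 < rho -> rho < 1 -> chainable rho x ->
  x (dyadic_floor i t) @[i --> \oo] --> chain_path x t.
Proof.
move=> r0 r1 xc; pose N := (Num.truncn `|t|).+1.
have tN : - N%:R <= t <= N%:R.
  by rewrite -ler_norml; have /andP[_ /ltW] := truncn_itv (normr_ge0 t).
have [m h] := xc N; exact: (chain_cvg r0 r1 h tN).
Qed.

Lemma chain_path_continuous rho x : 0 < rho -> rho < 1 -> chainable rho x ->
  continuous (chain_path x).
Proof.
move=> r0 r1 xc t; pose N := (Num.truncn (`|t| + 1)).+1.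
have t10 : 0 <= `|t| + 1 by rewrite addr_ge0.
have tN : `|t| + 1 <= N%:R by have /andP[_ /ltW] := truncn_itv t10.
have [m h] := xc N.
apply/cvgrPdist_lt => e e0.
have c0 : 0 < 1 + 2 / (1 - rho) by rewrite addr_gt0// divr_gt0// subr_gt0.
have e1 : 0 < e / (1 + 2 / (1 - rho)) by rewrite divr_gt0.
have [k mk rk] := rho_pow_small m r0 r1 e1.
near=> v.
have tv : `|t - v| <= 2 ^- k.
  by near: v; apply: cvgr_dist_le; [exact: cvg_id|rewrite invr_gt0].
apply: (@le_lt_trans _ _ (rho ^+ k * (1 + 2 / (1 - rho)))); last by rewrite -ltr_pdivlMr.
apply: (chain_continuity r0 r1 h mk _ _ tv); last 2 first.
- exact: chain_path_cvg xc.
- exact: chain_path_cvg xc.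
- by rewrite -ler_norml (le_trans _ tN)// lerDl.
rewrite -ler_norml (le_trans _ tN)// -lerBlDl.
by rewrite (le_trans (lerB_dist _ _))// distrC (le_trans tv).
Unshelve. all: by end_near. Qed.

End DyadicChaining.

(** * The Kolmogorov continuity criterion *)

Section KolmogorovContinuity.
Context {d : measure_display} {T : measurableType d} {R : realType}.
Variable P : probability T R.
Implicit Types (X : R -> T -> R) (N k m : nat).

(** The form in which chaining uses moment or tail conditions: over the [N.*2 * 2 ^ k] cells of
    level k the union bound is of order (2 q)^k, which is summable when 2 q < 1. *)
Definition geometric_tail X N (C rho q : R) : Prop := forall k t v,
  - N%:R <= t <= N%:R -> - N%:R <= v <= N%:R -> `|t - v| <= 2 ^- k ->
  (P [set w | (rho ^+ k <= `|X t w - X v w|)%R] <= (C * q ^+ k)%:E)%E.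

Definition chain_bad X N (rho : R) k : set T :=
  \big[setU/set0]_(j <- iota 0 (N.*2 * 2 ^ k))
    [set w | rho ^+ k <= `|X (grid_point N k j.+1) w - X (grid_point N k j) w|].

Lemma chain_badP X N rho k w :
  ~ chain_bad X N rho k w <-> small_increments N k (rho ^+ k) (X ^~ w).
Proof.
rewrite /chain_bad /small_increments.
elim: (N.*2 * 2 ^ k)%N => [|M ih].
  by rewrite big_nil; split => // _ [].
rewrite -addn1 iotaD add0n big_cat/= big_seq1; split => [nb j|h [b|b]].
  rewrite addn1 ltnS leq_eqVlt => /orP[/eqP ->|jM].
    by rewrite ltNge; apply/negP => b; apply: nb; right.
  by have /ih/(_ _ jM) : ~ (\big[setU/set0]_(j <- iota 0 M)
    [set w | rho ^+ k <= `|X (grid_point N k j.+1) w - X (grid_point N k j) w|]) w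
    by move=> b; apply: nb; left.
- by move: b; apply/ih => j jM; apply: h; rewrite addn1 ltnS ltnW.
- by have := h M; rewrite addn1 ltnSn ltNge b => /(_ isT).
Qed.

Section Tail.
Variables (X : R -> T -> R) (N : nat) (C rho q : R).
Hypotheses (mX : forall t, measurable_fun setT (X t)).
Hypotheses (C0 : 0 <= C) (rho0 : 0 < rho) (q0 : 0 <= q) (q1 : 2 * q < 1).
Hypothesis tailX : geometric_tail X N C rho q.

Lemma measurable_chain_bad k : measurable (chain_bad X N rho k).
Proof.
apply: bigsetU_measurable => j _; apply: measurable_norm_ge.
exact: measurable_funB.
Qed.

Lemma chain_bad_le k :
  (P (chain_bad X N rho k) <= (N.*2%:R * C * (2 * q) ^+ k)%:E)%E.
Proof.
have mI j : measurable [set w | rho ^+ k <=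
    `|X (grid_point N k j.+1) w - X (grid_point N k j) w|].
  by apply: measurable_norm_ge; exact: measurable_funB.
rewrite /chain_bad big_seq big_mkcond/=.
apply: (@le_trans _ _ (\sum_(j <- iota 0 (N.*2 * 2 ^ k)) (C * q ^+ k))%:E).
  apply: probability_bigU_le => j; first by case: ifP.
  case: ifP => [|_]; last by rewrite measure0 lee_fin mulr_ge0// exprn_ge0.
  rewrite mem_iota add0n => /andP[_ jM].
  apply: tailX; [exact: grid_point_itv|exact/grid_point_itv/ltnW|].
  by rewrite grid_pointS addrC addKr ger0_norm.
rewrite big_const_seq count_predT size_iota iter_addr_0 lee_fin.
by rewrite -[leLHS]mulr_natl natrM natrX exprMn -!mulrA [_ ^+ k * (C * _)]mulrCA.
Qed.

Definition chain_bad_tail m : set T := \bigcup_i chain_bad X N rho (m + i).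

Lemma chain_bad_tailP m w : ~ chain_bad_tail m w ->
  forall k, (m <= k)%N -> small_increments N k (rho ^+ k) (X ^~ w).
Proof.
move=> h k mk; apply/chain_badP => b; apply: h.
by exists (k - m)%N => //; rewrite subnKC.
Qed.

Lemma measurable_chain_bad_tail m : measurable (chain_bad_tail m).
Proof. by apply: bigcupT_measurable => i; exact: measurable_chain_bad. Qed.

Lemma chain_bad_tail_le m :
  (P (chain_bad_tail m) <= (N.*2%:R * C * (2 * q) ^+ m / (1 - 2 * q))%:E)%E.
Proof.
have m0 : 0 <= N.*2%:R * C * (2 * q) ^+ m by rewrite !mulr_ge0// exprn_ge0// mulr_ge0.
have mF i : measurable (chain_bad X N rho (m + i)) by exact: measurable_chain_bad.
apply: (le_trans (measure_sigma_subadditive P mF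
  (measurable_chain_bad_tail m) (@subset_refl _ _))).
apply: le_trans; last first.
  by apply: (nneseries_geometric_le m0); rewrite q1 mulr_ge0.
apply: lee_nneseries => // i _.
by rewrite (le_trans (chain_bad_le _))// exprD mulrA.
Qed.

Lemma chain_bad_limsup : P (lim_sup_set (chain_bad X N rho)) = 0%E.
Proof.
apply: lim_sup_set_cvg0; first exact: measurable_chain_bad.
apply: (@le_lt_trans _ _ (\sum_(k <oo) (N.*2%:R * C * (2 * q) ^+ k)%:E)%E).
  by apply: lee_nneseries => // k _; exact: chain_bad_le.
apply: (le_lt_trans (nneseries_geometric_le _ _)); last exact: ltry.
  by rewrite mulr_ge0.
by rewrite q1 mulr_ge0.
Qed.

(* Borel-Cantelli, for the approximation of a fixed time t. *)
Lemma dyadic_ae_cvg t : - N%:R <= t <= N%:R -> rho < 1 ->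
  {ae P, forall w, X (dyadic_floor i t) w @[i --> \oo] --> X t w}.
Proof.
move=> tN rho1.
pose B k := [set w | rho ^+ k <= `|X t w - X (dyadic_floor k t) w|].
have mB k : measurable (B k) by apply: measurable_norm_ge; exact: measurable_funB.
exists (lim_sup_set B); split.
- apply: bigcap_measurable => [|k _]; first by exists 0%N.
  by apply: bigcup_measurable => i _; exact: mB.
- apply: lim_sup_set_cvg0 => //.
  apply: (@le_lt_trans _ _ (\sum_(k <oo) (C * q ^+ k)%:E)%E).
    apply: lee_nneseries => // k _; apply: tailX => //.
      by have [j jN ->] := dyadic_floor_grid k tN; exact: grid_point_itv.
    have /andP[h1 h2] := dyadic_floor_itv k t.
    by rewrite ger0_norm ?subr_ge0// lerBlDl ltW.
  apply: (le_lt_trans (nneseries_geometric_le C0 _)); last exact: ltry.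
  by rewrite q0 (le_lt_trans _ q1)// ler_peMl// ler1n.
move=> w /=; apply: contra_notP => nB.
have [m hm] : exists m, forall k, (m <= k)%N -> ~ B k w.
  apply: contra_notP nB => h m _; apply: contrapT => h'.
  by apply: h; exists m => k mk Bk; apply: h'; exists k.
apply/cvgrPdist_lt => e e0.
have [k mk rk] := rho_pow_small m rho0 rho1 e0.
exists k => // i /= ki.
have /negP := hm i (leq_trans mk ki); rewrite -ltNge => /lt_trans; apply.
by rewrite (le_lt_trans _ rk)// ler_wiXn2l// ltW.
Qed.

End Tail.

(** Borel-Cantelli makes almost every path chainable on every [-N, N]. At a fixed t the dyadic
    values converge both to [chain_path] and, almost surely, to X t, so the two agree. *)
Theorem kolmogorov_continuity X (rho q : R) :
  (forall t, measurable_fun setT (X t)) ->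
  0 < rho -> rho < 1 -> 0 <= q -> 2 * q < 1 ->
  (forall N, exists2 C, 0 <= C & geometric_tail X N C rho q) ->
  exists Z : T -> continuousType R R, continuous_version_on P setT X Z.
Proof.
move=> mX rho0 rho1 q0 q1 tailX.
pose good w := chainable rho (X ^~ w).
pose Z w : continuousType R R :=
  match pselect (good w) with
  | left gw => mkcts (chain_path_continuous rho0 rho1 gw)
  | right _ => mkcts (@cst_continuous R R 0)
  end.
(* The event of chainable paths, expressed by countably many measurable events. *)
pose G := \bigcap_N ~` lim_sup_set (chain_bad X N rho).
have GP w : G w <-> good w.
  split => [h N|h N _].
    apply: contrapT => h'; apply: (h N I) => m _; apply: contrapT => h''.
    apply: h'; exists m => k mk; apply/chain_badP => b; apply: h''.
    by exists k.
  have [m hm] := h N => /(_ m I)[k mk]; apply/chain_badP; exact: hm.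
have mL N : measurable (lim_sup_set (chain_bad X N rho)).
  apply: bigcap_measurable => [|k _]; first by exists 0%N.
  by apply: bigcup_measurable => i _; exact: measurable_chain_bad.
have mG : measurable G.
  by apply: bigcap_measurable => [|N _]; [exists 0%N|exact: measurableC].
have ZE w t : G w -> Z w t = chain_path (X ^~ w) t.
  by move=> /GP gw; rewrite /Z; case: pselect.
have Z0 w t : ~ G w -> Z w t = 0.
  by move=> ngw; rewrite /Z; case: pselect => // gw; exfalso; apply: ngw; exact/GP.
have PG : {ae P, forall w, G w}.
  exists (\bigcup_N lim_sup_set (chain_bad X N rho)); split.
  - exact: bigcupT_measurable.
  - apply/eqP; rewrite -measure_le0.
    have mU : measurable (\bigcup_N lim_sup_set (chain_bad X N rho)).
      exact: bigcupT_measurable.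
    apply: (le_trans (measure_sigma_subadditive P mL mU (@subset_refl _ _))).
    rewrite eseries0// => N _ _; have [C C0 tN] := tailX N.
    exact: (chain_bad_limsup mX C0 q0 q1 tN).
  by move=> w /=; rewrite /G -setC_bigcup => /contrapT.
exists Z; split => [t|t _].
  (* The indicator of [G] matches the value 0 given to [Z] on the bad paths, so the limit holds at
     every point. *)
  apply: (@measurable_fun_cvg _ _ _ _
    (fun k => (fun w => \1_G w * X (dyadic_floor k t) w))).
    by move=> k; apply: measurable_funM => //; exact: measurable_indic.
  move=> w _; rewrite indicE; have [gw|ngw] := boolP (w \in G).
    rewrite ZE; last by rewrite inE in gw.
    rewrite (_ : (fun k => _) = (fun k => X (dyadic_floor k t) w)); last first.
      by apply/funext => k; rewrite mul1r.
    by apply: (@chain_path_cvg _ _ _ _ rho0 rho1); apply/GP; rewrite inE in gw.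
  rewrite Z0; last by move=> gw; move/negP: ngw; rewrite inE.
  rewrite (_ : (fun k => _) = fun=> 0); first exact: cvg_cst.
  by apply/funext => k; rewrite mul0r.
pose N := (Num.truncn `|t|).+1.
have tN : - N%:R <= t <= N%:R.
  by rewrite -ler_norml; have /andP[_ /ltW] := truncn_itv (normr_ge0 t).
have [C C0 tailN] := tailX N.
have := dyadic_ae_cvg mX C0 rho0 q0 q1 tailN tN rho1.
apply: filterS2 PG => w gw ct; rewrite ZE//.
have ct' : X (dyadic_floor i t) w @[i --> \oo] --> chain_path (X ^~ w) t.
  by apply: chain_path_cvg; [exact: rho0|exact: rho1|exact/GP].
exact: (@cvg_unique _ _ _ _ _ _ ct' ct).
Qed.

End KolmogorovContinuity.

(** * Versions of a process from its rescaled increments *)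

Section Versions.
Context {R : realType} {d : measure_display} {T : measurableType d}.
Variables (P : probability T R) (Y : R -> T -> R) (h u rho q : R).
Hypothesis mY : forall t, measurable_fun setT (Y t).
Hypotheses (rho0 : 0 < rho) (rho1 : rho < 1) (q0 : 0 <= q) (q1 : 2 * q < 1).

Definition rescaled_process r t w := (Y (u + r * t) w - Y u w) / r `^ h.

Lemma measurable_rescaled_process r t : measurable_fun setT (rescaled_process r t).
Proof. exact: (measurable_funM (measurable_funB (mY _) (mY _)) (measurable_cst _)). Qed.

Lemma le_probability_ae (A B : set T) : measurable A -> measurable B ->
  {ae P, forall w, A w -> B w} -> (P A <= P B)%E.
Proof.
move=> mA mB [N [mN N0 AB]].
apply: (@le_trans _ _ (P (B `|` N))).
  apply: le_measure; rewrite ?inE//; first exact: measurableU.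
  move=> w Aw; have [Bw|nB] := pselect (B w); first by left.
  by right; apply: AB => /= /(_ Aw).
have PN : (P N = 0)%E by exact: N0.
apply: (@le_trans _ _ (P B + P N)%E); last by rewrite PN adde0.
exact: (@measureU2 _ _ _ P _ _ mB mN).
Qed.

(** The continuity criterion concerns processes on the whole line, whereas tail bounds may hold only
    on an interval of rescaled times. Composing with [g] extends the process, and it is unchanged
    where [g] is the identity. *)
Lemma continuous_version_affine (g : R -> R) (V : set R) r : 0 < r ->
  (forall N, exists2 C, 0 <= C & geometric_tail P (rescaled_process r \o g) N C rho q) ->
  (forall t, V t -> g ((t - u) / r) = (t - u) / r) ->
  exists Z, continuous_version_on P V Y Z.
Proof.
move=> r0 tailg gV.
have [Z [mZ Zg]] := kolmogorov_continuity
  (fun t => measurable_rescaled_process r (g t)) rho0 rho1 q0 q1 tailg.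
have cZ w : continuous (fun t => r `^ h * Z w ((t - u) / r) + Y u w).
  move=> t; apply: cvgD; last exact: cvg_cst.
  apply: cvgMl_tmp.
  apply: (@continuous_comp _ _ _ (fun t => (t - u) / r) (Z w)); last exact: cts_fun.
  by apply: cvgMr_tmp; apply: cvgB; [exact: cvg_id|exact: cvg_cst].
exists (fun w => mkcts (@cZ w)); split => t.
  apply: measurable_funD (mY u).
  exact: (measurable_funM (measurable_cst _) (mZ _)).
move=> Vt; apply: filterS (Zg ((t - u) / r) I) => w Zw.
rewrite -[LHS]/(r `^ h * Z w ((t - u) / r) + Y u w) Zw /rescaled_process/= gV//.
rewrite [r * _]mulrC divfK ?gt_eqF// [u + _]addrC subrK.
by rewrite mulrC divfK ?gt_eqF ?powR_gt0// subrK.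
Qed.

Lemma continuous_version_global r : 0 < r ->
  (forall N, exists2 C, 0 <= C & geometric_tail P (rescaled_process r) N C rho q) ->
  exists Z, continuous_version_on P setT Y Z.
Proof. by move=> r0 tl; exact: (@continuous_version_affine id setT r r0 tl). Qed.

Lemma continuous_version_local r C : 0 < r -> 0 <= C ->
  geometric_tail P (rescaled_process r) 1 C rho q ->
  exists2 V, nbhs u V & exists Z, continuous_version_on P V Y Z.
Proof.
move=> r0 C0 tl; exists [set t | `|t - u| <= r].
  by apply: filterS (nbhsx_ballx u r r0) => t /= /ltW; rewrite distrC.
(* Clamping to [-1, 1] is 1-Lipschitz, so the tail bound on [-1, 1] holds for the composition on
   every interval. *)
pose g (t : R) := if t < -1 then -1 else if 1 < t then 1 else t.
have g1 t : - 1%:R <= g t <= 1%:R.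
  by rewrite /g; case: ltP => t1; [lra|case: ltP => t2; lra].
have gl t v : `|g t - g v| <= `|t - v|.
  have h1 := ler_norm (t - v); have h2 := ler_norm (v - t); rewrite distrC in h2.
  rewrite /g ler_norml; case: (ltP t) => t1; case: (ltP v) => v1;
  case: (ltP 1 t) => t2; case: (ltP 1 v) => v2; lra.
apply: (@continuous_version_affine g _ r r0).
  move=> N; exists C => // k t v _ _ tv; apply: tl => //.
  exact: le_trans (gl t v) tv.
move=> t /= tr.
have : `|(t - u) / r| <= 1 by rewrite normf_div (gtr0_norm r0) ler_pdivrMr// mul1r.
by rewrite ler_norml /g => /andP[h1 h2]; rewrite ltNge h1 ltNge h2.
Qed.

End Versions.

(** * Convergence in distribution in C(R) *)

Section PathDistance.
Context {R : realType}.
Implicit Types (x y z : R -> R) (N : nat) (t : R).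

(** Truncation at 1 makes the supremum finite for arbitrary functions; the distance is also applied
    to step functions, which are not paths. *)
Definition pdist N x y : R :=
  sup [set Num.min 1 `|x t - y t| | t in [set t | - N%:R <= t <= N%:R]].

Let pset N x y := [set Num.min 1 `|x t - y t| | t in [set t | - N%:R <= t <= N%:R]].

Let pset_sup N x y : has_sup (pset N x y).
Proof.
split; first by exists (Num.min 1 `|x 0 - y 0|), 0 => //=; rewrite lerNl oppr0 !ler0n.
by exists 1 => _ [t _ <-]; rewrite ge_min lexx.
Qed.

Lemma pdist_ub N x y t : - N%:R <= t <= N%:R -> Num.min 1 `|x t - y t| <= pdist N x y.
Proof.
by move=> tN; apply: (ub_le_sup (proj2 (pset_sup N x y))); exists t.
Qed.

Lemma pdist_le N x y e : (forall t, - N%:R <= t <= N%:R -> Num.min 1 `|x t - y t| <= e) ->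
  pdist N x y <= e.
Proof.
move=> h; apply: ge_sup; first exact: (proj1 (pset_sup N x y)).
by move=> _ [t tN <-]; exact: h.
Qed.

Lemma pdist_le_dist N x y e : (forall t, - N%:R <= t <= N%:R -> `|x t - y t| <= e) ->
  pdist N x y <= e.
Proof. by move=> h; apply: pdist_le => t tN; rewrite ge_min h ?orbT. Qed.

Lemma pdist_le1 N x y : pdist N x y <= 1.
Proof. by apply: pdist_le => t _; rewrite ge_min lexx. Qed.

Lemma zero_in_itv N : - N%:R <= (0 : R) <= N%:R.
Proof. by rewrite lerNl oppr0 !ler0n. Qed.

Lemma pdist_ge0 N x y : 0 <= pdist N x y.
Proof.
by apply: le_trans (pdist_ub x y (zero_in_itv N)); rewrite le_min ler01 normr_ge0.
Qed.

Lemma pdist_refl N x : pdist N x x = 0.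
Proof.
apply/eqP; rewrite eq_le pdist_ge0 andbT.
by apply: pdist_le_dist => t _; rewrite subrr normr0.
Qed.

Lemma pdist_sym N x y : pdist N x y = pdist N y x.
Proof. by rewrite /pdist; under eq_imagel do rewrite distrC. Qed.

Lemma pdist_triangle N x y z : pdist N x z <= pdist N x y + pdist N y z.
Proof.
apply: pdist_le => t tN.
apply: le_trans (lerD (pdist_ub x y tN) (pdist_ub y z tN)).
have h : `|x t - z t| <= `|x t - y t| + `|y t - z t|.
  by rewrite -(subrKA (y t)) ler_normD.
have h1 : 0 <= `|x t - y t| by []; have h2 : 0 <= `|y t - z t| by [].
by rewrite /Num.min; do !case: ifPn; rewrite ?ltNge ?negbK; move: h h1 h2; lra.
Qed.

Lemma pdist_mono N N' x y : (N <= N')%N -> pdist N x y <= pdist N' x y.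
Proof.
move=> NN'; apply: pdist_le => t /andP[tN1 tN2]; apply: pdist_ub.
rewrite (le_trans _ tN1)/=; last by rewrite lerN2 ler_nat.
by rewrite (le_trans tN2)// ler_nat.
Qed.

Lemma pdist_lt N x y t e : e <= 1 -> pdist N x y < e -> - N%:R <= t <= N%:R ->
  `|x t - y t| < e.
Proof.
move=> e1 xy tN; have := le_lt_trans (pdist_ub x y tN) xy.
by rewrite gt_min ltNge e1.
Qed.

Lemma pdist_dyadic_cvg N x : continuous x ->
  pdist N x (x \o dyadic_floor m) @[m --> \oo] --> 0.
Proof.
move=> cx; apply/cvgrPdist_le => e e0.
have half0 : (0 : R) < 2^-1 by rewrite invr_gt0.
have half1 : (2^-1 : R) < 1 by rewrite invf_lt1// ltr1n.
have h t : [set` `[- N%:R, N%:R]] t ->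
    \forall t' \near t & m \near \oo, `|x t' - x (dyadic_floor m t')| <= e.
  move=> _; have e20 : 0 < e / 2 by rewrite divr_gt0.
  have /cvgrPdist_le/(_ _ e20)/nbhs_ballP[del /= del0 hdel] := cx t.
  have d20 : 0 < del / 2 by rewrite divr_gt0.
  have [k _ hk] := rho_pow_small 0 half0 half1 d20.
  near=> t' m.
  have tt' : `|t - t'| < del / 2 by near: t'; apply: cvgr_dist_lt => //; exact: cvg_id.
  have km : (k <= m)%N by near: m; exact: nbhs_infty_ge.
  have tm : `|t' - dyadic_floor m t'| < del / 2.
    have /andP[h1 h2] := dyadic_floor_itv m t'.
    rewrite ger0_norm ?subr_ge0// ltrBlDl (lt_le_trans h2)// lerD2l.
    rewrite ltW// (le_lt_trans _ hk)// -exprVn ler_wiXn2l// ?invr_ge0//.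
    by rewrite invf_le1// ler1n.
  rewrite -(subrKA (x t)) (splitr e) (le_trans (ler_normD _ _))// lerD//.
    rewrite distrC; apply: hdel; rewrite /ball/= (lt_trans tt')//.
    by rewrite ltr_pdivrMr// mulr2n mulrDr mulr1 ltrDl.
  apply: hdel; rewrite /ball/= -(subrKA t') (le_lt_trans (ler_normD _ _))//.
  by rewrite (splitr del) ltrD.
(* The near-covering form of compactness turns the estimate near each t into one for all t of the
   segment and all large m. *)
have := proj1 (compact_near_coveringP _) (@segment_compact R (- N%:R) N%:R) nat \oo
  (fun m t => `|x t - x (dyadic_floor m t)| <= e) (@filter_filter _ _ eventually_filter) h.
apply: filterS => m hm.
rewrite sub0r normrN ger0_norm ?pdist_ge0//.
apply: pdist_le_dist => t tN; apply: hm.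
by rewrite /= in_itv.
Unshelve. all: by end_near. Qed.

Lemma pdist_dist N x y z : `|pdist N x z - pdist N y z| <= pdist N x y.
Proof.
have h1 := pdist_triangle N x y z; have h2 := pdist_triangle N y x z.
rewrite (pdist_sym N y x) in h2; rewrite ler_norml; apply/andP; split; lra.
Qed.

Definition path_fun (x : continuousType R R) : R -> R := x.

Lemma path_space_continuous (phi : path_space R -> R) : continuous phi ->
  D_continuous (fun N (x y : path_space R) => pdist N (path_fun x) (path_fun y)) phi.
Proof.
move=> cphi x e e0.
(* One index governs both interval and radius, so the sets decrease and generate a filter. It is
   shown to converge to [x] in [path_space], and continuity of [phi] is applied along it. *)
pose U k : set (path_space R) :=
  [set y | pdist k (path_fun x) (path_fun y) < k.+1%:R^-1].
have UU i j : (i <= j)%N -> U j `<=` U i.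
  move=> ij y; rewrite /U/= => h; apply: (le_lt_trans (pdist_mono _ _ ij)).
  by rewrite (lt_le_trans h)// lef_pV2 ?posrE// ler_nat.
pose Fx := filter_from [set: nat] U.
have FF : Filter Fx.
  apply: filter_from_filter; first by exists 0%N.
  move=> i j _ _; exists (maxn i j) => // y Uy.
  by split; apply: UU Uy; rewrite ?leq_maxl ?leq_maxr.
have Fxx : Fx --> x.
  pose i (y : path_space R) : R -> R := path_fun y.
  have h : {family @bounded_interval R, i @ Fx --> i x}.
    apply/fam_cvgP => A [_ [M [_ AM]]] B /uniform_nbhs[E [entE EB]].
    move: entE; rewrite -entourage_ballE => -[del /= del0 delE].
    have M0 : 0 <= `|M| + 1 by rewrite addr_ge0.
    have d0 : 0 <= del^-1 by rewrite invr_ge0 ltW.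
    (* The first entry makes [-k, k] contain A, with |M| + 1 because [bounded_set] speaks of numbers
       strictly above M; the second makes the radius at most [del]. *)
    exists (maxn (Num.truncn (`|M| + 1)).+1 (Num.truncn del^-1).+1) => //.
    set k := maxn _ _ => y Uy; apply: EB => t At; apply: delE => /=.
    have kM : `|M| + 1 <= k%:R.
      have /andP[_ /ltW h] := truncn_itv M0; rewrite (le_trans h)// ler_nat.
      exact: leq_maxl.
    have kd : k.+1%:R^-1 <= del.
      rewrite -[leRHS]invrK lef_pV2 ?posrE ?invr_gt0//.
      have /andP[_ /ltW h] := truncn_itv d0; rewrite (le_trans h)// ler_nat.
      by rewrite (leq_trans (leq_maxr _ _) (leqnSn _)).
    rewrite /ball/=; apply: lt_le_trans kd; apply: pdist_lt Uy _.
      by rewrite invf_le1// ler1n.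
    rewrite -ler_norml (le_trans _ kM)//.
    by apply: AM => //; rewrite (le_lt_trans (ler_norm _))// ltrDl.
  move=> A; rewrite nbhsE => -[B [[C oC <-] Cx] BA].
  apply: (filterS BA); apply: (h C); apply: open_nbhs_nbhs.
  by split.
have /cvgrPdist_lt/(_ _ e0)/Fxx[k _ hk] := cphi x.
exists k, k.+1%:R^-1; first by rewrite invr_gt0.
move=> N kN y xy; apply: hk; rewrite /U/=.
exact: le_lt_trans (pdist_mono _ _ kN) xy.
Qed.

End PathDistance.

(** * Path functionals reduced to finitely many coordinates *)

Section PathSkeleton.
Context {R : realType}.
Variables (psi : path_space R -> R) (M L : R) (N : nat).
Hypotheses (psiM : forall x, `|psi x| <= M) (L0 : 0 <= L).
Hypothesis psiL : forall x y : path_space R,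
  `|psi x - psi y| <= L * pdist N (path_fun x) (path_fun y).

(* The McShane extension of psi to arbitrary functions, in particular to the
   step functions obtained by sampling a path on a grid. *)
Definition path_ext (x : R -> R) : R :=
  infconv psi (fun x (y : path_space R) => L * pdist N x (path_fun y)) x.

Let c0 (x : R -> R) (y : path_space R) : 0 <= L * pdist N x (path_fun y).
Proof. by rewrite mulr_ge0// pdist_ge0. Qed.

Let y0 : path_space R := mkcts (@cst_continuous R R 0).

Lemma path_ext_lip x x' : `|path_ext x - path_ext x'| <= L * pdist N x x'.
Proof.
apply: (infconv_dist y0 psiM c0) => y.
by rewrite -mulrBr normrM ger0_norm// ler_wpM2l// pdist_dist.
Qed.

Lemma path_ext_continuous (x : continuousType R R) : path_ext x = psi x.
Proof.
apply/eqP; rewrite eq_le; apply/andP; split.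
  have := infconv_le psiM c0 x (x : path_space R).
  by rewrite pdist_refl mulr0 addr0.
apply: (infconv_ge y0) => y.
by have := psiL x y; rewrite ler_norml => /andP[_]; lra.
Qed.

Lemma path_ext_bound x : `|path_ext x| <= M + L.
Proof.
rewrite ler_norml (le_trans _ (infconv_geN y0 psiM c0 x))/=; last by rewrite lerN2 lerDl.
rewrite (le_trans (infconv_le psiM c0 x y0))// lerD//.
  exact: le_trans (ler_norm _) (psiM _).
by rewrite ler_piMr// pdist_le1.
Qed.

Definition grid_size (m : nat) : nat := (N.*2 * 2 ^ m)%N.

(** The index of the point [dyadic_floor m t]. For t outside [-N, N] the value is arbitrary, and
    [pdist N] does not see it. *)
Definition grid_index (m : nat) (t : R) : 'I_(grid_size m).+1 :=
  inord (Num.truncn ((dyadic_floor m t + N%:R) * 2 ^+ m)).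

Definition samples (m : nat) (x : R -> R) : 'rV[R]_(grid_size m).+1 :=
  \row_j x (grid_point N m j).

(** The functional evaluated at the step function through the samples: a Lipschitz function of
    finitely many coordinates, to which finite-dimensional convergence applies. *)
Definition skeleton (m : nat) (v : 'rV[R]_(grid_size m).+1) : R :=
  path_ext (fun t => v 0 (grid_index m t)).

Lemma skeleton_samples m x : skeleton (samples m x) = path_ext (x \o dyadic_floor m).
Proof.
apply/eqP; rewrite -subr_eq0 -normr_le0 (le_trans (path_ext_lip _ _))//.
rewrite -(mulr0 L) ler_wpM2l//; apply: pdist_le_dist => t tN.
have [j jN jE] := dyadic_floor_grid m tN.
rewrite mxE /grid_index /= jE {2}/grid_point subrK divfK ?gt_eqF ?exprn_gt0//.
by rewrite natrK inordK ?ltnS// subrr normr0.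
Qed.

Lemma skeleton_lip m (v v' : 'rV[R]_(grid_size m).+1) :
  `|skeleton v - skeleton v'| <= L * l1dist v v'.
Proof.
rewrite (le_trans (path_ext_lip _ _))// ler_wpM2l//.
apply: pdist_le_dist => t _; rewrite /l1dist (bigD1 (grid_index m t))//= lerDl.
by rewrite sumr_ge0.
Qed.

Lemma skeleton_dist m (x : continuousType R R) :
  `|psi x - skeleton (samples m x)| <= L * pdist N x (x \o dyadic_floor m).
Proof. by rewrite skeleton_samples -path_ext_continuous path_ext_lip. Qed.

Section Random.
Context {d : measure_display} {T : measurableType d}.
Variables (P : probability T R) (Z : T -> continuousType R R).
Hypothesis mZ : forall t, measurable_fun setT (fun w => Z w t).

Lemma bounded_rv_skeleton m : bounded_rv (fun w => skeleton (samples m (Z w))).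
Proof.
apply: (@bounded_rv_lipschitz _ _ _ _ (fun w => samples m (Z w)) _ _ (M + L) L) => //.
- by move=> j; under eq_fun do rewrite mxE; exact: mZ.
- by move=> v; exact: path_ext_bound.
- exact: skeleton_lip.
Qed.

Lemma bounded_rv_path : bounded_rv (psi \o (Z : T -> path_space R)).
Proof.
have [] // := @mean_cvg_dominated _ _ _ P
  (fun m w => skeleton (samples m (Z w))) (psi \o (Z : T -> path_space R)) (M + L).
- by move=> m; have [] := bounded_rv_skeleton m.
- by move=> m w; exact: path_ext_bound.
move=> w; apply/cvgrPdist_le => e e0.
have L10 : 0 < L + 1 by rewrite ltr_wpDl.
have e1 : 0 < e / (L + 1) by rewrite divr_gt0.
have /cvgrPdist_le/(_ _ e1) := pdist_dyadic_cvg N (@cts_fun _ _ (Z w)).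
apply: filterS => m; rewrite sub0r normrN ger0_norm ?pdist_ge0// => h.
rewrite (le_trans (skeleton_dist _ _))// (le_trans (ler_wpM2l L0 h))//.
by rewrite mulrA ler_pdivrMr// mulrC ler_wpM2l ?(ltW e0)// lerDl.
Qed.

(** Off the chaining event the path is within rho^m / (1 - rho) of its skeleton; on it the
    difference is at most 2 M + L. The law of [Z] enters only through [C], so the bound is uniform
    over processes sharing it, which does the work of tightness in C(R). *)
Lemma mean_skeleton_dist (C rho q : R) m : 0 <= C -> 0 < rho -> rho < 1 ->
  0 <= q -> 2 * q < 1 ->
  geometric_tail P (fun t w => Z w t) N C rho q ->
  `|mean P (psi \o (Z : T -> path_space R)) - mean P (fun w => skeleton (samples m (Z w)))|
    <= L * (rho ^+ m / (1 - rho)) +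
       (2 * M + L) * (N.*2%:R * C * (2 * q) ^+ m / (1 - 2 * q)).
Proof.
move=> C0 rho0 rho1 q0 q1 tailZ.
have M0 : 0 <= M by rewrite (le_trans _ (psiM y0)).
pose A := chain_bad_tail (fun t w => Z w t) N rho m.
have mA : measurable A by exact: measurable_chain_bad_tail.
have PA : fine (P A) <= N.*2%:R * C * (2 * q) ^+ m / (1 - 2 * q).
  rewrite -lee_fin fineK ?fin_num_measure//.
  exact: chain_bad_tail_le mZ C0 q0 q1 tailZ m.
have r1 : 0 < 1 - rho by rewrite subr_gt0.
rewrite (le_trans (@mean_dist _ _ _ P _ _ A (L * (rho ^+ m / (1 - rho))) (2 * M + L) _ _ mA _ _ _))//.
- exact: bounded_rv_path.
- exact: bounded_rv_skeleton.
- by rewrite mulr_ge0// divr_ge0 ?exprn_ge0// ltW.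
- move=> w /chain_bad_tailP inc; rewrite (le_trans (skeleton_dist _ _))// ler_wpM2l//.
  apply: pdist_le_dist => t tN.
  apply: (chain_limit rho0 rho1 inc (leqnn m) tN).
  exact: (cvg_comp _ _ (@dyadic_floor_cvg R t) (@cts_fun _ _ (Z w) t)).
- move=> w; rewrite (le_trans (ler_normB _ _))//.
  have := psiM (Z w); have := path_ext_bound (fun t => samples m (Z w) 0 (grid_index m t)).
  by rewrite /= -/(skeleton _); lra.
by rewrite lerD2l ler_wpM2l// addr_ge0// mulr_ge0.
Qed.

End Random.
End PathSkeleton.

Section PathConvergence.
Context {R : realType}.
Context {d d' : measure_display} {T : measurableType d} {T' : measurableType d'}.
Variables (P : probability T R) (P' : probability T' R).
Variables (Z : R -> T -> continuousType R R) (Z' : T' -> continuousType R R).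
Variables (rho q : R).

Theorem path_cvg_in_distribution :
  0 < rho -> rho < 1 -> 0 <= q -> 2 * q < 1 ->
  (forall r t, measurable_fun setT (fun w => Z r w t)) ->
  (forall t, measurable_fun setT (fun w => Z' w t)) ->
  (forall n (t : 'I_n -> R) phi M L, (forall x, `|phi x| <= M) -> 0 <= L ->
    (forall x y, `|phi x - phi y| <= L * l1dist x y) ->
    mean P (fun w => phi (\row_j Z r w (t j))) @[r --> 0^'+] -->
    mean P' (fun w => phi (\row_j Z' w (t j)))) ->
  (forall N, exists2 C, 0 <= C &
    (\forall r \near 0^'+, geometric_tail P (fun t w => Z r w t) N C rho q) /\
    geometric_tail P' (fun t w => Z' w t) N C rho q) ->
  @cvg_in_distribution R (path_space R) _ _ T T' P P' (fun r w => Z r w) Z'.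
Proof.
move=> rho0 rho1 q0 q1 mZ mZ' fdd tail phi cphi [M phiM].
apply: (@portmanteau R (path_space R) _ (0 : R)^'+ _ _ _ _ _ P P' (fun r w => Z r w) Z'
  (fun N (x y : path_space R) => pdist N (path_fun x) (path_fun y))
  phi M) => //.
- by move=> N x y; exact: pdist_ge0.
- by move=> N x; exact: pdist_refl.
- by move=> N x y; exact: pdist_sym.
- by move=> N x y z; exact: pdist_triangle.
- move=> M' psi [psiM [N [L [L0 psiL]]]]; split => [r|].
    exact: (bounded_rv_path psiM L0 psiL P (mZ r)).
  exact: (bounded_rv_path psiM L0 psiL P' mZ').
- move=> M' psi [psiM [N [L [L0 psiL]]]]; apply/cvgrPdist_le => e e0.
  have [C C0 [tZ tZ']] := tail N.
  pose E m := L * (rho ^+ m / (1 - rho)) +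
       (2 * M' + L) * (N.*2%:R * C * (2 * q) ^+ m / (1 - 2 * q)).
  have E0 : E m @[m --> \oo] --> 0.
    have ex (z : R) : 0 <= z -> z < 1 -> z ^+ m @[m --> \oo] --> 0.
      move=> z0 z1; have := @cvg_geometric R 1 z; rewrite ger0_norm// => /(_ z1).
      rewrite (_ : geometric 1 z = (fun m => z ^+ m))//.
      by apply/funext => m; rewrite /geometric/= mul1r.
    have -> : (0 : R) = L * (0 / (1 - rho)) +
        (2 * M' + L) * (N.*2%:R * C * 0 / (1 - 2 * q)) by rewrite !(mul0r, mulr0) addr0.
    apply: cvgD.
      by apply: cvgMl_tmp; apply: cvgMr_tmp; apply: ex => //; exact: ltW.
    apply: cvgMl_tmp; apply: cvgMr_tmp; apply: cvgMl_tmp; apply: ex => //.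
    by rewrite mulr_ge0.
  have e30 : 0 < e / 3 by rewrite divr_gt0.
  (* The level m is fixed before r, which is possible because the error does not depend on r. *)
  have /cvgrPdist_le/(_ _ e30)[m _ /(_ m (leqnn m))] := E0.
  rewrite sub0r normrN => /(le_trans (ler_norm _)) Em.
  have sk := fdd _ (fun j => grid_point N m j) (@skeleton R psi L N m) (M' + L) L
    (fun v => @path_ext_bound R psi M' L N psiM L0 _) L0
    (@skeleton_lip R psi M' L N psiM L0 m).
  have /cvgrPdist_le/(_ _ e30) := sk.
  apply: filterS2 tZ => r tZ hr.
  have h1 := mean_skeleton_dist psiM L0 psiL (mZ r) m C0 rho0 rho1 q0 q1 tZ.
  have h2 := mean_skeleton_dist psiM L0 psiL mZ' m C0 rho0 rho1 q0 q1 tZ'.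
  rewrite -/(E m) in h1 h2.
  move: (le_trans h1 Em) (le_trans h2 Em) hr; rewrite /samples /comp.
  set x1 := mean P _; set x2 := mean P _; set x3 := mean P' _; set x4 := mean P' _.
  rewrite !ler_norml => /andP[? ?] /andP[? ?] /andP[? ?].
  by apply/andP; split; lra.
exact: path_space_continuous.
Qed.

End PathConvergence.

Lemma geometric_tail_ae {R : realType} {d : measure_display} {T : measurableType d}
    (P : probability T R) (X X' : R -> T -> R) N (C rho q : R) :
  (forall t, measurable_fun setT (X t)) -> (forall t, measurable_fun setT (X' t)) ->
  (forall t, - N%:R <= t <= N%:R -> {ae P, forall w, X' t w = X t w}) ->
  geometric_tail P X N C rho q -> geometric_tail P X' N C rho q.
Proof.
move=> mX mX' XX' tl k t v tN vN tv; apply: le_trans (tl k t v tN vN tv).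
apply: le_probability_ae.
- by apply: measurable_norm_ge; exact: measurable_funB.
- by apply: measurable_norm_ge; exact: measurable_funB.
by apply: filterS2 (XX' t tN) (XX' v vN) => w /= -> ->.
Qed.

(** * Strong localisability from tails and finite-dimensional limits *)

Section StrongLocalisability.
Context {R : realType}.
Context {d d' : measure_display} {T : measurableType d} {T' : measurableType d'}.
Variables (P : probability T R) (P' : probability T' R).
Variables (Y : R -> T -> R) (Y' : R -> T' -> R) (h u rho q : R).
Hypotheses (mY : forall t, measurable_fun setT (Y t)) (mY' : forall t, measurable_fun setT (Y' t)).
Hypotheses (rho0 : 0 < rho) (rho1 : rho < 1) (q0 : 0 <= q) (q1 : 2 * q < 1).
Hypothesis lipschitz_cvg : forall n (t : 'I_n -> R) phi M L,
  (forall x, `|phi x| <= M) -> 0 <= L ->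
  (forall x y, `|phi x - phi y| <= L * l1dist x y) ->
  mean P (fun w => phi (\row_j rescaled_process Y h u r (t j) w)) @[r --> 0^'+] -->
  mean P' (fun w => phi (\row_j Y' (t j) w)).

Lemma localisable_lipschitz : localisable P P' h u Y Y'.
Proof.
move=> n t.
apply: (@cvg_in_distribution_rV R n _ _ T T' P P'
  (fun r w => \row_j rescaled_process Y h u r (t j) w) (fun w => \row_j Y' (t j) w)).
- by move=> r j; under eq_fun do rewrite mxE; exact: measurable_rescaled_process.
- by move=> j; under eq_fun do rewrite mxE; exact: mY'.
- by move=> phi M L; exact: lipschitz_cvg.
Qed.

Hypothesis tails : forall N, exists2 C, 0 <= C &
  (\forall r \near 0^'+, geometric_tail P (rescaled_process Y h u r) N C rho q) /\
  geometric_tail P' Y' N C rho q.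

Lemma strongly_localisable_version V Z : nbhs u V ->
  continuous_version_on P V Y Z -> strongly_localisable V P P' h u Y Y'.
Proof.
move=> nV [mZ ZY].
have tails' N : exists2 C, 0 <= C & geometric_tail P' Y' N C rho q.
  by have [C C0 [_ tl]] := tails N; exists C.
have [Z' [mZ' ZY']] := kolmogorov_continuity mY' rho0 rho1 q0 q1 tails'.
exists Z, Z'; split => //.
have mZr r t : measurable_fun setT (fun w => (rescaled_path h u r (Z w) : continuousType R R) t).
  exact: (measurable_rescaled_process h u mZ).
have near_V t : \forall r \near (0 : R)^'+, V (u + r * t).
  have ct : u + r * t @[r --> (0 : R)^'+] --> u.
    apply: cvg_at_right_filter.
    rewrite -[X in _ --> X](_ : u + 0 * t = u); last by rewrite mul0r addr0.
    by apply: cvgD; [exact: cvg_cst|apply: cvgMr_tmp; exact: cvg_id].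
  exact: ct.
have Vu : V u by exact: nbhs_singleton.
have aeV r t : V (u + r * t) ->
    {ae P, forall w,
      (rescaled_path h u r (Z w) : continuousType R R) t = rescaled_process Y h u r t w}.
  move=> Vt; apply: filterS2 (ZY _ Vt) (ZY _ Vu) => w e1 e2.
  by rewrite -[LHS]/((Z w (u + r * t) - Z w u) / r `^ h) e1 e2.
apply: (@path_cvg_in_distribution R _ _ T T' P P'
  (fun r w => rescaled_path h u r (Z w)) Z' rho q rho0 rho1 q0 q1 mZr mZ').
- move=> n t phi M L phiM L0 phiL.
  have -> : mean P' (fun w => phi (\row_j Z' w (t j))) = mean P' (fun w => phi (\row_j Y' (t j) w)).
    apply: mean_ae_eq.
    + apply: (@bounded_rv_lipschitz _ _ _ _ (fun w => \row_j Z' w (t j)) _ _ M L) => //.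
      by move=> j; under eq_fun do rewrite mxE; exact: mZ'.
    + apply: (@bounded_rv_lipschitz _ _ _ _ (fun w => \row_j Y' (t j) w) _ _ M L) => //.
      by move=> j; under eq_fun do rewrite mxE; exact: mY'.
    have ae_all : {ae P', forall w, forall j, Z' w (t j) = Y' (t j) w}.
      by apply: filter_forall => j; exact: (ZY' (t j) I).
    apply: filterS ae_all => w e; congr phi; apply/rowP => j.
    by rewrite !mxE e.
  have lc := @lipschitz_cvg n t phi M L phiM L0 phiL.
  refine (cvg_trans _ lc).
  apply: near_eq_cvg.
  (* For small r the finitely many times u + r t_j all lie in V, where the version agrees with Y
     almost surely. *)
  have nj := @filter_forall _ _ _ _ (at_right_proper_filter (0 : R)) (fun j => near_V (t j)).
  apply: filterS nj => r Vr; apply: mean_ae_eq.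
  + apply: (@bounded_rv_lipschitz _ _ _ _
      (fun w => \row_j rescaled_process Y h u r (t j) w) _ _ M L) => //.
    by move=> j; under eq_fun do rewrite mxE; exact: measurable_rescaled_process.
  + apply: (@bounded_rv_lipschitz _ _ _ _
      (fun w => \row_j (rescaled_path h u r (Z w) : continuousType R R) (t j)) _ _ M L) => //.
    by move=> j; under eq_fun do rewrite mxE; exact: mZr.
  have ae_all : {ae P, forall w, forall j,
      (rescaled_path h u r (Z w) : continuousType R R) (t j) = rescaled_process Y h u r (t j) w}.
    by apply: filter_forall => j; exact: aeV.
  apply: filterS ae_all => w e; congr phi; apply/rowP => j.
  by rewrite !mxE e.
move=> N; have [C C0 [tl tl']] := tails N; exists C => //; split; last first.
  apply: geometric_tail_ae tl' => //.
  by move=> t _; exact: (ZY' t I).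
have [e /= e0 eV] := (nbhs_ballP _ _).1 nV.
(* Brings u + r t into V for all t in [-N, N] at once, which the transfer of tail bounds
   requires. *)
have rN : \forall r \near (0 : R)^'+, r * N%:R < e.
  have ct : r * N%:R @[r --> (0 : R)^'+] --> 0.
    apply: cvg_at_right_filter; rewrite -[X in _ --> X](mul0r N%:R).
    by apply: cvgMr_tmp; exact: cvg_id.
  exact: (@cvgr_lt _ _ _ (at_right_proper_filter (0 : R)) _ _ ct _ e0).
have rpos : \forall r \near (0 : R)^'+, 0 < r by exact: nbhs_right_gt.
apply: filterS3 rpos rN tl => r r0 hr.
apply: geometric_tail_ae => //.
- exact: measurable_rescaled_process.
- exact: mZr.
move=> t tN; apply: (@aeV r t); apply: eV.
rewrite /ball/= opprD addrA subrr add0r normrN normrM (gtr0_norm r0).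
by apply: le_lt_trans hr; rewrite ler_pM2l// ler_norml.
Qed.

End StrongLocalisability.

(** * Multistable integrals *)

Section MultistableIntegral.
Context {R : realType} {d : measure_display} {T : measurableType d}.
Variables (P : probability T R) (alpha : R -> R) (I : (R -> R) -> T -> R).
Hypothesis HI : multistable_integral P alpha I.
Local Open Scope ereal_scope.

(** [I] is given by its joint characteristic functions rather than as a pathwise linear map, so a
    combination of differences is read as one of n + n integrals with opposite coefficients. *)
Lemma multistable_cf n (g g' : 'I_n -> R -> R) (th : 'I_n -> R) :
  (forall j, Falpha alpha (g j)) -> (forall j, Falpha alpha (g' j)) ->
  'E_P[fun w => cos (\sum_j th j * (I (g j) w - I (g' j) w))%R] =
    expeR (- modular leb alpha (fun x => \sum_j th j * (g j x - g' j x))%R) /\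
  'E_P[fun w => sin (\sum_j th j * (I (g j) w - I (g' j) w))%R] = 0.
Proof.
move=> Fg Fg'.
pose k (i : 'I_(n + n)) := match fintype.split i with inl j => g j | inr j => g' j end.
pose s (i : 'I_(n + n)) := match fintype.split i with inl j => th j | inr j => (- th j)%R end.
have kl j : k (lshift n j) = g j by rewrite /k (unsplitK (inl j)).
have kr j : k (rshift n j) = g' j by rewrite /k (unsplitK (inr j)).
have sl j : s (lshift n j) = th j by rewrite /s (unsplitK (inl j)).
have sr j : s (rshift n j) = (- th j)%R by rewrite /s (unsplitK (inr j)).
have Fk i : Falpha alpha (k i) by rewrite /k; case: fintype.split.
have [c0 s0] := proj2 HI (n + n)%N k s Fk.
have E1 w : (\sum_i s i * I (k i) w = \sum_j th j * (I (g j) w - I (g' j) w))%R.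
  rewrite big_split_ord/= -big_split/=; apply: eq_bigr => j _.
  by rewrite sl sr kl kr mulNr mulrBr.
have E2 x : (\sum_i s i * k i x = \sum_j th j * (g j x - g' j x))%R.
  rewrite big_split_ord/= -big_split/=; apply: eq_bigr => j _.
  by rewrite sl sr kl kr mulNr mulrBr.
split; last by rewrite -s0; congr ('E_P[_]); apply/funext => w; rewrite E1.
transitivity ('E_P[fun w => cos (\sum_i s i * I (k i) w)%R]).
  by congr ('E_P[_]); apply/funext => w; rewrite E1.
rewrite c0; apply: (congr1 (fun z => expeR (- z))).
exact: (eq_modular leb alpha E2).
Qed.

Section Tail.
Variables a b : R.
Hypotheses (a0 : (0 < a)%R) (ab : (a <= b)%R).
Hypothesis malpha : lebesgue_measurable_fun alpha.
Hypothesis alphaab : forall x, (a <= alpha x <= b)%R.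

Lemma modular_cf_tail (X : T -> R) (g : R -> R) (l : R) :
  measurable_fun setT X -> lebesgue_measurable_fun g -> (0 < l)%R ->
  (forall t, 'E_P[fun w => cos (t * X w)%R] =
    expeR (- modular leb alpha (fun x => t * g x)%R)) ->
  P [set w | (l <= `|X w|)%R] <=
  (tail_constant a)%:E * modular leb alpha (fun x => g x / l)%R.
Proof.
move=> mX mg l0 cf; pose N (t : R) := modular leb alpha (fun x => t * g x)%R.
have -> : modular leb alpha (fun x => g x / l)%R = N l^-1%R.
  by apply: eq_modular => x; rewrite mulrC.
apply: (@cf_tail _ _ _ P X N a l a0 l0 mX _ cf); first by move=> t; exact: modular_ge0.
move=> s t /andP[s0 s1].
have := modularZ leb a0 malpha alphaab s (measurable_funM (measurable_cst t) mg).
have sn1 : (`|s| <= 1)%R by rewrite ger0_norm.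
rewrite (powmax_le1 a0 ab sn1) (ger0_norm s0) => /(le_trans _); apply.
rewrite le_eqVlt; apply/orP; left; apply/eqP.
by apply: eq_modular => x; rewrite -[LHS]mulrA.
Qed.

Let mI k : Falpha alpha k -> measurable_fun setT (I k).
Proof. exact: (proj1 HI). Qed.

Lemma multistable_tail1 (g : R -> R) (l : R) : Fab a b g -> (0 < l)%R ->
  P [set w | (l <= `|I g w|)%R] <=
  (tail_constant a)%:E * modular leb alpha (fun x => g x / l)%R.
Proof.
move=> Fg l0; have Ag := Fab_Falpha a0 ab malpha alphaab Fg.
apply: (modular_cf_tail (mI Ag) Fg.1 l0) => t.
have [h _] := proj2 HI 1%N (fun=> g) (fun=> t) (fun=> Ag).
have E1 w : (\sum_(j < 1) t * I g w = t * I g w)%R by rewrite big_ord1.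
have E2 x : (\sum_(j < 1) t * g x = t * g x)%R by rewrite big_ord1.
transitivity ('E_P[fun w => cos (\sum_(j < 1) t * I g w)%R]).
  by congr ('E_P[_]); apply/funext => w; rewrite E1.
rewrite h; apply: (congr1 (fun z => expeR (- z))).
exact: (eq_modular leb alpha E2).
Qed.

Lemma multistable_tail (g g' : R -> R) (c l : R) : Fab a b g -> Fab a b g' ->
  (0 < l)%R ->
  P [set w | (l <= `|(I g w - I g' w) / c|)%R] <=
  (tail_constant a)%:E * modular leb alpha (fun x => (g x - g' x) / c / l)%R.
Proof.
move=> Fg Fg' l0.
have Ag := Fab_Falpha a0 ab malpha alphaab Fg.
have Ag' := Fab_Falpha a0 ab malpha alphaab Fg'.
have mX : measurable_fun setT (fun w => (I g w - I g' w) / c)%R.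
  exact: (measurable_funM (measurable_funB (mI Ag) (mI Ag')) (measurable_cst _)).
have mD : lebesgue_measurable_fun (fun x => (g x - g' x) / c)%R.
  exact: (measurable_funM (measurable_funB Fg.1 Fg'.1) (measurable_cst _)).
apply: (modular_cf_tail mX mD l0) => t.
have [h _] := @multistable_cf 1 (fun=> g) (fun=> g') (fun=> t / c)%R
  (fun=> Ag) (fun=> Ag').
have E1 w : (\sum_(j < 1) t / c * (I g w - I g' w) = t * ((I g w - I g' w) / c))%R.
  by rewrite big_ord1; ring.
have E2 x : (\sum_(j < 1) t / c * (g x - g' x) = t * ((g x - g' x) / c))%R.
  by rewrite big_ord1; ring.
transitivity ('E_P[fun w => cos (\sum_(j < 1) t / c * (I g w - I g' w))%R]).
  by congr ('E_P[_]); apply/funext => w; rewrite E1.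
rewrite h; apply: (congr1 (fun z => expeR (- z))).
exact: (eq_modular leb alpha E2).
Qed.

End Tail.
End MultistableIntegral.

(** * Convergence to zero of [powmax] integrals under linear combinations *)

Section PowmaxCvg.
Context {d : measure_display} {X : measurableType d} {R : realType}.
Variable mu : {measure set X -> \bar R}.
Variables a b : R.
Hypotheses (a0 : 0 < a) (ab : a <= b) (b2 : b <= 2).
Local Open Scope ereal_scope.

Lemma cvge0P (f : nat -> \bar R) : (forall k, 0 <= f k) ->
  f k @[k --> \oo] --> 0 <->
  forall e : R, (0 < e)%R -> \forall k \near \oo, f k <= e%:E.
Proof.
move=> f0; split => [/fine_cvgP[ffin /cvgrPdist_le h] e e0|h].
  apply: filterS2 ffin (h e e0) => k fk.
  by rewrite sub0r normrN ger0_norm ?fine_ge0// -lee_fin fineK.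
apply/fine_cvgP; split.
  apply: filterS (h 1%R ltr01) => k fk.
  by rewrite ge0_fin_numE// (le_lt_trans fk)// ltry.
apply/cvgrPdist_le => e e0; apply: filterS (h e e0) => k fk.
have ffk : f k \is a fin_num by rewrite ge0_fin_numE// (le_lt_trans fk)// ltry.
by rewrite sub0r normrN ger0_norm ?fine_ge0// -lee_fin fineK.
Qed.

Let I0 g : 0 <= \int[mu]_x (powmax a b (g x))%:E.
Proof. by apply: integral_ge0 => x _; rewrite lee_fin powmax_ge0. Qed.

Lemma powmax_cvg0D (g k : nat -> X -> R) :
  (forall n, measurable_fun setT (g n)) -> (forall n, measurable_fun setT (k n)) ->
  \int[mu]_x (powmax a b (g n x))%:E @[n --> \oo] --> 0 ->
  \int[mu]_x (powmax a b (k n x))%:E @[n --> \oo] --> 0 ->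
  \int[mu]_x (powmax a b (g n x + k n x))%:E @[n --> \oo] --> 0.
Proof.
move=> mg mk /(cvge0P (fun n => I0 (g n))) hg /(cvge0P (fun n => I0 (k n))) hk.
apply/(cvge0P (fun n => I0 _)) => e e0.
have e80 : (0 < e / 8)%R by rewrite divr_gt0.
apply: filterS2 (hg _ e80) (hk _ e80) => n gn kn.
rewrite (le_trans (powmax_integralD mu a0 ab b2 (mg n) (mk n)))//.
have -> : e%:E = 4%:E * (e / 8)%:E + 4%:E * (e / 8)%:E.
  by rewrite -!EFinM -EFinD; congr (_%:E); field.
by apply: leeD; [apply: (lee_wpmul2l _ gn)|apply: (lee_wpmul2l _ kn)].
Qed.

Lemma powmax_cvg0Z (c : R) (g : nat -> X -> R) :
  (forall n, measurable_fun setT (g n)) ->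
  \int[mu]_x (powmax a b (g n x))%:E @[n --> \oo] --> 0 ->
  \int[mu]_x (powmax a b (c * g n x))%:E @[n --> \oo] --> 0.
Proof.
move=> mg /(cvge0P (fun n => I0 (g n))) hg.
apply/(cvge0P (fun n => I0 _)) => e e0.
have p0 := powmax_ge0 a b c.
have e1 : (0 < e / (powmax a b c + 1))%R by rewrite divr_gt0// ltr_wpDl.
apply: filterS (hg _ e1) => n gn.
rewrite (le_trans (powmax_integralZ mu a b c (mg n)))//.
apply: (@le_trans _ _ ((powmax a b c)%:E * (e / (powmax a b c + 1))%:E)).
  by apply: lee_wpmul2l.
rewrite -EFinM lee_fin mulrA ler_pdivrMr ?ltr_wpDl// mulrC.
by rewrite ler_wpM2l ?(ltW e0)// lerDl.
Qed.

Lemma powmax_cvg0_sum (I : Type) (s : seq I) (g : nat -> I -> X -> R) :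
  (forall n i, measurable_fun setT (g n i)) ->
  (forall i, \int[mu]_x (powmax a b (g n i x))%:E @[n --> \oo] --> 0) ->
  \int[mu]_x (powmax a b (\sum_(i <- s) g n i x)%R)%:E @[n --> \oo] --> 0.
Proof.
move=> mg hg; elim: s => [|i s ih].
  apply: cvg_near_cst; apply: nearW => n.
  rewrite integral0_eq// => x _; rewrite big_nil /powmax normr0 !powR0 ?maxxx//.
    by rewrite gt_eqF// (lt_le_trans a0 ab).
  by rewrite gt_eqF.
rewrite (_ : (fun n => _) = (fun n => \int[mu]_x
  (powmax a b (g n i x + \sum_(j <- s) g n j x)%R)%:E)); last first.
  by apply/funext => n; apply: eq_integral => x _; rewrite big_cons.
have ms n : measurable_fun setT (fun x => \sum_(j <- s) g n j x)%R.
  by apply: measurable_sum; exact: mg.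
exact: (@powmax_cvg0D (fun n => g n i) _ (fun n => mg n i) ms (hg i) ih).
Qed.

End PowmaxCvg.

(** * Convergence of the rescaled kernels *)

Section RescaledKernels.
Context {R : realType}.
Variables (a b : R) (alpha : R -> R) (f H : R -> R -> R) (h u : R).
Hypotheses (a0 : 0 < a) (ab : a <= b) (b2 : b <= 2).
Hypotheses (calpha : continuous alpha) (alphaab : forall x, a <= alpha x <= b).
Hypotheses (fab : forall t, Fab a b (f t)) (Hab : forall t, Fab a b (H t)).
Hypothesis lim_fH : forall t : R,
  (\int[leb]_z (powmax a b
     ((f (u + r * t) (u + r * z) - f u (u + r * z))
        / r `^ (h - (alpha (u + r * z))^-1) - H t z))%:E)%E
    @[r --> 0^'+] --> 0%E.

Let malpha := lebesgue_measurable_continuous calpha.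

Lemma FabZ (c : R) g : Fab a b g -> Fab a b (fun x => c * g x).
Proof. exact: (@finite_powmaxZ _ _ R leb a b c g). Qed.

Lemma FabD g k : Fab a b g -> Fab a b k -> Fab a b (fun x => g x + k x).
Proof. exact: (@finite_powmaxD _ _ R leb a b a0 ab b2 g k). Qed.

Lemma Fab_sum n (th : 'I_n -> R) (g : 'I_n -> R -> R) : (forall j, Fab a b (g j)) ->
  Fab a b (fun x => \sum_j th j * g j x).
Proof.
move=> Fg; apply: (@finite_powmax_sum _ _ R leb a b a0 ab b2 _ _ (fun j x => th j * g j x)).
by move=> j; exact: FabZ.
Qed.

Lemma FabB_div (c : R) g k : Fab a b g -> Fab a b k -> Fab a b (fun x => (g x - k x) / c).
Proof.
move=> Fg Fk.
have -> : (fun x => (g x - k x) / c) = (fun x => c^-1 * (g x + (- 1) * k x)).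
  by apply/funext => x; rewrite mulN1r mulrC.
exact: FabZ (FabD Fg (FabZ (- 1) Fk)).
Qed.

Let incr r v (x : R) := (f (u + r * v) x - f u x) / r `^ h.

Let scaled r v (z : R) := (f (u + r * v) (u + r * z) - f u (u + r * z))
  / r `^ (h - (alpha (u + r * z))^-1).

Let mscaled r v : 0 < r -> lebesgue_measurable_fun (scaled r v).
Proof.
move=> r0.
have mg : lebesgue_measurable_fun (fun z => f (u + r * v) (u + r * z) - f u (u + r * z)).
  apply: measurable_funB.
    exact: (lebesgue_measurable_aff u r0 (fab (u + r * v)).1).
  exact: (lebesgue_measurable_aff u r0 (fab u).1).
apply: (measurable_funM mg).
have -> : (fun z => (r `^ (h - (alpha (u + r * z))^-1))^-1) =
    (fun z => r `^ ((alpha (u + r * z))^-1 - h)).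
  by apply/funext => z; rewrite -powRN opprB.
apply: (measurableT_comp (measurable_powRr r)).
apply: measurable_funB; last exact: measurable_cst.
have calphaV : continuous (fun z => (alpha z)^-1).
  by move=> z; apply: cvgV; [exact: (al_neq0 a0 alphaab)|exact: calpha].
exact: (lebesgue_measurable_aff u r0 (lebesgue_measurable_continuous calphaV)).
Qed.

Let modular_scaled n (t th : 'I_n -> R) r : 0 < r ->
  modular leb alpha (fun x => \sum_j th j * incr r (t j) x) =
  modular leb (fun z => alpha (u + r * z)) (fun z => \sum_j th j * scaled r (t j) z).
Proof.
move=> r0; pose g x := \sum_j th j * (f (u + r * t j) x - f u x).
have mg : lebesgue_measurable_fun g.
  apply: measurable_sum => j; apply: (measurable_funM (measurable_cst _)).
  exact: (measurable_funB (fab (u + r * t j)).1 (fab u).1).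
have -> : (fun x => \sum_j th j * incr r (t j) x) = (fun x => g x / r `^ h).
  by apply/funext => x; rewrite /g mulr_suml; apply: eq_bigr => j _; rewrite mulrA.
rewrite (modular_rescale a0 malpha alphaab h u r0 mg); apply: eq_modular => z.
by rewrite /g mulr_suml; apply: eq_bigr => j _; rewrite mulrA.
Qed.

Lemma increments_modular_cvg n (t th : 'I_n -> R) :
  fine (modular leb alpha (fun x => \sum_j th j * ((f (u + r * t j) x - f u x) / r `^ h)))
    @[r --> 0^'+] -->
  fine (modular leb (fun=> alpha u) (fun z => \sum_j th j * H (t j) z)).
Proof.
(* [modular_cvg] rests on dominated convergence, a statement about sequences, so r runs through an
   arbitrary positive sequence tending to 0. *)
apply/cvg_at_rightP => r_ [r0 rto0].
have FS := Fab_sum th (fun j => Hab (t j)).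
have malu : lebesgue_measurable_fun (fun=> alpha u) by exact: measurable_cst.
have fin : modular leb (fun=> alpha u) (fun z => \sum_j th j * H (t j) z) \is a fin_num.
  rewrite ge0_fin_numE; last exact: modular_ge0.
  exact: (Fab_modular_lty a0 malu (fun=> alphaab u) FS).
suff : modular leb alpha (fun x => \sum_j th j * incr (r_ k) (t j) x)
    @[k --> \oo] --> modular leb (fun=> alpha u) (fun z => \sum_j th j * H (t j) z).
  by rewrite -(fineK fin) => /fine_cvgP[].
rewrite (_ : (fun k => _) = (fun k => modular leb (fun z => alpha (u + r_ k * z))
    (fun z => \sum_j th j * scaled (r_ k) (t j) z))); last first.
  by apply/funext => k; exact: modular_scaled.
have mS k : lebesgue_measurable_fun (fun z => \sum_j th j * scaled (r_ k) (t j) z).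
  apply: measurable_sum => j; apply: (measurable_funM (measurable_cst _)).
  exact: mscaled.
have mal k := lebesgue_measurable_aff u (r0 k) malpha.
apply: (@modular_cvg _ _ _ leb a b a0 b2 _ _ _ _ mal malu _ (fun=> alphaab u) _ mS FS).
- by move=> k x; exact: alphaab.
- move=> x; have ur : (u + r_ k * x) @[k --> \oo] --> u.
    rewrite -[X in _ --> X]addr0 -[X in _ --> _ + X](mul0r x).
    by apply: cvgD; [exact: cvg_cst|exact: cvgMr_tmp].
  exact: (cvg_comp _ _ ur (@calpha u)).
rewrite (_ : (fun k => _) = (fun k => (\int[leb]_z (powmax a b (\sum_j
    th j * (scaled (r_ k) (t j) z - H (t j) z)))%:E)%E)); last first.
  apply/funext => k; apply: eq_integral => z _; rewrite -sumrB.
  by congr ((powmax a b _)%:E); apply: eq_bigr => j _; rewrite mulrBr.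
have mD k j : lebesgue_measurable_fun (fun z => scaled (r_ k) (t j) z - H (t j) z).
  exact: (measurable_funB (mscaled (t j) (r0 k)) (Hab (t j)).1).
apply: (@powmax_cvg0_sum _ _ R leb a b a0 ab b2 _ _
  (fun k j z => th j * (scaled (r_ k) (t j) z - H (t j) z))).
  by move=> k j; exact: (measurable_funM (measurable_cst _) (mD k j)).
move=> j; apply: (@powmax_cvg0Z _ _ R leb a b (th j)
  (fun k z => scaled (r_ k) (t j) z - H (t j) z)).
  by move=> k; exact: mD.
apply: (cvg_comp r_ _ _ (lim_fH (t j))) => A hA.
have hk : \forall k \near \oo, 0 < r_ k -> A (r_ k) := rto0 _ hA.
by apply: filterS hk => k; apply; exact: r0.
Qed.
End RescaledKernels.

(** * From increment conditions to geometric tails *)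

Section GeometricTail.
Context {R : realType} {d : measure_display} {T : measurableType d}.
Variable P : probability T R.
Variables (b kappa : R).
Hypotheses (b0 : 0 < b) (kappa1 : 1 < kappa).

(* With rho ^ (- b) = 2 ^ ((kappa - 1) / 2), the 2 ^ k increments of order
   2 ^ (- k) exceed rho ^ k with total probability at most
   (2 rho ^ (- b) 2 ^ (- kappa)) ^ k = 2 ^ (- k (kappa - 1) / 2). *)
Definition chain_rho : R := 2 `^ (- ((kappa - 1) / (2 * b))).

Definition chain_q : R := chain_rho `^ (- b) * 2 `^ (- kappa).

Lemma chain_rho_gt0 : 0 < chain_rho. Proof. exact: powR_gt0. Qed.

Lemma chain_rho_lt1 : chain_rho < 1.
Proof.
have k0 : 0 < (kappa - 1) / (2 * b) by rewrite divr_gt0 ?subr_gt0// mulr_gt0.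
by have /andP[] := powR2N_lt1 k0.
Qed.

Lemma chain_q_ge0 : 0 <= chain_q. Proof. by rewrite mulr_ge0// powR_ge0. Qed.

Lemma chain_q_lt1 : 2 * chain_q < 1.
Proof.
have two : (2 : R) = 2 `^ 1 by rewrite powRr1.
have n2 : (2 : R) != 0 by [].
have -> : 2 * chain_q = 2 `^ (- ((kappa - 1) / 2)).
  rewrite /chain_q /chain_rho -powRrM {1}two -!powRD ?n2 ?implybT//.
  by congr (_ `^ _); field; rewrite gt_eqF.
have k0 : 0 < (kappa - 1) / 2 by rewrite divr_gt0 ?subr_gt0.
by have /andP[] := powR2N_lt1 k0.
Qed.

(** For l <= 1 the largest power l^(-p) with p in [a, b] is l^(-b); the thresholds rho^k of chaining
    all lie in this range. *)
Definition increment_tail (X : R -> T -> R) (A : set R) (C : R) : Prop :=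
  forall t v, A t -> A v -> forall l, 0 < l <= 1 ->
  (P [set w | (l <= `|X t w - X v w|)%R] <= (C * (l `^ (- b) * `|t - v| `^ kappa))%:E)%E.

Lemma increment_tail_geometric X (N : nat) C : 0 <= C ->
  increment_tail X [set t | - N%:R <= t <= N%:R] C ->
  geometric_tail P X N C chain_rho chain_q.
Proof.
move=> C0 h k t v tN vN tv.
have r0 := chain_rho_gt0; have r1 := chain_rho_lt1.
have lk : 0 < chain_rho ^+ k <= 1 by rewrite exprn_gt0// exprn_ile1// ltW.
apply: (le_trans (h t v tN vN _ lk)); rewrite lee_fin ler_wpM2l//.
have E1 : (chain_rho ^+ k) `^ (- b) = (chain_rho `^ (- b)) ^+ k.
  by rewrite -powR_mulrn ?ltW// powRAC powR_mulrn// powR_ge0.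
have E2 : (2 ^- k) `^ kappa = (2 `^ (- kappa)) ^+ k :> R.
  rewrite -powR_invn// -powRrM -[RHS]powR_mulrn ?powR_ge0// -powRrM.
  by rewrite mulNr mulNr mulrC.
rewrite E1 exprMn ler_wpM2l ?exprn_ge0 ?powR_ge0// -E2.
by apply: le_powR2r => //; exact: le_trans (ltW kappa1).
Qed.

End GeometricTail.

Section ModularControl.
Context {R : realType}.
Variables (a b : R).
Hypotheses (a0 : 0 < a) (ab : a <= b) (b2 : b <= 2).
Local Open Scope ereal_scope.

(** A common target for both increment conditions, which also passes to the limit kernel. Truncation
    at 1 is harmless when bounding probabilities. It lets a norm bound m act through (m / l)^a even
    when m > l, where the modular itself is only controlled by (m / l)^b. *)
Definition modular_control (al : R -> R) (g : R -> R -> R) (kappa : R) (A : set R) (C : R) :=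
  forall t v, A t -> A v -> forall l : R, (0 < l <= 1)%R ->
  mine 1 (modular leb al (fun x => (g t x - g v x) / l)%R) <=
    (C * (l `^ (- b) * `|t - v| `^ kappa))%:E.

Let b0 : (0 < b)%R. Proof. exact: lt_le_trans a0 ab. Qed.

Lemma inv_powR_le (l : R) : (0 < l <= 1)%R -> (l `^ (- a) <= l `^ (- b))%R.
Proof. by move=> l01; rewrite ger_powR// lerN2. Qed.

Section Tail.
Context {d : measure_display} {T : measurableType d} (P : probability T R).
Variables (al : R -> R) (I : (R -> R) -> T -> R).
Hypothesis HI : multistable_integral P al I.
Hypothesis mal : lebesgue_measurable_fun al.
Hypothesis alab : forall x, (a <= al x <= b)%R.

(** The summand 1 in the constant serves the case of a modular above 1: there the truncated bound is
    at least 1 and hence exceeds any probability. *)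
Lemma control_tail (F : R -> R -> R) (c kappa : R) (A : set R) (C : R) :
  (forall t, Fab a b (F t)) ->
  modular_control al (fun t x => F t x / c)%R kappa A C ->
  increment_tail P b kappa (fun t w => I (F t) w / c)%R A ((tail_constant a + 1) * C)%R.
Proof.
move=> FF h t v At Av l l01; have /andP[l0 l1] := l01.
have tc0 := tail_constant_gt0 a0.
have := multistable_tail HI a0 ab mal alab c (FF t) (FF v) l0.
have := h t v At Av l l01.
have -> : (fun x => (F t x / c - F v x / c) / l)%R = (fun x => (F t x - F v x) / c / l)%R.
  by apply/funext => x; rewrite -mulrBl.
have -> : [set w | (l <= `|(I (F t) w - I (F v) w) / c|)%R] =
    [set w | (l <= `|I (F t) w / c - I (F v) w / c|)%R].
  by apply/funext => w /=; rewrite mulrBl.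
set m := modular _ _ _; set z := (_ * _ `^ kappa)%R.
have m0 : 0 <= m by exact: modular_ge0.
move: m m0 => m m0 hm hP.
have [m1|m1] := leP m 1.
  rewrite (min_r m1) in hm.
  apply: (le_trans hP); apply: (@le_trans _ _ ((tail_constant a + 1)%:E * m)).
    by apply: lee_wpmul2r => //; rewrite lee_fin lerDl.
  by rewrite -mulrA EFinM lee_wpmul2l// lee_fin addr_ge0// ltW.
rewrite (min_l (ltW m1)) lee_fin in hm.
apply: (@le_trans _ _ 1).
  apply: probability_le1.
  have mI k : Fab a b k -> measurable_fun setT (I k).
    by move=> Fk; apply: (proj1 HI); exact: (Fab_Falpha a0 ab mal alab).
  apply: measurable_norm_ge.
  apply: (measurable_funB (measurable_funM (mI _ (FF t)) (measurable_cst _))).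
  exact: (measurable_funM (mI _ (FF v)) (measurable_cst _)).
rewrite lee_fin -mulrA -[leLHS](mulr1 1%R) ler_pM//.
by rewrite lerDr ltW.
Qed.

End Tail.

Section Increments.
Variables (alpha : R -> R) (f : R -> R -> R) (h u : R).
Hypotheses (malpha : lebesgue_measurable_fun alpha) (alphaab : forall x, (a <= alpha x <= b)%R).
Hypothesis fab : forall t, Fab a b (f t).

Let F r (t x : R) := (f (u + r * t) x / r `^ h)%R.

Let FD r t v : (fun x => F r t x - F r v x)%R = (fun x => (f (u + r * t) x - f (u + r * v) x) / r `^ h)%R.
Proof. by apply/funext => x; rewrite mulrBl. Qed.

Let FabF r t v : Fab a b (fun x => F r t x - F r v x)%R.
Proof. by rewrite FD; exact: (FabB_div a0 ab b2). Qed.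

Let modular00 (l : R) r t : modular leb alpha (fun x => (F r t x - F r t x) / l)%R = 0.
Proof.
apply: integral0_eq => x _; rewrite subrr mul0r normr0 powR0//.
exact: (al_neq0 a0 alphaab).
Qed.

Lemma norm_increments_control (eta c r : R) (A : set R) : (0 < c)%R ->
  norm_increments alpha f h u eta A c r ->
  modular_control alpha (F r) (a * eta) A (c `^ a)%R.
Proof.
move=> c0 hn t v At Av l l01; have /andP[l0 l1] := l01.
have [->|tv] := eqVneq t v.
  by rewrite modular00 min_r ?lee01// lee_fin !mulr_ge0// powR_ge0.
have tv0 : (0 < `|t - v|)%R by rewrite normr_gt0 subr_eq0.
pose m := (c * `|t - v| `^ eta)%R.
have m0 : (0 < m)%R by rewrite mulr_gt0// powR_gt0.
have mE : ((m / l) `^ a = c `^ a * (l `^ (- a) * `|t - v| `^ (a * eta)))%R.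
  rewrite powRM ?invr_ge0 ?(ltW m0) ?(ltW l0)// powRM ?powR_ge0 ?(ltW c0)//.
  by rewrite -powR_inv1 ?(ltW l0)// -!powRrM mulN1r (mulrC eta); ring.
have h1 : ((m / l) `^ a <= c `^ a * (l `^ (- b) * `|t - v| `^ (a * eta)))%R.
  by rewrite mE !ler_wpM2l ?powR_ge0// ler_wpM2r ?powR_ge0// inv_powR_le.
apply: le_trans (_ : ((m / l) `^ a)%:E <= _); last by rewrite lee_fin.
(* If l < m then (m / l)^a >= 1 and the truncation suffices; otherwise the factor m / l is at most 1
   and scaling costs the power [a]. *)
have [lm|ml] := ltP l m.
  rewrite ge_min; apply/orP; left; rewrite lee_fin.
  rewrite -[leLHS](_ : 1 `^ a = 1)%R; last by rewrite powR1.
  apply: le_powR2r; [exact: ltW|exact: ler01|].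
  by rewrite ler_pdivlMr// mul1r ltW.
rewrite ge_min; apply/orP; right.
have Fm := Fnorm_le_modular a0 ab malpha alphaab m0 (FabF r t v).
have /Fm Dm : Fnorm alpha (fun x => F r t x - F r v x)%R <= m%:E by rewrite FD; exact: hn.
have mD : lebesgue_measurable_fun (fun x => (F r t x - F r v x) / m)%R.
  exact: (measurable_funM (FabF r t v).1 (measurable_cst _)).
have -> : modular leb alpha (fun x => (F r t x - F r v x) / l)%R =
    modular leb alpha (fun x => (m / l) * ((F r t x - F r v x) / m))%R.
  by apply: eq_modular => x; field; rewrite !gt_eqF.
apply: (le_trans (modularZ leb a0 malpha alphaab (m / l) mD)).
have ml0 : (0 <= m / l)%R by rewrite divr_ge0// ltW.
have ml1 : (`|m / l| <= 1)%R by rewrite ger0_norm// ler_pdivrMr// mul1r.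
rewrite (powmax_le1 a0 ab ml1) (ger0_norm ml0) -[leRHS]mule1.
by apply: (lee_wpmul2l _ Dm); rewrite lee_fin powR_ge0.
Qed.

Lemma integral_increments_modular (kappa c r : R) (A : set R) : (0 < r)%R ->
  integral_increments alpha f h u kappa A c r -> forall t v, A t -> A v ->
  modular leb alpha (fun x => F r t x - F r v x)%R <= (c * `|t - v| `^ kappa)%:E.
Proof.
move=> r0 hi t v At Av; rewrite FD.
have mg : lebesgue_measurable_fun (fun x => f (u + r * t) x - f (u + r * v) x)%R.
  exact: (measurable_funB (fab (u + r * t)).1 (fab (u + r * v)).1).
rewrite (modular_rescale a0 malpha alphaab h u r0 mg).
exact: hi.
Qed.

Let powmax_inv (l : R) : (0 < l <= 1)%R -> powmax a b l^-1 = (l `^ (- b))%R.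
Proof.
move=> /andP[l0 l1].
have li0 : (0 < l^-1)%R by rewrite invr_gt0.
rewrite powmax_ge1 ?ab// gtr0_norm//; last by rewrite invf_ge1.
by rewrite -powR_inv1 ?(ltW l0)// -powRrM mulN1r.
Qed.

Lemma integral_increments_control (kappa c r : R) (A : set R) : (0 < r)%R -> (0 < c)%R ->
  integral_increments alpha f h u kappa A c r ->
  modular_control alpha (F r) kappa A c.
Proof.
move=> r0 c0 hi t v At Av l l01.
have Dm := integral_increments_modular r0 hi At Av.
rewrite ge_min; apply/orP; right.
have -> : modular leb alpha (fun x => (F r t x - F r v x) / l)%R =
    modular leb alpha (fun x => l^-1 * (F r t x - F r v x))%R.
  by apply: eq_modular => x; rewrite mulrC.
apply: (le_trans (modularZ leb a0 malpha alphaab l^-1 (FabF r t v).1)).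
rewrite (powmax_inv l01) mulrCA EFinM.
by apply: (lee_wpmul2l _ Dm); rewrite lee_fin powR_ge0.
Qed.

(** By the unit-ball description it is enough that max(m^(-a), m^(-b)) c tau^kappa <= 1 for m = c'
    tau^(kappa / b) and tau = |t - v|. The power b cancels tau exactly; the power a leaves a
    nonnegative power of tau, bounded through the diameter L. *)
Lemma integral_increments_norm (kappa c L : R) : (0 < kappa)%R -> (0 < c)%R -> (0 < L)%R ->
  exists2 c' : R, (0 < c')%R & forall (A : set R) r, (0 < r)%R ->
    (forall t v, A t -> A v -> `|t - v| <= L)%R ->
    integral_increments alpha f h u kappa A c r ->
    norm_increments alpha f h u (kappa / b) A c' r.
Proof.
move=> kappa0 c0 L0.
(* [c1] is what the power b requires of c', and [c2], the a-th root of [cL], what the power a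
   requires. *)
pose c1 := (c `^ b^-1)%R; pose cL := (c * L `^ (kappa - a * (kappa / b)))%R.
have cL0 : (0 < cL)%R by rewrite mulr_gt0// powR_gt0.
pose c2 := (cL `^ a^-1)%R.
have c10 : (0 < c1)%R by rewrite powR_gt0.
have c20 : (0 < c2)%R by rewrite powR_gt0.
have k0 : (0 <= kappa - a * (kappa / b))%R.
  by rewrite mulrCA subr_ge0 ger_pMr// ler_pdivrMr// mul1r.
exists (Num.max c1 c2); first by rewrite lt_max c10.
set c' := Num.max c1 c2; have c'0 : (0 < c')%R by rewrite lt_max c10.
have c'b : (c <= c' `^ b)%R.
  rewrite -[leLHS](_ : c1 `^ b = c)%R.
    by apply: le_powR2r; [exact: ltW|exact: ltW|rewrite le_max lexx].
  by rewrite -powRrM mulVf ?gt_eqF// powRr1// ltW.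
have c'a : (cL <= c' `^ a)%R.
  rewrite -[leLHS](_ : c2 `^ a = cL)%R.
    by apply: le_powR2r; [exact: ltW|exact: ltW|rewrite le_max lexx orbT].
  by rewrite -powRrM mulVf ?gt_eqF// powRr1// ltW.
move=> A r r0 AL hi t v At Av; rewrite -FD.
have [->|tv] := eqVneq t v.
  have -> : (fun x => F r v x - F r v x)%R = (fun=> 0%R) by apply/funext => x; rewrite subrr.
  by rewrite Fnorm0 lee_fin mulr_ge0 ?powR_ge0// ltW.
have tv0 : (0 < `|t - v|)%R by rewrite normr_gt0 subr_eq0.
have tvL := AL t v At Av.
set tau := `|t - v|%R in tv0 tvL *.
have m0 : (0 < c' * tau `^ (kappa / b))%R by rewrite mulr_gt0// powR_gt0.
set m := (c' * _)%R in m0 *.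
apply: (modular_le_Fnorm a0 ab malpha alphaab m0 (FabF r t v)).
have Dm := integral_increments_modular r0 hi At Av; rewrite -/tau in Dm.
have -> : modular leb alpha (fun x => (F r t x - F r v x) / m)%R =
    modular leb alpha (fun x => m^-1 * (F r t x - F r v x))%R.
  by apply: eq_modular => x; rewrite mulrC.
apply: (le_trans (modularZ leb a0 malpha alphaab m^-1 (FabF r t v).1)).
apply: (@le_trans _ _ ((powmax a b m^-1)%:E * (c * tau `^ kappa)%:E)).
  by apply: (lee_wpmul2l _ Dm); rewrite lee_fin powmax_ge0.
have mi0 : (0 < m^-1)%R by rewrite invr_gt0.
have tk0 : (0 < c * tau `^ kappa)%R by rewrite mulr_gt0// powR_gt0.
have mp p : ((m^-1 `^ p) = (c' `^ p)^-1 * (tau `^ (p * (kappa / b)))^-1)%R.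
  rewrite -[m^-1%R]powR_inv1 ?(ltW m0)// -powRrM mulN1r powRN /m powRM ?powR_ge0 ?(ltW c'0)//.
  by rewrite invfM -powRrM (mulrC (kappa / b)%R).
rewrite -EFinM lee_fin /powmax gtr0_norm// maxr_pMl ?(ltW tk0)// ge_max.
apply/andP; split; rewrite mp.
  rewrite -mulrA ler_pdivrMl ?powR_gt0// mulr1 (le_trans _ c'a)//.
  rewrite mulrCA /cL ler_wpM2l ?(ltW c0)// mulrC -powRB; last first.
    by rewrite [tau == _]gt_eqF// implybT.
  by apply: le_powR2r => //; exact: ltW.
have -> : (b * (kappa / b) = kappa)%R by field; rewrite gt_eqF.
rewrite -mulrA ler_pdivrMl ?powR_gt0// mulr1.
by rewrite mulrCA mulVf ?gt_eqF ?powR_gt0// mulr1.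
Qed.

End Increments.
End ModularControl.

(** * Finite-dimensional convergence and bounds for the limit process *)

Section FiniteDimensional.
Context {R : realType}.
Context {d d' : measure_display} {T : measurableType d} {T' : measurableType d'}.
Variables (P : probability T R) (P' : probability T' R).
Variables (a b : R) (alpha : R -> R).
Variables (I : (R -> R) -> T -> R) (I' : (R -> R) -> T' -> R).
Variables (f H : R -> R -> R) (h u : R).
Hypotheses (a0 : 0 < a) (ab : a <= b) (b2 : b <= 2).
Hypotheses (calpha : continuous alpha) (alphaab : forall x, a <= alpha x <= b).
Hypotheses (HI : multistable_integral P alpha I)
  (HI' : multistable_integral P' (fun=> alpha u) I').
Hypotheses (fab : forall t, Fab a b (f t)) (Hab : forall t, Fab a b (H t)).
Hypothesis lim_fH : forall t : R,
  (\int[leb]_z (powmax a b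
     ((f (u + r * t) (u + r * z) - f u (u + r * z))
        / r `^ (h - (alpha (u + r * z))^-1) - H t z))%:E)%E
    @[r --> 0^'+] --> 0%E.

Let malpha := lebesgue_measurable_continuous calpha.
Let malphau : lebesgue_measurable_fun (fun=> alpha u). Proof. exact: measurable_cst. Qed.
Let alphauab : forall x : R, a <= alpha u <= b. Proof. by []. Qed.
Let Af t : Falpha alpha (f t). Proof. exact: (Fab_Falpha a0 ab malpha alphaab (fab t)). Qed.
Let AH t : Falpha (fun=> alpha u) (H t).
Proof. exact: (Fab_Falpha a0 ab malphau alphauab (Hab t)). Qed.
Let mI t : measurable_fun setT (I (f t)). Proof. exact: (proj1 HI). Qed.
Let mI' t : measurable_fun setT (I' (H t)). Proof. exact: (proj1 HI'). Qed.

Let X := rescaled_process (fun t => I (f t)) h u.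
Let mX r t : measurable_fun setT (X r t).
Proof. exact: measurable_rescaled_process. Qed.

Let Nr n (t th : 'I_n -> R) r :=
  modular leb alpha (fun x => \sum_j th j * ((f (u + r * t j) x - f u x) / r `^ h)).

Let N' n (t th : 'I_n -> R) := modular leb (fun=> alpha u) (fun z => \sum_j th j * H (t j) z).

Let Nr_fin n (t th : 'I_n -> R) r : Nr t th r \is a fin_num.
Proof.
rewrite ge0_fin_numE; last exact: modular_ge0.
apply: (Fab_modular_lty a0 malpha alphaab).
by apply: (Fab_sum a0 ab b2) => j; exact: (FabB_div a0 ab b2).
Qed.

Let N'_fin n (t th : 'I_n -> R) : N' t th \is a fin_num.
Proof.
rewrite ge0_fin_numE; last exact: modular_ge0.
by apply: (Fab_modular_lty a0 malphau alphauab); exact: (Fab_sum a0 ab b2).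
Qed.

Let dot_rescaled n (t th : 'I_n -> R) r w :
  \sum_j th j / r `^ h * (I (f (u + r * t j)) w - I (f u) w) =
  dot th (\row_j X r (t j) w).
Proof. by apply: eq_bigr => j _; rewrite mxE /X /rescaled_process; ring. Qed.

Let cf_rescaled n (t th : 'I_n -> R) r :
  mean P (fun w => cos (dot th (\row_j X r (t j) w))) =
    expR (- fine (Nr t th r)) /\
  mean P (fun w => sin (dot th (\row_j X r (t j) w))) = 0.
Proof.
have [c0 s0] := multistable_cf HI (fun j => th j / r `^ h)
  (fun j => Af (u + r * t j)) (fun=> Af u).
have md : measurable_fun setT (fun w => dot th (\row_j X r (t j) w)).
  apply: measurable_dot => j; under eq_fun do rewrite mxE.
  exact: mX.
have -> : (fun w => cos (dot th (\row_j X r (t j) w))) =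
    (fun w => cos (\sum_j th j / r `^ h * (I (f (u + r * t j)) w - I (f u) w))).
  by apply/funext => w; rewrite dot_rescaled.
have -> : (fun w => sin (dot th (\row_j X r (t j) w))) =
    (fun w => sin (\sum_j th j / r `^ h * (I (f (u + r * t j)) w - I (f u) w))).
  by apply/funext => w; rewrite dot_rescaled.
have ms : measurable_fun setT
    (fun w => \sum_j th j / r `^ h * (I (f (u + r * t j)) w - I (f u) w)).
  by rewrite (funext (dot_rescaled t th r)).
split; apply: EFin_inj.
  rewrite -expectation_mean; last exact: bounded_rv_cos.
  rewrite c0 -[RHS]/(expeR (- (fine (Nr t th r))%:E)) (fineK (Nr_fin t th r)).
  apply: (congr1 (fun z => expeR (- z)))%E; apply: eq_modular => x.
  by apply: eq_bigr => j _; ring.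
by rewrite -expectation_mean; [exact: s0|exact: bounded_rv_sin].
Qed.

Let cf_limit n (t th : 'I_n -> R) :
  mean P' (fun w => cos (dot th (\row_j I' (H (t j)) w))) = expR (- fine (N' t th)) /\
  mean P' (fun w => sin (dot th (\row_j I' (H (t j)) w))) = 0.
Proof.
have [c0 s0] := proj2 HI' n (fun j => H (t j)) th (fun j => AH (t j)).
have E w : \sum_j th j * I' (H (t j)) w = dot th (\row_j I' (H (t j)) w).
  by apply: eq_bigr => j _; rewrite mxE.
have md : measurable_fun setT (fun w => dot th (\row_j I' (H (t j)) w)).
  by apply: measurable_dot => j; under eq_fun do rewrite mxE; exact: mI'.
split; apply: EFin_inj.
  rewrite -expectation_mean; last exact: bounded_rv_cos.
  rewrite -[RHS]/(expeR (- (fine (N' t th))%:E)) (fineK (N'_fin t th)).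
  rewrite -[RHS]c0; congr ('E_P'[_])%E; apply/funext => w; by rewrite E.
rewrite -expectation_mean; last exact: bounded_rv_sin.
rewrite -[RHS]s0; congr ('E_P'[_])%E; apply/funext => w; by rewrite E.
Qed.

Let Nr_cvg n (t th : 'I_n -> R) : fine (Nr t th r) @[r --> 0^'+] --> fine (N' t th).
Proof. exact: (increments_modular_cvg a0 ab b2 calpha alphaab fab Hab lim_fH). Qed.

Lemma rescaled_tight n (t : 'I_n -> R) (e : R) : 0 < e -> exists2 K : R, 0 < K &
  (\forall r \near (0 : R)^'+, forall j,
    (P [set w | (K <= `|(\row_j X r (t j) w) 0 j|)%R] <= e%:E)%E) /\
  (forall j, (P' [set w | (K <= `|(\row_j I' (H (t j)) w) 0 j|)%R] <= e%:E)%E).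
Proof.
move=> e0; have tc0 := tail_constant_gt0 a0.
pose n1 j := fine (@N' 1 (fun=> t j) (fun=> 1)).
have n10 j : 0 <= n1 j by apply: fine_ge0; exact: modular_ge0.
(* A common bound for the modulars of all coordinates: those of the limit, and, by the slack 1,
   those of the rescaled increments for small r. *)
pose B := \sum_j n1 j + 1.
have n1B j : n1 j + 1 <= B by rewrite /B lerD2r (bigD1 j)//= lerDl sumr_ge0.
have B0 : 0 < B by rewrite /B ltr_wpDl// sumr_ge0.
(* Chosen so that [tail_constant a * B] is at most e K^a; K >= 1 makes scaling by 1/K cost only the
   power [a]. *)
pose K := Num.max 1 ((tail_constant a * B / e) `^ a^-1).
have K1 : 1 <= K by rewrite /K le_max lexx.
have K0 : 0 < K by exact: lt_le_trans K1.
have Ka : tail_constant a * B / e <= K `^ a.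
  have z0 : 0 <= tail_constant a * B / e.
    by apply: divr_ge0; [apply: mulr_ge0; exact: ltW|exact: ltW].
  rewrite -[leLHS](_ : ((tail_constant a * B / e) `^ a^-1) `^ a = _); last first.
    by rewrite -powRrM mulVf ?gt_eqF// powRr1.
  by apply: le_powR2r; [exact: ltW|exact: powR_ge0|rewrite /K le_max lexx orbT].
have key (al g : R -> R) : lebesgue_measurable_fun al -> (forall x, a <= al x <= b) ->
    lebesgue_measurable_fun g -> (modular leb al g <= B%:E)%E ->
    ((tail_constant a)%:E * modular leb al (fun x => (g x / K)%R) <= e%:E)%E.
  move=> mal alab mg gB.
  have -> : modular leb al (fun x => g x / K)%R = modular leb al (fun x => K^-1 * g x)%R.
    by apply: eq_modular => x; rewrite mulrC.
  have Ki : `|K^-1| <= 1 by rewrite gtr0_norm ?invr_gt0// invf_le1.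
  have := modularZ leb a0 mal alab K^-1 mg; rewrite (powmax_le1 a0 ab Ki) => hm.
  apply: (@le_trans _ _ ((tail_constant a)%:E * ((`|K^-1| `^ a)%R%:E * B%:E))%E).
    apply: lee_wpmul2l; first by rewrite lee_fin ltW.
    by apply: (le_trans hm); apply: (lee_wpmul2l _ gB); rewrite lee_fin powR_ge0.
  rewrite -!EFinM lee_fin gtr0_norm ?invr_gt0// -powR_inv1 ?(ltW K0)// -powRrM mulN1r powRN.
  rewrite mulrCA ler_pdivrMl ?powR_gt0// -ler_pdivrMr//.
exists K => //; split.
  have near_j j : \forall r \near (0 : R)^'+,
      (modular leb alpha (fun x => ((f (u + r * t j) x - f u x) / r `^ h)%R) <= B%:E)%E.
    have n1lt : n1 j < n1 j + 1 by rewrite ltrDl.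
    have hn := @cvgr_le _ _ _ (at_right_proper_filter 0) _ _ (@Nr_cvg 1 (fun=> t j) (fun=> 1)) _ n1lt.
    apply: filterS hn => r; rewrite -lee_fin (fineK (Nr_fin _ _ _)) => hr.
    rewrite (_ : modular _ _ _ = @Nr 1 (fun=> t j) (fun=> 1) r); last first.
      by apply: eq_modular => x; rewrite big_ord1 mul1r.
    by apply: (le_trans hr); rewrite lee_fin n1B.
  have nj := @filter_forall _ _ _ _ (at_right_proper_filter (0 : R)) near_j.
  apply: filterS nj => r hr j.
  have mg : lebesgue_measurable_fun (fun x => (f (u + r * t j) x - f u x) / r `^ h).
    by have [] := FabB_div a0 ab b2 (r `^ h) (fab (u + r * t j)) (fab u).
  have -> : [set w | (K <= `|(\row_j0 X r (t j0) w) 0 j|)%R] =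
      [set w | (K <= `|(I (f (u + r * t j)) w - I (f u) w) / r `^ h|)%R].
    by apply/funext => w /=; rewrite mxE.
  apply: (le_trans (multistable_tail HI a0 ab malpha alphaab _ (fab _) (fab _) K0)).
  exact: (key _ _ malpha alphaab mg (hr j)).
move=> j.
have -> : [set w | (K <= `|(\row_j0 I' (H (t j0)) w) 0 j|)%R] =
    [set w | (K <= `|I' (H (t j)) w|)%R].
  by apply/funext => w /=; rewrite mxE.
apply: (le_trans (multistable_tail1 HI' a0 ab malphau alphauab (Hab _) K0)).
apply: (key _ _ malphau alphauab (Hab (t j)).1).
have -> : modular leb (fun=> alpha u) (H (t j)) = (n1 j)%:E.
  rewrite /n1 (fineK (N'_fin _ _)); apply: eq_modular => x.
  by rewrite big_ord1 mul1r.
by rewrite lee_fin (le_trans _ (n1B j))// lerDl.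
Qed.

Lemma rescaled_lipschitz_cvg n (t : 'I_n -> R) (phi : 'rV[R]_n -> R) (M L : R) :
  (forall x, `|phi x| <= M) -> 0 <= L ->
  (forall x y, `|phi x - phi y| <= L * l1dist x y) ->
  mean P (fun w => phi (\row_j X r (t j) w)) @[r --> 0^'+] -->
  mean P' (fun w => phi (\row_j I' (H (t j)) w)).
Proof.
move=> phiM L0 phiL.
apply: (@mean_lipschitz_cvg R n R (0 : R)^'+ _ _ _ _ _ P P'
  (fun r w => \row_j X r (t j) w) (fun w => \row_j I' (H (t j)) w)
  _ _ _ _ (rescaled_tight t) phi M L phiM L0 phiL).
- move=> r j; under eq_fun do rewrite mxE; exact: mX.
- move=> j; under eq_fun do rewrite mxE; exact: mI'.
- move=> th; rewrite (cf_limit t th).1.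
  rewrite (_ : (fun r => _) = (fun r => expR (- fine (Nr t th r)))); last first.
    by apply/funext => r; rewrite (cf_rescaled t th r).1.
  have nn : - fine (Nr t th r) @[r --> 0^'+] --> - fine (N' t th).
    by apply: cvgN; exact: Nr_cvg.
  exact: (cvg_comp _ _ nn (@continuous_expR R _)).
- move=> th; rewrite (cf_limit t th).2.
  rewrite (_ : (fun r => _) = (fun=> 0)); first exact: cvg_cst.
  by apply/funext => r; rewrite (cf_rescaled t th r).2.
Qed.

(** The difference over l is a combination with coefficients 1/l and -1/l, so its modular converges.
    When the bound is below 1 the truncation is inactive and the inequality passes to the limit;
    otherwise there is nothing to prove. *)
Lemma control_limit (kappa C : R) (A : set R) :
  (\forall r \near (0 : R)^'+,
    modular_control b alpha (fun t x => f (u + r * t) x / r `^ h) kappa A C) ->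
  modular_control b (fun=> alpha u) H kappa A C.
Proof.
move=> hr t v At Av l l01; set z := (C * _).
pose t2 (j : 'I_2) := if j == 0 then t else v.
pose th2 (j : 'I_2) := if j == 0 then l^-1 else - l^-1.
have EN r : modular leb alpha (fun x => (f (u + r * t) x / r `^ h - f (u + r * v) x / r `^ h) / l)
    = Nr t2 th2 r.
  apply: eq_modular => x; rewrite !big_ord_recl big_ord0 /= /t2 /th2/=.
  by ring.
have EN' : modular leb (fun=> alpha u) (fun x => (H t x - H v x) / l) = N' t2 th2.
  apply: eq_modular => x; rewrite !big_ord_recl big_ord0 /= /t2 /th2/=.
  by ring.
rewrite EN' -(fineK (N'_fin t2 th2)).
have [z1|z1] := leP 1 z; first by rewrite ge_min lee_fin z1.
rewrite ge_min; apply/orP; right; rewrite lee_fin.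
apply: (cvgr_to_le (Nr_cvg (t := t2) (th := th2))).
apply: filterS hr => r /(_ t v At Av l l01).
rewrite EN -(fineK (Nr_fin t2 th2 r)) -/z ge_min !lee_fin => /orP[|//].
by rewrite leNgt z1.
Qed.

End FiniteDimensional.

(** * Localisability on a neighbourhood and on the whole line *)

Section Tails.
Context {R : realType}.
Context {d d' : measure_display} {T : measurableType d} {T' : measurableType d'}.
Variables (P : probability T R) (P' : probability T' R).
Variables (a b : R) (alpha : R -> R).
Variables (I : (R -> R) -> T -> R) (I' : (R -> R) -> T' -> R).
Variables (f H : R -> R -> R) (h u : R).
Hypotheses (a0 : 0 < a) (ab : a <= b) (b2 : b <= 2).
Hypotheses (calpha : continuous alpha) (alphaab : forall x, a <= alpha x <= b).
Hypotheses (HI : multistable_integral P alpha I)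
  (HI' : multistable_integral P' (fun=> alpha u) I').
Hypotheses (fab : forall t, Fab a b (f t)) (Hab : forall t, Fab a b (H t)).
Hypothesis lim_fH : forall t : R,
  (\int[leb]_z (powmax a b
     ((f (u + r * t) (u + r * z) - f u (u + r * z))
        / r `^ (h - (alpha (u + r * z))^-1) - H t z))%:E)%E
    @[r --> 0^'+] --> 0%E.
Variable kappa : R.
Hypothesis kappa1 : 1 < kappa.

Let Y := fun t => I (f t).
Let Y' := fun t => I' (H t).
Let rho := chain_rho b kappa.
Let q := chain_q b kappa.
Let b0 : 0 < b. Proof. exact: lt_le_trans a0 ab. Qed.
Let rho0 : 0 < rho. Proof. exact: chain_rho_gt0. Qed.
Let rho1 : rho < 1. Proof. exact: chain_rho_lt1. Qed.
Let q0 : 0 <= q. Proof. exact: chain_q_ge0. Qed.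
Let q1 : 2 * q < 1. Proof. exact: chain_q_lt1. Qed.
Let malpha := lebesgue_measurable_continuous calpha.
Let malphau : lebesgue_measurable_fun (fun=> alpha u). Proof. exact: measurable_cst. Qed.
Let alphauab : forall x : R, a <= alpha u <= b. Proof. by []. Qed.
Let mY t : measurable_fun setT (Y t).
Proof. by apply: (proj1 HI); exact: (Fab_Falpha a0 ab malpha alphaab (fab t)). Qed.
Let mY' t : measurable_fun setT (Y' t).
Proof. by apply: (proj1 HI'); exact: (Fab_Falpha a0 ab malphau alphauab (Hab t)). Qed.

Let control r N C := modular_control b alpha (fun t x => f (u + r * t) x / r `^ h) kappa
  [set t | - N%:R <= t <= N%:R] C.

Let tc1 : 0 <= tail_constant a + 1.
Proof. by rewrite addr_ge0// ltW// tail_constant_gt0. Qed.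

Lemma control_rescaled_tail r (N : nat) C : 0 <= C -> control r N C ->
  geometric_tail P (rescaled_process Y h u r) N ((tail_constant a + 1) * C) rho q.
Proof.
move=> C0 hr; apply: (increment_tail_geometric b0 kappa1 (mulr_ge0 tc1 C0)).
have tl := control_tail a0 ab HI malpha alphaab (F := fun t => f (u + r * t))
  (fun t => fab _) hr.
move=> t v At Av l l01; apply: le_trans (tl t v At Av l l01).
suff -> : [set w | (l <= `|rescaled_process Y h u r t w - rescaled_process Y h u r v w|)%R] =
  [set w | (l <= `|I (f (u + r * t)) w / r `^ h - I (f (u + r * v)) w / r `^ h|)%R] by [].
by apply/funext => w /=; rewrite /rescaled_process -!mulrBl opprB addrA subrK.
Qed.

Lemma control_limit_tail (N : nat) C : 0 <= C -> (\forall r \near 0^'+, control r N C) ->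
  geometric_tail P' Y' N ((tail_constant a + 1) * C) rho q.
Proof.
move=> C0 hr; apply: (increment_tail_geometric b0 kappa1 (mulr_ge0 tc1 C0)).
have hl := control_limit a0 ab b2 calpha alphaab fab Hab lim_fH hr.
have hl1 : modular_control b (fun=> alpha u) (fun t x => H t x / 1) kappa
    [set t | - N%:R <= t <= N%:R] C.
  by rewrite (_ : (fun t x => H t x / 1) = H)//;
    apply/funext => t; apply/funext => x; rewrite divr1.
have := control_tail a0 ab HI' malphau alphauab Hab hl1.
by rewrite (_ : (fun t w => I' (H t) w / 1) = Y')//;
  apply/funext => t; apply/funext => x; rewrite divr1.
Qed.

Let lipschitz_cvg := rescaled_lipschitz_cvg a0 ab b2 calpha alphaab HI HI' fab Hab lim_fH.

Lemma multistable_localisable : localisable P P' h u Y Y'.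
Proof. exact: (localisable_lipschitz mY mY' lipschitz_cvg). Qed.

Lemma strongly_localisable_near :
  (forall N, exists2 C, 0 <= C & \forall r \near 0^'+, control r N C) ->
  (exists2 V, nbhs u V & strongly_localisable V P P' h u Y Y') /\
  ((exists Z, continuous_version_on P setT Y Z) -> strongly_localisable setT P P' h u Y Y').
Proof.
move=> ctl.
have tails N : exists2 C, 0 <= C &
    (\forall r \near 0^'+, geometric_tail P (rescaled_process Y h u r) N C rho q) /\
    geometric_tail P' Y' N C rho q.
  have [C C0 hC] := ctl N; exists ((tail_constant a + 1) * C); first exact: mulr_ge0.
  split; last exact: control_limit_tail.
  by apply: filterS hC => r; exact: control_rescaled_tail.
have strong V Z := @strongly_localisable_version _ _ _ _ _ _ _ _ _ _ _ _ _
  mY mY' rho0 rho1 q0 q1 lipschitz_cvg tails V Z.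
split; last by move=> [Z YZ]; apply: (strong setT Z) => //; exact: filterT.
(* The rescaled times [-1, 1] for one admissible r describe Y on |t - u| <= r, which is the
   neighbourhood obtained. *)
have [C C0 [tl _]] := tails 1.
have rpos : \forall r \near (0 : R)^'+, 0 < r by exact: nbhs_right_gt.
have [r [r0 tr]] := @filter_ex _ _ (at_right_proper_filter (0 : R)) _ (filterI rpos tl).
have [V nV [Z YZ]] := continuous_version_local mY rho0 rho1 q0 q1 r0 C0 tr.
by exists V => //; exact: strong YZ.
Qed.

Lemma strongly_localisable_uniform (r0 : R) : 0 < r0 ->
  (forall N, exists2 C, 0 <= C & forall r, 0 < r < r0 -> control r N C) ->
  strongly_localisable setT P P' h u Y Y'.
Proof.
move=> r00 ctl.
have [_ strong] : (exists2 V, nbhs u V & strongly_localisable V P P' h u Y Y') /\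
    ((exists Z, continuous_version_on P setT Y Z) -> strongly_localisable setT P P' h u Y Y').
  apply: strongly_localisable_near => N; have [C C0 hC] := ctl N; exists C => //.
  have rpos : \forall r \near (0 : R)^'+, 0 < r by exact: nbhs_right_gt.
  have rr0 : \forall r \near (0 : R)^'+, r < r0 by exact: nbhs_right_lt.
  by apply: filterS2 rpos rr0 => r p1 p2; apply: hC; rewrite p1.
(* [r0 / 2] is admissible for every interval, so a single rescaled process satisfies tail bounds on
   all of them and gives a version on the whole line. *)
apply: strong; apply: (continuous_version_global mY rho0 rho1 q0 q1 (r := r0 / 2)).
  by rewrite divr_gt0.
move=> N; have [C C0 hC] := ctl N; exists ((tail_constant a + 1) * C); first exact: mulr_ge0.
by apply: (control_rescaled_tail C0); apply: hC; lra.
Qed.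

End Tails.

Lemma bounded_interval_sym {R : realType} (N : nat) :
  bounded_interval [set t : R | - N%:R <= t <= N%:R].
Proof.
split; last first.
  exists N%:R; split; first exact: num_real.
  by move=> x Nx t /= tN; rewrite (le_trans _ (ltW Nx))// ler_norml.
move=> x y /= /andP[x1 x2] /andP[y1 y2] z /andP[xz zy].
by rewrite (le_trans x1 xz) (le_trans zy y2).
Qed.

Lemma bounded_set_diameter {R : realType} (A : set R) : bounded_set A ->
  exists2 L : R, 0 < L & forall t v, A t -> A v -> `|t - v| <= L.
Proof.
move=> [M [_ AM]].
have M1 : M < `|M| + 1 by rewrite ltr_pwDr// ler_norm.
exists (2 * (`|M| + 1)); first by rewrite mulr_gt0// ltr_wpDl.
move=> t v At Av; apply: (le_trans (ler_normB _ _)).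
by have := AM _ M1 _ At; have := AM _ M1 _ Av; rewrite /=; lra.
Qed.

Theorem theorem3p2 (R : realType) (a b : R) (alpha : R -> R)
    (d d' : measure_display) (T : measurableType d) (T' : measurableType d')
    (P : probability T R) (P' : probability T' R)
    (I : (R -> R) -> T -> R) (I' : (R -> R) -> T' -> R)
    (f H : R -> R -> R) (h u : R) :
  0 < a -> a <= b -> b <= 2 ->
  continuous alpha ->
  (forall x, a <= alpha x <= b) ->
  multistable_integral P alpha I ->
  multistable_integral P' (fun=> alpha u) I' ->
  (forall t, Fab a b (f t)) ->
  jointly_measurable_fun H ->
  (forall t, Fab a b (H t)) ->
  (forall t : R,
    (\int[leb]_z (powmax a b
       ((f (u + r * t) (u + r * z) - f u (u + r * z))
          / r `^ (h - (alpha (u + r * z))^-1) - H t z))%:E)%E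
      @[r --> 0^'+] --> 0%E) ->
  let Y := fun t => I (f t) in
  let Y' := fun t => I' (H t) in
  let strong := fun V => strongly_localisable V P P' h u Y Y' in
  localisable P P' h u Y Y' /\
  forall eta : R, a^-1 < eta ->
    [/\ on_bounded_intervals (norm_increments alpha f h u eta) ->
          (exists2 V, nbhs u V & strong V) /\
          ((exists Z, continuous_version_on P setT Y Z) -> strong setT),
        uniformly_on_bounded_intervals (norm_increments alpha f h u eta) ->
          strong setT,
        on_bounded_intervals (integral_increments alpha f h u (a * eta)) ->
          [/\ on_bounded_intervals (norm_increments alpha f h u (a * eta / b)),
              exists2 V, nbhs u V & strong V &
              (exists Z, continuous_version_on P setT Y Z) -> strong setT] &
        uniformly_on_bounded_intervals
            (integral_increments alpha f h u (a * eta)) ->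
          uniformly_on_bounded_intervals
            (norm_increments alpha f h u (a * eta / b)) /\
          strong setT].
Proof.
move=> a0 ab b2 calpha alphaab HI HI' fab _ Hab lim_fH Y Y' strong.
split; first exact: (multistable_localisable a0 ab b2 calpha alphaab HI HI' fab Hab lim_fH).
move=> eta aeta.
have malpha := lebesgue_measurable_continuous calpha.
(* Both conditions enter chaining with kappa = a eta: the norm condition after raising to the power
   [a], the integral condition as it stands rather than through the weaker norm bound it implies. *)
have kappa1 : 1 < a * eta by rewrite -ltr_pdivrMl// mulr1.
have kappa0 : 0 < a * eta by exact: lt_trans ltr01 kappa1.
have rpos : \forall r \near (0 : R)^'+, 0 < r by exact: nbhs_right_gt.
have near_strong := strongly_localisable_near a0 ab b2 calpha alphaab HI HI' fab Hab lim_fH kappa1.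
have uniform_strong r0 := @strongly_localisable_uniform _ _ _ _ _ _ _ _ _ _ _ _ _ _ _ _
  a0 ab b2 calpha alphaab HI HI' fab Hab lim_fH _ kappa1 r0.
have norm_control := @norm_increments_control R a b a0 ab b2 alpha f h u malpha alphaab fab.
have integral_control := @integral_increments_control R a b a0 ab b2 alpha f h u malpha alphaab fab.
have integral_norm := @integral_increments_norm R a b a0 ab b2 alpha f h u malpha alphaab fab.
split.
- move=> hn; apply: near_strong => N.
  have [c c0 hc] := hn _ (bounded_interval_sym N); exists (c `^ a); first exact: powR_ge0.
  by apply: filterS hc => r; exact: norm_control.
- move=> [r0 r00 hn]; apply: (uniform_strong r0 r00) => N.
  have [c c0 hc] := hn _ (bounded_interval_sym N); exists (c `^ a); first exact: powR_ge0.
  by move=> r /hc; exact: norm_control.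
- move=> hi.
  have [loc glob] : (exists2 V, nbhs u V & strong V) /\
      ((exists Z, continuous_version_on P setT Y Z) -> strong setT).
    apply: near_strong => N.
    have [c c0 hc] := hi _ (bounded_interval_sym N); exists c; first exact: ltW.
    by apply: filterS2 rpos hc => r r0; exact: integral_control.
  split => // A bA; have [c c0 hc] := hi _ bA; have [L L0 AL] := bounded_set_diameter bA.2.
  have [c' c'0 hc'] := integral_norm _ _ _ kappa0 c0 L0; exists c' => //.
  by apply: filterS2 rpos hc => r r0; exact: hc'.
move=> [r0 r00 hi]; split; last first.
  apply: (uniform_strong r0 r00) => N.
  have [c c0 hc] := hi _ (bounded_interval_sym N); exists c; first exact: ltW.
  by move=> r r0r; have /andP[rp _] := r0r; exact: integral_control rp c0 (hc r r0r).
exists r0 => // A bA; have [c c0 hc] := hi _ bA; have [L L0 AL] := bounded_set_diameter bA.2.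
have [c' c'0 hc'] := integral_norm _ _ _ kappa0 c0 L0; exists c' => //.
by move=> r r0r; have /andP[rp _] := r0r; exact: hc' rp AL (hc r r0r).
Qed.
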